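(* Let $\{\mathcal I_\tau\}_{\tau\in\mathbb Z}$ be a collection of families of bounded intervals in $\mathbb R$ such that, for positive integers $N_\tau$, $$\sum_{I\in\mathcal I_\tau}\mathbf 1_I\le N_\tau\qquad\text{for each }\tau.$$ For each $\tau$ and $I\in\mathcal I_\tau$ let $m_{\tau,I}:\mathbb R\to\mathbb C$ be supported in $I$ and suppose there exists $\xi_{\tau,I}\in I$ such that $m_{\tau,I}(\cdot+\xi_{\tau,I})$ is a Hörmander–Mihlin multiplier, with $\sup_{\tau,I}\|m_{\tau,I}(\cdot+\xi_{\tau,I})\|_{\mathrm{HM}(\mathbb R)}\le1$. Let $\vec f=\{f_{\tau,I}\}_{\tau,I}$ be functions and $\{F_{\tau,I}\}_{\tau,I}$ be nonnegative functions on $\mathbb R$ such that, for each $\tau$ and $I\in\mathcal I_\tau$, $$|f_{\tau,I}|\lesssim\phi_{|I|^{-1}}*F_{\tau,I}$$ with an absolute implicit constant. Then $$\sup_{\alpha>0}\alpha\left|\left\{x\in\mathbb R:\left(\sum_\tau\Big|\sum_{I\in\mathcal I_\tau}T_{m_{\tau,I}}f_{\tau,I}(x)\Big|^2\right)^{1/2}>\alpha\right\}\right|\lesssim\int_{\mathbb R}\left(\sum_\tau N_\tau\sum_{I\in\mathcal I_\tau}|F_{\tau,I}|^2\right)^{1/2},$$ with an absolute implicit constant.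
   Context: $\phi(x)=(1+|x|^2)^{-3/4}$ for $x\in\mathbb R$, and for $t>0$, $\phi_t(x)=t^{-1}\phi(t^{-1}x)$. $T_m$ is the Fourier multiplier operator with symbol $m$, $\widehat{T_mf}=m\hat f$. For a one-dimensional Hörmander–Mihlin multiplier $m:\mathbb R\to\mathbb C$, $\|m\|_{\mathrm{HM}(\mathbb R)}=\sup_{j=0,1}\sup_{\xi\ne0}|\xi|^j|\partial^jm(\xi)|$. $A\lesssim B$ means $A\le CB$. *)

(* Defs.v *)
From HB Require Import structures.
From mathcomp Require Import all_boot all_order all_algebra finmap.
From mathcomp Require Import all_classical all_reals all_analysis.
From mathcomp.analysis.showcase Require Import summability.
From mathcomp Require Import complex.
Set Implicit Arguments.
Unset Strict Implicit.
Unset Printing Implicit Defensive.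
Import Order.TTheory GRing.Theory Num.Theory.
Import numFieldNormedType.Exports.
Local Open Scope classical_set_scope.
Local Open Scope complex_scope.
Local Open Scope ring_scope.

(* There is no normed module structure on [R[i]] over [R]: measurability,
   integration and differentiation of functions [R -> R[i]] are taken on real
   and imaginary parts, and the modulus is [Normc.normc], with values
   in [R]. *)
Section ComplexValued.
Context {R : realType}.
Implicit Types (f : R -> R[i]) (j : nat) (x : R).
Local Notation mu := (@lebesgue_measure R).

Definition cmod (z : R[i]) : R := Normc.normc z.

Definition cmeasurable f : Prop :=
  measurable_fun [set: R] (fun x : R => complex.Re (f x)) /\
  measurable_fun [set: R] (fun x : R => complex.Im (f x)).

Definition cintegral f : R[i] :=
  Rintegral mu [set: R] (fun x : R => complex.Re (f x))
  +i* Rintegral mu [set: R] (fun x : R => complex.Im (f x)).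

Definition cderivable f x : Prop :=
  derivable (fun y : R => complex.Re (f y)) x 1 /\
  derivable (fun y : R => complex.Im (f y)) x 1.

Definition cderive j f x : R[i] :=
  derive1n j (fun y : R => complex.Re (f y)) x
  +i* derive1n j (fun y : R => complex.Im (f y)) x.

Definition expi (t : R) : R[i] := cos t +i* sin t.

End ComplexValued.

Section FourierMultipliers.
Context {R : realType}.
Implicit Types (f m : R -> R[i]) (x xi : R).

Definition fourier f xi : R[i] :=
  cintegral (fun x => f x * expi (- (2 * pi * x * xi))).

(* Inverse Fourier transform of [m * fourier f]. The integral is absolutely
   convergent when [f] is integrable and [m] is bounded and measurable with
   bounded support. *)
Definition multiplier_op m f x : R[i] :=
  cintegral (fun xi => m xi * fourier f xi * expi (2 * pi * x * xi)).

Definition HM_norm m : \bar R :=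
  ereal_sup [set y | exists j xi, [/\ (j <= 1)%N, xi != 0 &
    y = (`|xi| ^+ j * cmod (cderive j m xi))%:E]].

Definition HM_multiplier m : Prop :=
  (forall xi, xi != 0 -> cderivable m xi) /\ (HM_norm m < +oo)%E.

End FourierMultipliers.

Section Majorants.
Context {R : realType}.
Implicit Types (t x : R) (g h : R -> R) (I : interval R).
Local Notation mu := (@lebesgue_measure R).

Definition phi x : R := (1 + `|x| ^+ 2) `^ (- (3 / 4)).

Definition dilate t g x : R := t^-1 * g (t^-1 * x).

(* Convolution of nonnegative functions, with values in [0, +oo]. *)
Definition convolution g h x : \bar R := (\int[mu]_y (g (x - y) * h y)%:E)%E.

Definition itv_length I : R := fine (mu [set` I]).

End Majorants.

Section FamilySums.
Context {R : realType}.
Local Notation mu := (@lebesgue_measure R).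

Definition cvg_in_measure (K : Type) (G : set_system K)
    (h : K -> R -> R[i]) (g : R -> R[i]) : Prop :=
  forall e : R, 0 < e ->
    (fun k => mu [set x | e < cmod (h k x - g x)]) @ G --> 0%E.

(* [g] is the sum over [j : J] of the [h j]: the partial sums over finite
   subsets of [J], directed by inclusion, converge to [g] in measure. For finite
   [J] this says that [g] is the finite sum almost everywhere. *)
Definition sums_to (J : choiceType) (h : J -> R -> R[i]) (g : R -> R[i]) :
    Prop :=
  cmeasurable g /\
  cvg_in_measure totally (fun (A : {fset J}) x => \sum_(j <- A) h j x) g.

Definition weakL1 (S : R -> \bar R) : \bar R :=
  ereal_sup [set (alpha%:E * mu [set x | (alpha%:E < S x)%E])%E
            | alpha in [set alpha : R | 0 < alpha]].

End FamilySums.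

(* Main.v *)
Require Import Defs.
From HB Require Import structures.
From mathcomp Require Import all_boot all_order all_algebra finmap.
From mathcomp Require Import all_classical all_reals all_analysis.
From mathcomp.analysis.showcase Require Import summability.
From mathcomp Require Import complex measurable_realfun.
From mathcomp Require Import ring lra.
Set Implicit Arguments.
Unset Strict Implicit.
Unset Printing Implicit Defensive.
Import Order.TTheory GRing.Theory Num.Theory.
Import numFieldNormedType.Exports.
Local Open Scope classical_set_scope.
Local Open Scope ring_scope.

(* By duality with Plancherel, a sum of multipliers whose supports have overlap at
   most N loses only a factor N in the square of its L^2 norm. For the weak type
   bound one runs a Calderon-Zygmund decomposition on the scalar function
   G = (sum_tau N_tau sum_I F_I^2)^(1/2) at height alpha, which yields blocks B
   of length l_B carrying mass about alpha l_B. The piece of f_I coming from B is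
   left alone when l_B <= |I|^-1, since f_I is then already smooth at the scale of
   B: phi_{|I|^-1} is essentially constant on B. When l_B > |I|^-1, the multiple
   of exp(2 pi i xi_I x) on B with the same Fourier coefficient at xi_I is
   subtracted from it. The remaining good part is controlled in L^2 by
   alpha int G. The bad pieces have Fourier transform vanishing at xi_I, which
   compensates the singularity of m_I there; comparing the L^2 norm of T b with
   that of its modulation-weighted version (a finite difference on the Fourier
   side) on dyadic annuli around B gives L^1 bounds away from B, with the weight
   N_tau again produced by the overlap.
   For infinite families, nearly maximizing int (N_tau sum_{I in A} F_I^2)^(1/2)
   over finite A makes the remaining sums small in measure, and the estimate
   passes to the limit. *)

(** * Integration *)

(** The decay exponent of phi carries the treatment of the bad pieces: |x| phi_t(x) is bounded
    uniformly in t. A piece of mass V kept within distance O(l) of its centre c thus has int |x -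
    c|^2 |b|^2 of order V^2 l, although its plain L^2 norm blows up as t tends to 0. This weighted
    norm is what a finite difference of m times the transform of b asks for when it falls on the
    second factor; when it falls on m, the zero at xi_I is used. Since |f_I| is only bounded by a
    convolution, f_I has no localization of its own. It is shared among grid cells in proportion to
    the terms of its majorant; the parts then carry the masses of F_I, and Minkowski's inequality in
    a weighted l^2 space lets all families act through the one scalar G. The hard estimates concern
    finitely many bounded functions of compact support on a finite grid. The stopping time is then a
    finite bisection, and the upper half of Plancherel's identity suffices. General f_I are
    recovered by approximation in L^1, which is enough because each m_I is bounded with bounded
    support. *)

Ltac meas := repeat first
  [ assumption
  | exact: measurable_cst
  | exact: measurable_id
  | apply: measurable_funD
  | apply: measurable_funB
  | apply: measurable_funM
  | apply: measurable_funN
  | apply: measurable_funX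
  | apply: measurable_maxr
  | apply: measurable_minr ].

Section Nint.
Context {R : realType}.
Local Notation mu := (@lebesgue_measure R).
Implicit Types f g : R -> R.

Definition nint g : \bar R := (\int[mu]_x (g x)%:E)%E.

Lemma nint_ge0 f : (forall x, 0 <= f x) -> (0 <= nint f)%E.
Proof. by move=> f0; apply: integral_ge0 => x _; rewrite lee_fin. Qed.

(** The integral of a nonnegative function is a supremum over the simple functions below it, which
    gives monotonicity for arbitrary functions. It is applied to right-hand sides containing sums
    over arbitrary index types. *)
Lemma le_integral_nonmeasurable (f g : R -> \bar R) :
  (forall x, 0 <= f x)%E -> (forall x, f x <= g x)%E ->
  (\int[mu]_x f x <= \int[mu]_x g x)%E.
Proof.
move=> f0 fg; have g0 x : (0 <= g x)%E by exact: le_trans (fg x).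
rewrite !ge0_integralTE//; apply: le_ereal_sup => _ [h hf <-].
by exists h => // x; exact: le_trans (fg x).
Qed.

Lemma le_nint f g : (forall x, 0 <= f x) -> (forall x, f x <= g x) ->
  (nint f <= nint g)%E.
Proof. by move=> f0 fg; apply: le_integral_nonmeasurable => x; rewrite lee_fin. Qed.

Lemma nintD f g : measurable_fun setT f -> measurable_fun setT g ->
  (forall x, 0 <= f x) -> (forall x, 0 <= g x) ->
  nint (fun x => f x + g x) = (nint f + nint g)%E.
Proof.
move=> mf mg f0 g0; rewrite /nint -ge0_integralD//.
- by move=> x _; rewrite lee_fin.
- exact/measurable_EFinP.
- by move=> x _; rewrite lee_fin.
- exact/measurable_EFinP.
Qed.

Lemma nintZ f (c : R) : measurable_fun setT f -> (forall x, 0 <= f x) ->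
  0 <= c -> nint (fun x => c * f x) = (c%:E * nint f)%E.
Proof.
move=> mf f0 c0; rewrite /nint -ge0_integralZl_EFin//.
- by move=> x _; rewrite lee_fin.
- exact/measurable_EFinP.
Qed.

Lemma nint_sum (I : Type) (s : seq I) (f : I -> R -> R) :
  (forall i, measurable_fun setT (f i)) -> (forall i x, 0 <= f i x) ->
  nint (fun x => \sum_(i <- s) f i x) = (\sum_(i <- s) nint (f i))%E.
Proof.
move=> mf f0; rewrite /nint -ge0_integral_sum//.
- by apply: eq_integral => x _; rewrite sumEFin.
- by move=> i; apply/measurable_EFinP; exact: mf.
- by move=> i x _; rewrite lee_fin.
Qed.

Definition translate (c : R) (x : measurableTypeR R) : measurableTypeR R :=
  (x : R) + c.

Lemma measurable_translate (c : R) : measurable_fun setT (translate c).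
Proof. by apply: measurable_funD; [exact: measurable_id|exact: measurable_cst]. Qed.

HB.instance Definition _ (c : R) :=
  isMeasurableFun.Build _ _ _ _ (translate c) (@measurable_translate c).

(** The pushforward agrees with Lebesgue measure on half-open intervals, and these determine it. *)
Lemma lebesgue_measure_translate (c : R) (A : set R) : measurable A ->
  pushforward mu (translate c) A = mu A.
Proof.
move=> mA; apply/esym/lebesgue_measure_unique => //= _ [[a b]] _ <-.
rewrite /pushforward.
have -> : translate c @^-1` `]a, b] = `]a - c, b - c]%classic.
  apply/seteqP; split => x /=; rewrite /translate !in_itv/= => /andP[h1 h2];
  apply/andP; split; lra.
rewrite !lebesgue_measure_itv/= !lte_fin ltrD2r.
by case: ifP => // _; rewrite -!EFinB; congr EFin; ring.
Qed.

Lemma integral_translate (f : R -> \bar R) (c : R) :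
  measurable_fun setT f -> (forall x, 0 <= f x)%E ->
  (\int[mu]_x f (x + c)%R = \int[mu]_x f x)%E.
Proof.
move=> mf f0.
transitivity (\int[pushforward mu (translate c)]_x f x)%E.
  by rewrite ge0_integral_pushforward//=; exact: measurable_translate.
by apply: eq_measure_integral => A mA _; exact: lebesgue_measure_translate.
Qed.

Lemma nint_translate f (c : R) :
  measurable_fun setT f -> (forall x, 0 <= f x) ->
  nint (fun x => f (x + c)) = nint f.
Proof.
move=> mf f0; apply: (@integral_translate (fun x => (f x)%:E)).
  exact/measurable_EFinP.
by move=> x; rewrite lee_fin.
Qed.

Lemma nint_indic (A : set R) : measurable A -> nint \1_A = mu A.
Proof. by move=> mA; rewrite /nint integral_indic// setIT. Qed.

Lemma nint_fin f (M : R) : (forall x, 0 <= f x) -> (nint f <= M%:E)%E ->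
  exists2 v, 0 <= v & nint f = v%:E.
Proof.
move=> f0 fM; have := nint_ge0 f0; case: (nint f) fM => [r|//|//] _ r0.
by exists r => //; rewrite -lee_fin.
Qed.

End Nint.

(** * Complex modulus, measurability and integration of complex functions *)

Section ComplexModulus.
Context {R : realType}.
Implicit Types (z w : R[i]) (t : R).

Lemma cmodE z : cmod z ^+ 2 = complex.Re z ^+ 2 + complex.Im z ^+ 2.
Proof. by case: z => a b; rewrite /cmod /= sqr_sqrtr// addr_ge0 ?sqr_ge0. Qed.

Lemma cmod_ge0 z : 0 <= cmod z.
Proof. by case: z => a b; rewrite /cmod /= sqrtr_ge0. Qed.

Lemma cmod0 : cmod (0 : R[i]) = 0.
Proof. exact: Normc.normc0. Qed.

Lemma cmod0_eq0 z : cmod z = 0 -> z = 0.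
Proof. exact: Normc.eq0_normc. Qed.

Lemma cmodM z w : cmod (z * w) = cmod z * cmod w.
Proof. exact: Normc.normcM. Qed.

Lemma cmodD z w : cmod (z + w) <= cmod z + cmod w.
Proof. exact: le_normcD. Qed.

Lemma cmodN z : cmod (- z) = cmod z.
Proof. exact: normcN. Qed.

Lemma cmodB z w : cmod (z - w) <= cmod z + cmod w.
Proof. by rewrite -(cmodN w) cmodD. Qed.

Lemma cmodC z w : cmod (z - w) = cmod (w - z).
Proof. by rewrite -cmodN opprB. Qed.

Lemma cmod_real t : cmod (real_complex R t) = `|t|.
Proof. by rewrite /cmod /= expr0n /= addr0 sqrtr_sqr. Qed.

Lemma cmod_sum (I : Type) (s : seq I) (F : I -> R[i]) :
  cmod (\sum_(i <- s) F i) <= \sum_(i <- s) cmod (F i).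
Proof.
elim: s => [|i s ih]; first by rewrite !big_nil cmod0.
by rewrite !big_cons; apply: le_trans (cmodD _ _) _; rewrite lerD2l.
Qed.

Lemma normRe_le_cmod z : `|complex.Re z| <= cmod z.
Proof.
rewrite -(@ler_pXn2r _ 2)// ?nnegrE ?normr_ge0 ?cmod_ge0//.
by rewrite cmodE real_normK ?num_real// lerDl sqr_ge0.
Qed.

Lemma normIm_le_cmod z : `|complex.Im z| <= cmod z.
Proof.
rewrite -(@ler_pXn2r _ 2)// ?nnegrE ?normr_ge0 ?cmod_ge0//.
by rewrite cmodE real_normK ?num_real// lerDr sqr_ge0.
Qed.

Lemma Re_le_cmod z : complex.Re z <= cmod z.
Proof. by apply: le_trans (normRe_le_cmod z); rewrite ler_norm. Qed.

Lemma cmod_le_Re_Im z : cmod z <= `|complex.Re z| + `|complex.Im z|.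
Proof.
rewrite -(@ler_pXn2r _ 2)// ?nnegrE ?addr_ge0 ?normr_ge0 ?cmod_ge0//.
rewrite cmodE sqrrD !real_normK ?num_real// -addrA lerD2l lerDr.
by rewrite mulrn_wge0// mulr_ge0.
Qed.

Lemma ReD z w : complex.Re (z + w) = complex.Re z + complex.Re w.
Proof. by case: z; case: w. Qed.

Lemma ImD z w : complex.Im (z + w) = complex.Im z + complex.Im w.
Proof. by case: z; case: w. Qed.

Lemma ReM z w : complex.Re (z * w) =
  complex.Re z * complex.Re w - complex.Im z * complex.Im w.
Proof. by case: z; case: w. Qed.

Lemma ImM z w : complex.Im (z * w) =
  complex.Re z * complex.Im w + complex.Im z * complex.Re w.
Proof. by case: z; case: w. Qed.

Lemma cmod_conj z : cmod (conjc z) = cmod z.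
Proof. by case: z => a b; rewrite /cmod /= sqrrN. Qed.

Lemma mul_conjc z : z * conjc z = real_complex R (cmod z ^+ 2).
Proof.
case: z => a b; rewrite cmodE; apply/eqP; rewrite eq_complex /=.
by apply/andP; split; apply/eqP; ring.
Qed.

(** Cauchy-Schwarz that counts the nonzero terms only. This is how the overlap enters: at a given
    frequency at most N multipliers are nonzero. *)
Lemma cmod_sum_sqr (I : Type) (s : seq I) (F : I -> R[i]) (M : R) :
  \sum_(i <- s) ((F i != 0)%:R : R) <= M ->
  cmod (\sum_(i <- s) F i) ^+ 2 <= M * \sum_(i <- s) cmod (F i) ^+ 2.
Proof.
move=> sM; set n := (X in X <= M) in sM.
have n0 : 0 <= n by apply: sumr_ge0.
set q := \sum_(i <- s) cmod (F i) ^+ 2.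
have q0 : 0 <= q by apply: sumr_ge0 => i _; rewrite sqr_ge0.
set a := \sum_(i <- s) cmod (F i).
have a0 : 0 <= a by apply: sumr_ge0 => i _; exact: cmod_ge0.
apply: (@le_trans _ _ (n * q)); last by rewrite ler_wpM2r.
apply: (@le_trans _ _ (a ^+ 2)).
  by rewrite ler_pXn2r ?nnegrE ?cmod_ge0//; exact: cmod_sum.
(* This is the sum over the nonzero terms of (l - |F i|)^2, plus zeros. Then l = a / n gives the
   inequality, and l = (q + 1) / a excludes a nonzero a when n = 0. *)
have key (l : R) : 0 <= l ^+ 2 * n - (l * a) *+ 2 + q.
  rewrite /n /a /q !mulr_sumr -sumrMnl -sumrB -big_split /=.
  apply: sumr_ge0 => i _; have [->|_] := eqVneq (F i) 0.
    by rewrite cmod0 /= !mulr0 mul0rn expr0n /= !(subr0, addr0).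
  by rewrite mulr1 -sqrrB sqr_ge0.
have [n00|n0'] := eqVneq n 0.
  have [->|a0'] := eqVneq a 0; first by rewrite expr0n /= mulr_ge0.
  have := key ((q + 1) / a); rewrite n00 mulr0 sub0r divfK//; lra.
have := key (a / n).
have -> : (a / n) ^+ 2 * n - (a / n * a) *+ 2 + q = q - a ^+ 2 / n.
  by field.
by rewrite subr_ge0 ler_pdivrMr ?lt_neqAle 1?eq_sym ?n0' ?n0// mulrC.
Qed.

Lemma cmod_sqrD z w : cmod (z + w) ^+ 2 <= 2 * cmod z ^+ 2 + 2 * cmod w ^+ 2.
Proof.
apply: (@le_trans _ _ ((cmod z + cmod w) ^+ 2)).
  by rewrite ler_pXn2r ?nnegrE ?addr_ge0 ?cmod_ge0// cmodD.
have := sqr_ge0 (cmod z - cmod w); lra.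
Qed.

Lemma expi0 : expi (0 : R) = 1.
Proof. by rewrite /expi cos0 sin0. Qed.

Lemma expiD t u : expi (t + u) = expi t * expi u.
Proof.
rewrite /expi cosD sinD; apply/eqP; rewrite eq_complex /=.
by apply/andP; split; apply/eqP; ring.
Qed.

Lemma expiN t : expi (- t) = conjc (expi t).
Proof. by rewrite /expi cosN sinN. Qed.

Lemma cmod_expi t : cmod (expi t) = 1.
Proof. by rewrite /cmod /= cos2Dsin2 sqrtr1. Qed.

Lemma norm_sin_le t : `|sin t| <= `|t|.
Proof.
wlog t0 : t / 0 <= t.
  move=> h; have [|t0] := leP 0 t; first exact: h.
  by rewrite -normrN -sinN -(normrN t) h// oppr_ge0 ltW.
have [x _] := @MVT_segment R sin cos 0 t t0 (fun x _ => is_derive_sin x)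
  (continuous_subspaceT (@continuous_sin R)).
by rewrite sin0 !subr0 => ->; rewrite normrM ler_piMl// cos_max.
Qed.

Lemma norm_cos_sub1_le t : `|cos t - 1| <= `|t|.
Proof.
wlog t0 : t / 0 <= t.
  move=> h; have [|t0] := leP 0 t; first exact: h.
  by rewrite -cosN -(normrN t) h// oppr_ge0 ltW.
have [x _] := @MVT_segment R cos (fun x => - sin x) 0 t t0
  (fun x _ => is_derive_cos x) (continuous_subspaceT (@continuous_cos R)).
by rewrite cos0 !subr0 => ->; rewrite normrM ler_piMl// normrN sin_max.
Qed.

Lemma cmod_expi_sub1 t : cmod (expi t - 1) <= 2 * `|t|.
Proof.
apply: le_trans (cmod_le_Re_Im _) _.
rewrite /expi /= oppr0 addr0.
have := norm_sin_le t; have := norm_cos_sub1_le t; lra.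
Qed.

Lemma cmod_expi_sub t u : cmod (expi t - expi u) <= 2 * `|t - u|.
Proof.
have -> : expi t - expi u = expi u * (expi (t - u) - 1).
  by rewrite mulrBr -expiD mulr1; congr (expi _ - _); ring.
by rewrite cmodM cmod_expi mul1r cmod_expi_sub1.
Qed.

(** The exact value serves for a lower bound: where the cosine is nonpositive the square is at least
    2, which recovers an unweighted norm on annuli. *)
Lemma cmod_expi_sub1_sqr t : cmod (expi t - 1) ^+ 2 = 2 - 2 * cos t.
Proof.
by rewrite cmodE /= oppr0 addr0 sqrrB expr1n mulr1 sin2cos2; ring.
Qed.

End ComplexModulus.

Section ComplexMeasurable.
Context {R : realType}.
Local Notation mu := (@lebesgue_measure R).
Implicit Types f g : R -> R[i].

Lemma cmeasurable_cst (z : R[i]) : cmeasurable (fun _ : R => z).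
Proof. by split; exact: measurable_cst. Qed.

Lemma cmeasurableD f g : cmeasurable f -> cmeasurable g ->
  cmeasurable (fun x => f x + g x).
Proof.
move=> [f1 f2] [g1 g2]; split.
  by under eq_fun do rewrite ReD; apply: measurable_funD.
by under eq_fun do rewrite ImD; apply: measurable_funD.
Qed.

Lemma cmeasurableM f g : cmeasurable f -> cmeasurable g ->
  cmeasurable (fun x => f x * g x).
Proof.
move=> [f1 f2] [g1 g2]; split.
  by under eq_fun do rewrite ReM; meas.
by under eq_fun do rewrite ImM; meas.
Qed.

Lemma cmeasurableN f : cmeasurable f -> cmeasurable (fun x => - f x).
Proof.
move=> mf; under eq_fun do rewrite -mulN1r.
by apply: cmeasurableM => //; exact: cmeasurable_cst.
Qed.

Lemma cmeasurableB f g : cmeasurable f -> cmeasurable g ->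
  cmeasurable (fun x => f x - g x).
Proof. by move=> mf mg; apply: cmeasurableD => //; exact: cmeasurableN. Qed.

Lemma cmeasurable_sum (I : Type) (s : seq I) (f : I -> R -> R[i]) :
  (forall i, cmeasurable (f i)) -> cmeasurable (fun x => \sum_(i <- s) f i x).
Proof.
move=> mf; elim: s => [|i s ih].
  by under eq_fun do rewrite big_nil; exact: cmeasurable_cst.
by under eq_fun do rewrite big_cons; exact: cmeasurableD.
Qed.

Lemma cmeasurable_real (h : R -> R) : measurable_fun setT h ->
  cmeasurable (fun x => real_complex R (h x)).
Proof. by move=> mh; split => //=; exact: measurable_cst. Qed.

Lemma cmeasurable_conj f : cmeasurable f -> cmeasurable (fun x => conjc (f x)).
Proof.
move=> [f1 f2]; split.
  by rewrite (_ : (fun _ => _) = (fun x => complex.Re (f x)))//; apply/funext => x; case: (f x).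
rewrite (_ : (fun _ => _) = (fun x => - complex.Im (f x))).
  exact: measurable_funN.
by apply/funext => x; case: (f x).
Qed.

Lemma cmeasurable_expi (h : R -> R) : measurable_fun setT h ->
  cmeasurable (fun x => expi (h x)).
Proof.
move=> mh; split => /=.
  by apply: (@measurableT_comp _ _ _ _ _ _ (@cos R)) => //; apply: continuous_measurable_fun; exact: continuous_cos.
by apply: (@measurableT_comp _ _ _ _ _ _ (@sin R)) => //; apply: continuous_measurable_fun; exact: continuous_sin.
Qed.

Lemma cmeasurable_comp f (h : R -> R) : cmeasurable f -> measurable_fun setT h ->
  cmeasurable (fun x => f (h x)).
Proof.
move=> [f1 f2] mh; split.
  exact: (@measurableT_comp _ _ _ _ _ _ (fun x => complex.Re (f x))).
exact: (@measurableT_comp _ _ _ _ _ _ (fun x => complex.Im (f x))).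
Qed.

Lemma measurable_sqrt (h : R -> R) : measurable_fun setT h ->
  measurable_fun setT (fun x => Num.sqrt (h x)).
Proof.
move=> mh; apply: (@measurableT_comp _ _ _ _ _ _ (@Num.sqrt R)) => //.
by apply: continuous_measurable_fun; exact: sqrt_continuous.
Qed.

Lemma measurable_cmod f : cmeasurable f ->
  measurable_fun setT (fun x => cmod (f x)).
Proof.
move=> [f1 f2]; rewrite (_ : (fun _ => _) =
    (fun x => Num.sqrt (complex.Re (f x) ^+ 2 + complex.Im (f x) ^+ 2))).
  by apply: measurable_sqrt; meas.
by apply/funext => x; case: (f x).
Qed.

Lemma measurable_cmod_sqr f : cmeasurable f ->
  measurable_fun setT (fun x => cmod (f x) ^+ 2).
Proof. by move=> mf; apply: measurable_funX; exact: measurable_cmod. Qed.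

End ComplexMeasurable.

Ltac cmeas := repeat first
  [ assumption
  | exact: cmeasurable_cst
  | apply: cmeasurableD
  | apply: cmeasurableM
  | apply: cmeasurableN
  | apply: cmeasurable_expi
  | apply: cmeasurable_conj
  | apply: cmeasurable_real
  | progress meas ].

Section ComplexIntegral.
Context {R : realType}.
Local Notation mu := (@lebesgue_measure R).
Implicit Types f g : R -> R[i].

Definition cintegrable f :=
  cmeasurable f /\ (nint (fun x => cmod (f x)) < +oo)%E.

Lemma integrableZ_EFin (h : R -> R) (a : R) :
  mu.-integrable setT (EFin \o h) ->
  mu.-integrable setT (EFin \o (fun x => a * h x)).
Proof. by move=> hi; have := integrableZl measurableT a hi. Qed.

Lemma cintegrable_norm f : cintegrable f ->
  mu.-integrable setT (EFin \o (fun x => cmod (f x))).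
Proof.
move=> [mf fi]; apply/integrableP; split.
  by apply/measurable_EFinP; exact: measurable_cmod.
apply: le_lt_trans fi; apply: le_integral_nonmeasurable => x //=.
by rewrite ger0_norm// cmod_ge0.
Qed.

Lemma cintegrable_ReIm f : cintegrable f ->
  mu.-integrable setT (EFin \o (fun x => complex.Re (f x))) /\
  mu.-integrable setT (EFin \o (fun x => complex.Im (f x))).
Proof.
move=> [mf fi]; have [f1 f2] := mf.
have ig := cintegrable_norm (conj mf fi).
split; apply: (le_integrable measurableT _ _ ig) => //=;
  try by apply/measurable_EFinP.
  by move=> x _; rewrite lee_fin (ger0_norm (cmod_ge0 _)) normRe_le_cmod.
by move=> x _; rewrite lee_fin (ger0_norm (cmod_ge0 _)) normIm_le_cmod.
Qed.

Lemma cintegrable_le f (g : R -> R) : cmeasurable f ->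
  (forall x, cmod (f x) <= g x) -> (nint g < +oo)%E -> cintegrable f.
Proof.
move=> mf fg gi; split => //; apply: le_lt_trans gi.
by apply: le_nint => // x; exact: cmod_ge0.
Qed.

Lemma cintegrableD f g : cintegrable f -> cintegrable g ->
  cintegrable (fun x => f x + g x).
Proof.
move=> [mf fi] [mg gi].
apply: (@cintegrable_le _ (fun x => cmod (f x) + cmod (g x))).
- exact: cmeasurableD.
- by move=> x; exact: cmodD.
- rewrite nintD; try exact: measurable_cmod; try by move=> x; exact: cmod_ge0.
  exact: lte_add_pinfty.
Qed.

Lemma cintegrableM_bounded f g (M : R) : cintegrable f -> cmeasurable g ->
  (forall x, cmod (g x) <= M) -> cintegrable (fun x => f x * g x).
Proof.
move=> [mf fi] mg gM.
apply: (@cintegrable_le _ (fun x => M * cmod (f x))).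
- exact: cmeasurableM.
- by move=> x; rewrite cmodM mulrC ler_wpM2r// cmod_ge0.
- have M0 : 0 <= M by apply: le_trans (gM 0); exact: cmod_ge0.
  rewrite nintZ//; [|exact: measurable_cmod|by move=> x; exact: cmod_ge0].
  have [v v0 ->] : exists2 v, 0 <= v & nint (fun x => cmod (f x)) = v%:E.
    have := nint_ge0 (fun x => cmod_ge0 (f x)).
    by case: (nint _) fi => [r|//|//] _ r0; exists r => //; rewrite -lee_fin.
  by rewrite -EFinM ltry.
Qed.

Lemma cintegrableZ f (c : R[i]) : cintegrable f ->
  cintegrable (fun x => c * f x).
Proof.
move=> fi; under eq_fun do rewrite mulrC.
by apply: (@cintegrableM_bounded _ _ (cmod c)) => //; exact: cmeasurable_cst.
Qed.

Lemma cintegrable_expi f (h : R -> R) : cintegrable f ->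
  measurable_fun setT h -> cintegrable (fun x => f x * expi (h x)).
Proof.
move=> fi mh; apply: (@cintegrableM_bounded _ _ 1) => //.
  exact: cmeasurable_expi.
by move=> x; rewrite cmod_expi.
Qed.

Lemma nint0 : nint (fun _ : R => 0 : R) = 0%E.
Proof. by rewrite /nint integral0. Qed.

Lemma cintegrable0 : cintegrable (fun _ : R => 0 : R[i]).
Proof.
split; first exact: cmeasurable_cst.
by under eq_fun do rewrite cmod0; rewrite nint0.
Qed.

Lemma cintegrable_sum (I : Type) (s : seq I) (f : I -> R -> R[i]) :
  (forall i, cintegrable (f i)) -> cintegrable (fun x => \sum_(i <- s) f i x).
Proof.
move=> mf; elim: s => [|i s ih].
  by under eq_fun do rewrite big_nil; exact: cintegrable0.
by under eq_fun do rewrite big_cons; exact: cintegrableD.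
Qed.

Lemma cintegralD f g : cintegrable f -> cintegrable g ->
  cintegral (fun x => f x + g x) = cintegral f + cintegral g.
Proof.
move=> /cintegrable_ReIm[f1 f2] /cintegrable_ReIm[g1 g2].
apply/eqP; rewrite eq_complex /=; apply/andP; split; apply/eqP.
  by rewrite -RintegralD//; apply: eq_Rintegral => x _; rewrite ReD.
by rewrite -RintegralD//; apply: eq_Rintegral => x _; rewrite ImD.
Qed.

Lemma cintegralZ f (c : R[i]) : cintegrable f ->
  cintegral (fun x => c * f x) = c * cintegral f.
Proof.
move=> /cintegrable_ReIm[f1 f2].
apply/eqP; rewrite eq_complex; apply/andP; split; apply/eqP.
  rewrite ReM /=  -!RintegralZl// -RintegralB//;
    try exact: integrableZ_EFin.
  by apply: eq_Rintegral => x _; rewrite ReM.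
rewrite ImM /= -!RintegralZl// -RintegralD//;
  try exact: integrableZ_EFin.
by apply: eq_Rintegral => x _; rewrite ImM.
Qed.

Lemma cintegralN f : cintegrable f ->
  cintegral (fun x => - f x) = - cintegral f.
Proof.
move=> fi; under eq_fun do rewrite -mulN1r.
by rewrite cintegralZ// mulN1r.
Qed.

Lemma cintegralB f g : cintegrable f -> cintegrable g ->
  cintegral (fun x => f x - g x) = cintegral f - cintegral g.
Proof.
move=> fi gi; rewrite cintegralD ?cintegralN//.
by under eq_fun do rewrite -mulN1r; exact: cintegrableZ.
Qed.

Lemma cintegral_cst0 : cintegral (fun _ : R => 0 : R[i]) = 0.
Proof. by rewrite /cintegral /= /Rintegral integral0. Qed.

Lemma cintegral_sum (I : Type) (s : seq I) (f : I -> R -> R[i]) :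
  (forall i, cintegrable (f i)) ->
  cintegral (fun x => \sum_(i <- s) f i x) = \sum_(i <- s) cintegral (f i).
Proof.
move=> mf; elim: s => [|i s ih].
  by under eq_fun do rewrite big_nil; rewrite big_nil cintegral_cst0.
under eq_fun do rewrite big_cons.
by rewrite cintegralD ?ih ?big_cons//; exact: cintegrable_sum.
Qed.

(** Multiplying [f] by the conjugate of its integral z turns the integral into the real number
    |z|^2; comparing real part and modulus and dividing by |z| finishes. *)
Lemma le_cmod_cintegral f : cintegrable f ->
  ((cmod (cintegral f))%:E <= nint (fun x => cmod (f x)))%E.
Proof.
move=> fi; set z := cintegral f.
have [z0|z0] := eqVneq (cmod z) 0.
  by rewrite z0; apply: nint_ge0 => x; exact: cmod_ge0.
have zp : 0 < cmod z by rewrite lt_neqAle eq_sym z0 cmod_ge0.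
have gi := cintegrableZ (conjc z) fi.
have zz : complex.Re (cintegral (fun x => conjc z * f x)) = cmod z ^+ 2.
  by rewrite cintegralZ// -/z mulrC mul_conjc.
have [gi1 _] := cintegrable_ReIm gi.
have ig := cintegrable_norm fi.
rewrite /nint -(fineK (integrable_fin_num measurableT ig)) lee_fin.
rewrite -(ler_pM2l zp) -expr2 -zz /=.
change (Rintegral mu setT (fun x => complex.Re (conjc z * f x)) <=
  cmod z * Rintegral mu setT (fun x => cmod (f x))).
rewrite -RintegralZl//; apply: le_Rintegral => //.
  exact: integrableZ_EFin.
by move=> x _; apply: le_trans (Re_le_cmod _) _; rewrite cmodM cmod_conj.
Qed.

Lemma eq_cintegral f g : f =1 g -> cintegral f = cintegral g.
Proof. by move=> /funext ->. Qed.

(** Meant for changing a multiplier at its singular frequency. *)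
Lemma ae_eq_cintegral f g (c : R) : cmeasurable f -> cmeasurable g ->
  (forall x, x != c -> f x = g x) -> cintegral f = cintegral g.
Proof.
move=> [f1 f2] [g1 g2] fg.
have aec (P : R -> Prop) : (forall x, x != c -> P x) -> {ae mu, forall x, P x}.
  move=> Pc; exists [set c]; split => //; first exact: lebesgue_measure_set1.
  by move=> x /= Px; apply: contrapT => /eqP /Pc.
apply/eqP; rewrite eq_complex /=; apply/andP; split; apply/eqP.
  congr fine; apply: ae_eq_integral => //; try by apply/measurable_EFinP.
  by apply: aec => x xc _; rewrite fg.
congr fine; apply: ae_eq_integral => //; try by apply/measurable_EFinP.
by apply: aec => x xc _; rewrite fg.
Qed.

End ComplexIntegral.

Section TrigonometricIntegrals.
Context {R : realType}.
Local Notation mu := (@lebesgue_measure R).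

Lemma integral_is_derive (f F : R -> R) (a b : R) : a < b ->
  continuous f -> (forall x : R, a <= x <= b -> is_derive x (1 : R) F (f x)) ->
  (\int[mu]_(x in `[a, b]) (f x)%:E = (F b - F a)%:E)%E.
Proof.
move=> ab cf dF; have cF x : a <= x <= b -> {for x, continuous F}.
  by move=> xab; apply: differentiable_continuous; apply/derivable1_diffP; case: (dF x xab).
have ioo x : x \in `]a, b[ -> a <= x <= b.
  by rewrite in_itv/= => /andP[x1 x2]; rewrite !ltW.
rewrite (@continuous_FTC2 _ f F)//.
- exact: continuous_subspaceT.
- split; first by move=> x /ioo xab; case: (dF x xab).
    by apply: cvg_at_right_filter; apply: cF; rewrite lexx ltW.
  by apply: cvg_at_left_filter; apply: cF; rewrite lexx ltW.
- by move=> x /ioo xab; rewrite derive1E; case: (dF x xab).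
Qed.

Lemma sin_nat_pi (n : nat) : sin (n%:R * pi) = 0 :> R.
Proof.
elim: n => [|n ih]; first by rewrite mul0r sin0.
by rewrite -natr1 mulrDl mul1r sinDpi ih oppr0.
Qed.

Definition cutoff (K x : R) : R := \1_`[- K, K]%classic x.

Lemma measurable_cutoff (K : R) : measurable_fun setT (cutoff K).
Proof. exact: measurable_indic. Qed.

Lemma cutoff_ge0 (K x : R) : 0 <= cutoff K x.
Proof. by rewrite /cutoff indicE. Qed.

Lemma cutoff_le1 (K x : R) : cutoff K x <= 1.
Proof. by rewrite /cutoff indicE; case: (_ \in _). Qed.

Lemma cutoffE (K x : R) : cutoff K x = (`|x|%R <= K)%R%:R.
Proof.
rewrite /cutoff indicE ler_norml; congr (nat_of_bool _)%:R.
by apply/idP/idP => [/set_mem|h]; rewrite ?inE /= in_itv.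
Qed.

Lemma nint_cutoff (K : R) : 0 <= K -> nint (cutoff K) = (2 * K)%:E.
Proof.
move=> K0; rewrite /cutoff nint_indic// lebesgue_measure_itv/= lte_fin.
case: ltP => h; first by rewrite -EFinB; congr EFin; ring.
by congr EFin; lra.
Qed.

Lemma is_derive_scale (f : R -> R) (a b x l : R) :
  is_derive (b * x) (1 : R) f l ->
  is_derive x (1 : R) (fun y => a * f (b * y)) (a * (l * b)).
Proof.
move=> fl; apply: (@is_deriveZ _ _ _ (f \o (fun y => b * y)) a).
apply: is_derive1_comp => //.
by have := @is_deriveZ R R R id b x 1 1 (is_derive_id x 1); rewrite scaler1.
Qed.

(** The imaginary part vanishes by parity; the real part is 2 sin(b K) / b. *)
Lemma cintegral_cutoff (K b : R) : 0 < K -> b != 0 -> sin (b * K) = 0 ->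
  cintegral (fun x => real_complex R (cutoff K x) * expi (b * x)) = 0.
Proof.
move=> K0 b0 sb0.
have cR (h : R -> R) : (Rintegral mu setT (fun x => cutoff K x * h x) =
    Rintegral mu `[- K, K]%classic h).
  rewrite [RHS]Rintegral_mkcond; apply: eq_Rintegral => x _.
  rewrite patchE /cutoff indicE; case: (_ \in _); by rewrite ?mul1r ?mul0r.
have cb (h : R -> R) : continuous h -> continuous (fun x => h (b * x)).
  by move=> ch x; apply: continuous_comp; [exact: mulrl_continuous|exact: ch].
have KK : - K < K by lra.
apply/eqP; rewrite eq_complex; apply/andP; split; apply/eqP; rewrite /cintegral /=.
  under eq_Rintegral do rewrite mul0r subr0.
  have d (x : R) : is_derive x (1 : R) (fun y => b^-1 * sin (b * y)) (cos (b * x)).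
    have := is_derive_scale b^-1 (is_derive_sin (b * x)).
    by rewrite [cos _ * _]mulrC mulKf.
  rewrite cR /Rintegral (integral_is_derive KK (cb cos (@continuous_cos R)) (fun x _ => d x)) /=.
  by rewrite mulrN sinN sb0 oppr0 subrr.
under eq_Rintegral do rewrite mul0r addr0.
have d (x : R) : is_derive x (1 : R) (fun y => - b^-1 * cos (b * y)) (sin (b * x)).
  have := is_derive_scale (- b^-1) (is_derive_cos (b * x)).
  by rewrite [_ * b]mulrC mulrN mulrNN mulKf.
rewrite cR /Rintegral (integral_is_derive KK (cb sin (@continuous_sin R)) (fun x _ => d x)) /=.
by rewrite mulrN cosN subrr.
Qed.

End TrigonometricIntegrals.

(** * Fourier transform and Plancherel's inequality *)

Section Fourier.
Context {R : realType}.
Local Notation mu := (@lebesgue_measure R).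
Implicit Types f u w : R -> R[i].

Lemma measurable_phase (xi : R) :
  measurable_fun setT (fun x : R => - (2 * pi * x * xi)).
Proof. by meas. Qed.

Lemma cintegrable_fourier f (xi : R) : cintegrable f ->
  cintegrable (fun x => f x * expi (- (2 * pi * x * xi))).
Proof. by move=> fi; apply: cintegrable_expi => //; exact: measurable_phase. Qed.

Lemma cmod_fourier_le f (xi : R) : cintegrable f ->
  ((cmod (fourier f xi))%:E <= nint (fun x => cmod (f x)))%E.
Proof.
move=> fi; apply: le_trans (le_cmod_cintegral (cintegrable_fourier xi fi)) _.
apply: le_nint => x; first exact: cmod_ge0.
by rewrite cmodM cmod_expi mulr1.
Qed.

Lemma fourierB f u xi : cintegrable f -> cintegrable u ->
  fourier (fun x => f x - u x) xi = fourier f xi - fourier u xi.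
Proof.
move=> fi ui; rewrite /fourier -cintegralB; try exact: cintegrable_fourier.
by apply: eq_cintegral => x; rewrite mulrBl.
Qed.

Lemma fourierZ f c xi : cintegrable f ->
  fourier (fun x => c * f x) xi = c * fourier f xi.
Proof.
move=> fi; rewrite /fourier -cintegralZ; last exact: cintegrable_fourier.
by apply: eq_cintegral => x; rewrite mulrA.
Qed.

Lemma fourier_sum (I : Type) (s : seq I) (f : I -> R -> R[i]) xi :
  (forall i, cintegrable (f i)) ->
  fourier (fun x => \sum_(i <- s) f i x) xi = \sum_(i <- s) fourier (f i) xi.
Proof.
move=> fi; rewrite /fourier -cintegral_sum.
  by apply: eq_cintegral => x; rewrite mulr_suml.
by move=> i; exact: cintegrable_fourier.
Qed.

Lemma fourier_shift f (h xi : R) :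
  fourier (fun x => expi (2 * pi * x * h) * f x) xi = fourier f (xi - h).
Proof.
apply: eq_cintegral => x; rewrite [LHS]mulrC [LHS]mulrA [LHS]mulrC -expiD.
by congr (_ * expi _); ring.
Qed.

Lemma measurable_fourier f : cintegrable f -> cmeasurable (fourier f).
Proof.
move=> fi.
have cont (g h : R -> R) : mu.-integrable setT (EFin \o g) ->
    mu.-integrable setT (EFin \o h) ->
    continuous (fun xi => \int[mu]_x (g x * cos (2 * pi * x * xi) +
                                      h x * sin (2 * pi * x * xi))).
  move=> gi hi xi0.
  have mgh xi : measurable_fun setT (fun x => g x * cos (2 * pi * x * xi) +
                                      h x * sin (2 * pi * x * xi)).
    have [[mg _] [mh _]] := (integrableP _ _ _ gi, integrableP _ _ _ hi).
    move/measurable_EFinP : mg => mg; move/measurable_EFinP : mh => mh.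
    have [mc ms] : cmeasurable (fun x : R => expi (2 * pi * x * xi)).
      by apply: cmeasurable_expi; meas.
    by apply: measurable_funD; apply: measurable_funM.
  have dom xi x : `|g x * cos (2 * pi * x * xi) + h x * sin (2 * pi * x * xi)|
      <= `|g x| + `|h x|.
    apply: le_trans (ler_normD _ _) _; rewrite !normrM.
    by apply: lerD; rewrite ler_piMr// ?cos_max ?sin_max.
  have idom : mu.-integrable setT (EFin \o (fun x => `|g x| + `|h x|)).
    have := integrableD measurableT (integrable_abse gi) (integrable_abse hi).
    by [].
  (* Dominated convergence near [xi0], with |g| + |h| as a bound valid at all frequencies;
     measurability of the transform is drawn from this continuity. *)
  apply: (@continuity_under_integral _ _ _ mu _ setT measurableT (xi0 - 1) (xi0 + 1)
    _ _ (fun x => `|g x| + `|h x|)) => //.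
  - move=> xi _; apply: le_integrable idom => //.
      by apply/measurable_EFinP; exact: mgh.
    move=> x _ /=; rewrite lee_fin [leRHS]ger0_norm ?addr_ge0//; exact: dom.
  - apply: aeW => x _ xi _; apply: cvgD; apply: cvgMr.
      apply: continuous_comp; [exact: mulrl_continuous|exact: continuous_cos].
    by apply: continuous_comp; [exact: mulrl_continuous|exact: continuous_sin].
  - by move=> xi _; apply: aeW => x _; exact: dom.
  - by rewrite inE /= in_itv /=; apply/andP; split; lra.
have [f1 f2] := cintegrable_ReIm fi.
have f1N : mu.-integrable setT (EFin \o (fun x => - complex.Re (f x))).
  by have := integrableZ_EFin (-1) f1; under eq_fun do rewrite mulN1r.
split; apply: continuous_measurable_fun.
  rewrite (_ : (fun _ => _) = (fun xi =>
      \int[mu]_x (complex.Re (f x) * cos (2 * pi * x * xi) +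
                  complex.Im (f x) * sin (2 * pi * x * xi)))).
    exact: cont.
  apply/funext => xi.
  by apply: eq_Rintegral => x _; rewrite ReM /= cosN sinN; ring.
rewrite (_ : (fun _ => _) = (fun xi =>
    \int[mu]_x (complex.Im (f x) * cos (2 * pi * x * xi) +
                - complex.Re (f x) * sin (2 * pi * x * xi)))).
  exact: cont.
apply/funext => xi.
by apply: eq_Rintegral => x _; rewrite ImM /= cosN sinN; ring.
Qed.

End Fourier.

Section CompactSupport.
Context {R : realType}.
Local Notation mu := (@lebesgue_measure R).
Implicit Types f u w : R -> R[i].

(** Bounded functions of compact support lie in L^1 and L^2 at once and are stable under every
    operation used below. Truncated functions are of this kind, and so is a multiplier of bounded
    support times a Fourier transform, so both sides of the transform obey the same rules. *)
Definition nice u := cmeasurable u /\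
  exists M K : R, [/\ 0 <= M, 0 < K & forall x, cmod (u x) <= M * cutoff K x].

Lemma cutoff_mono (K L x : R) : K <= L -> cutoff K x <= cutoff L x.
Proof.
move=> KL; rewrite !cutoffE ler_nat.
by case: (leP `|x| K) => //= h; rewrite (le_trans h KL).
Qed.

Lemma cutoff_sqr (K x : R) : cutoff K x ^+ 2 = cutoff K x.
Proof. by rewrite cutoffE; case: (_ <= _); rewrite /= ?expr1n ?expr0n. Qed.

Lemma nice_cintegrable u : nice u -> cintegrable u.
Proof.
move=> [mu_ [M [K [M0 K0 uM]]]]; apply: (cintegrable_le mu_ uM).
rewrite nintZ//; try exact: measurable_cutoff; try by move=> x; exact: cutoff_ge0.
by rewrite nint_cutoff ?ltW// -EFinM ltry.
Qed.

Lemma nice_sqr_fin u : nice u ->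
  exists2 v : R, 0 <= v & nint (fun x => cmod (u x) ^+ 2) = v%:E.
Proof.
move=> [mu_ [M [K [M0 K0 uM]]]].
apply: (@nint_fin _ _ (M ^+ 2 * (2 * K))) => [x|]; first exact: sqr_ge0.
rewrite EFinM -(nint_cutoff (ltW K0)) -nintZ ?sqr_ge0//;
  try exact: measurable_cutoff; try by move=> x; exact: cutoff_ge0.
apply: le_nint => x; first exact: sqr_ge0.
rewrite -(cutoff_sqr K x) -exprMn ler_pXn2r ?nnegrE ?cmod_ge0//.
by rewrite mulr_ge0// cutoff_ge0.
Qed.

Lemma nice0 : nice (fun _ => 0).
Proof.
split; first exact: cmeasurable_cst.
by exists 0, 1; split => // x; rewrite cmod0 mul0r.
Qed.

Lemma niceD u w : nice u -> nice w -> nice (fun x => u x + w x).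
Proof.
move=> [mu_ [M [K [M0 K0 uM]]]] [mw [N [L [N0 L0 wN]]]].
split; first exact: cmeasurableD.
exists (M + N), (Num.max K L); split; [exact: addr_ge0|by rewrite lt_max K0|].
move=> x; apply: le_trans (cmodD _ _) _; rewrite mulrDl; apply: lerD.
  apply: le_trans (uM x) _; rewrite ler_wpM2l//.
  by apply: cutoff_mono; rewrite le_max lexx.
apply: le_trans (wN x) _; rewrite ler_wpM2l//.
by apply: cutoff_mono; rewrite le_max lexx orbT.
Qed.

Lemma niceM u w (M : R) : nice u -> cmeasurable w ->
  (forall x, cmod (w x) <= M) -> nice (fun x => w x * u x).
Proof.
move=> [mu_ [N [K [N0 K0 uN]]]] mw wM; split; first exact: cmeasurableM.
have M0 : 0 <= M by apply: le_trans (wM 0); exact: cmod_ge0.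
exists (M * N), K; split => //; first exact: mulr_ge0.
move=> x; rewrite cmodM -mulrA; apply: ler_pM => //; exact: cmod_ge0.
Qed.

Lemma niceZ u (c : R[i]) : nice u -> nice (fun x => c * u x).
Proof.
by move=> nu; apply: (@niceM _ _ (cmod c)) => //; exact: cmeasurable_cst.
Qed.

Lemma niceN u : nice u -> nice (fun x => - u x).
Proof. by move=> nu; under eq_fun do rewrite -mulN1r; exact: niceZ. Qed.

Lemma niceB u w : nice u -> nice w -> nice (fun x => u x - w x).
Proof. by move=> nu nw; apply: niceD => //; exact: niceN. Qed.

Lemma nice_sum (I : Type) (s : seq I) (u : I -> R -> R[i]) :
  (forall i, nice (u i)) -> nice (fun x => \sum_(i <- s) u i x).
Proof.
move=> nu; elim: s => [|i s ih].
  by under eq_fun do rewrite big_nil; exact: nice0.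
by under eq_fun do rewrite big_cons; exact: niceD.
Qed.

Lemma nice_expi u (h : R -> R) : measurable_fun setT h -> nice u ->
  nice (fun x => expi (h x) * u x).
Proof.
move=> mh nu; apply: (@niceM _ _ 1) => //; first exact: cmeasurable_expi.
by move=> x; rewrite cmod_expi.
Qed.

Lemma nice_conj u : nice u -> nice (fun x => conjc (u x)).
Proof.
move=> [mu_ [M [K [M0 K0 uM]]]]; split; first exact: cmeasurable_conj.
by exists M, K; split => // x; rewrite cmod_conj.
Qed.

Lemma nice_translate u (c : R) : nice u -> nice (fun x => u (x + c)).
Proof.
move=> [mu_ [M [K [M0 K0 uM]]]]; split; first by apply: cmeasurable_comp => //; meas.
exists M, (K + `|c|); split => //; first by rewrite ltr_wpDr.
move=> x; apply: le_trans (uM _) _; rewrite ler_wpM2l// !cutoffE ler_nat.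
case: (leP `|x + c| K) => //= h; suff -> : `|x| <= K + `|c| by [].
have := ler_normB (x + c) c; rewrite addrK; lra.
Qed.

End CompactSupport.

Section Plancherel.
Context {R : realType}.
Local Notation mu := (@lebesgue_measure R).
Implicit Types f u w : R -> R[i].

Lemma nint_le_of_cutoff (h : R -> R) (C : \bar R) :
  measurable_fun setT h -> (forall x, 0 <= h x) ->
  (forall n : nat, (nint (fun x => (h x * cutoff n%:R x)%R) <= C)%E) ->
  (nint h <= C)%E.
Proof.
move=> mh h0 hC.
have -> : nint h = (\int[mu]_x limn (fun n => (h x * cutoff n%:R x)%:E))%E.
  apply: eq_integral => x _; apply/esym/cvg_lim => //.
  apply: cvg_near_cst; near=> n; rewrite cutoffE.
  suff -> : `|x| <= n%:R by rewrite mulr1.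
  by near: n; exact: nbhs_infty_ger.
rewrite monotone_convergence//.
- apply: lime_le; last by apply: nearW => n; exact: hC.
  apply: ereal_nondecreasing_is_cvgn => m n mn; apply: le_nint => x.
    by rewrite mulr_ge0// cutoff_ge0.
  by rewrite ler_wpM2l// cutoff_mono// ler_nat.
- move=> n; apply/measurable_EFinP; apply: measurable_funM => //.
  exact: measurable_cutoff.
- by move=> n x _; rewrite lee_fin mulr_ge0// cutoff_ge0.
- move=> x _ m n mn; rewrite lee_fin ler_wpM2l// cutoff_mono// ler_nat.
  exact: mn.
Unshelve. all: by end_near. Qed.

(** The interval is folded onto one period: the translates of [a, a + d[ are moved back, and the sum
    of [h] over the lattice is bounded before integrating. *)
Lemma nint_fold (h : R -> R) (a d C : R) (m : nat) :
  measurable_fun setT h -> (forall x, 0 <= h x) -> 0 < d -> 0 <= C ->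
  (forall s, \sum_(n < m) h (s + n%:R * d) <= C) ->
  (nint (fun x => (h x * \1_`[a, a + m%:R * d[%classic x)%R) <= (C * d)%:E)%E.
Proof.
move=> mh h0 d0 C0 hC.
have mI (b c : R) : measurable_fun setT (\1_`[b, c[%classic : R -> R).
  exact: measurable_indic.
have I0 (b c x : R) : 0 <= (\1_`[b, c[%classic x : R) by rewrite indicE.
have cover x : (\1_`[a, a + m%:R * d[%classic x : R) <=
    \sum_(n < m) \1_`[a, a + d[%classic (x - n%:R * d).
  rewrite indicE; case: (boolP (_ \in _)) => [|_ /=]; last by apply: sumr_ge0 => i _.
  rewrite inE/= in_itv/= => /andP[ax xm].
  pose n := Num.truncn ((x - a) / d).
  have x0 : 0 <= (x - a) / d by rewrite divr_ge0 ?subr_ge0// ltW.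
  have /andP[n1 n2] := truncn_itv x0; rewrite -/n in n1 n2.
  rewrite ler_pdivlMr// in n1; rewrite ltr_pdivrMr// in n2.
  have nm : (n < m)%N.
    by rewrite -(ltr_nat R) -(ltr_pM2r d0); lra.
  rewrite (bigD1 (Ordinal nm))//= indicE mem_set; last first.
    rewrite /= in_itv/= lerBrDr addrC -lerBrDr n1 /=.
    by move: n2; rewrite -natr1 mulrDl mul1r; lra.
  by rewrite lerDl; apply: sumr_ge0 => i _.
apply: (@le_trans _ _ (nint (fun x =>
    \sum_(n < m) h x * \1_`[a, a + d[%classic (x - n%:R * d)))).
  apply: le_nint => x; first by rewrite mulr_ge0.
  by rewrite -mulr_sumr ler_wpM2l.
have mS (n : nat) (c : R) : measurable_fun setT
    (fun x : R => h (x + c) * \1_`[a, a + d[%classic x).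
  apply: measurable_funM => //.
  by apply: (@measurableT_comp _ _ _ _ _ _ h) => //; meas.
rewrite nint_sum; last 2 first.
- move=> i; apply: measurable_funM => //.
  by apply: (@measurableT_comp _ _ _ _ _ _ (\1_`[a, a + d[%classic : R -> R)) => //; meas.
- by move=> i x; rewrite mulr_ge0.
rewrite (eq_bigr (fun n : 'I_m => nint (fun x =>
    (h (x + n%:R * d) * \1_`[a, a + d[%classic x)%R))); last first.
  move=> n _; rewrite -(@nint_translate _ _ (n%:R * d)).
  - by congr nint; apply/funext => x; rewrite addrK.
  - apply: measurable_funM => //.
    by apply: (@measurableT_comp _ _ _ _ _ _ (\1_`[a, a + d[%classic : R -> R)) => //; meas.
  - by move=> x; rewrite mulr_ge0.
rewrite -nint_sum; [|by move=> i; exact: mS|by move=> i x; rewrite mulr_ge0].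
apply: (@le_trans _ _ (nint (fun x => C * \1_`[a, a + d[%classic x))).
  apply: le_nint => x; first by apply: sumr_ge0 => i _; rewrite mulr_ge0.
  by rewrite -mulr_suml ler_wpM2r.
rewrite nintZ// nint_indic// lebesgue_measure_itv/= lte_fin ltrDl d0.
by rewrite -EFinB -EFinM addrAC subrr add0r.
Qed.

End Plancherel.

Section PlancherelInequality.
Context {R : realType}.
Local Notation mu := (@lebesgue_measure R).
Implicit Types f u w : R -> R[i].

Lemma nint_of_cintegral (h : R -> R) (v : R) :
  (forall x, 0 <= h x) -> cintegrable (fun x => real_complex R (h x)) ->
  cintegral (fun x => real_complex R (h x)) = real_complex R v ->
  nint h = v%:E.
Proof.
move=> h0 hi hv.
have [h1 _] := cintegrable_ReIm hi.
move: hv => /(congr1 (@complex.Re R)) /= <-.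
by rewrite /Rintegral fineK//; exact: (integrable_fin_num measurableT h1).
Qed.

Lemma conjcM (z w : R[i]) : conjc (z * w) = conjc z * conjc w.
Proof. exact: rmorphM. Qed.

Lemma conjc_sum (I : Type) (s : seq I) (F : I -> R[i]) :
  conjc (\sum_(i <- s) F i) = \sum_(i <- s) conjc (F i).
Proof. exact: rmorph_sum. Qed.

Lemma real_complex_sum (I : Type) (s : seq I) (F : I -> R) :
  real_complex R (\sum_(i <- s) F i) = \sum_(i <- s) real_complex R (F i).
Proof. exact: rmorph_sum. Qed.

Lemma real_complexM (x y : R) :
  real_complex R (x * y) = real_complex R x * real_complex R y.
Proof. by rewrite rmorphM. Qed.

(* Orthogonality of the exponentials of frequencies in (2K)^-1 Z on [-K, K]. *)
Lemma nint_trigpoly (K s : R) (m : nat) (c : 'I_m -> R[i]) : 0 < K ->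
  nint (fun x => cmod (\sum_n c n * expi (2 * pi * x * (s + n%:R / (2 * K)))) ^+ 2
                 * cutoff K x) = (2 * K * \sum_n cmod (c n) ^+ 2)%:E.
Proof.
move=> K0; set p := fun x : R => \sum_n c n * expi (2 * pi * x * (s + n%:R / (2 * K))).
have K2 : 2 * K != 0 by rewrite mulf_neq0// gt_eqF.
pose b (n k : 'I_m) : R := 2 * pi * ((n%:R - k%:R) / (2 * K)).
have mcut : cmeasurable (fun x : R => real_complex R (cutoff K x)).
  by apply: cmeasurable_real; exact: measurable_cutoff.
have niceE (n k : 'I_m) :
    nice (fun x => expi (b n k * x) * real_complex R (cutoff K x)).
  apply: nice_expi; first by meas.
  split => //; exists 1, K; split => // x.
  by rewrite mul1r cmod_real ger0_norm// cutoff_ge0.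
have E x : real_complex R (cmod (p x) ^+ 2 * cutoff K x) =
    \sum_n \sum_k (c n * conjc (c k)) *
      (expi (b n k * x) * real_complex R (cutoff K x)).
  rewrite real_complexM -mul_conjc /p conjc_sum mulr_suml mulr_suml.
  apply: eq_bigr => n _; rewrite mulr_sumr mulr_suml; apply: eq_bigr => k _.
  rewrite conjcM -expiN.
  have -> : b n k * x = 2 * pi * x * (s + n%:R / (2 * K)) +
      - (2 * pi * x * (s + k%:R / (2 * K))) by rewrite /b; field; rewrite gt_eqF.
  by rewrite expiD; ring.
apply: nint_of_cintegral.
- by move=> x; rewrite mulr_ge0 ?sqr_ge0// cutoff_ge0.
- under eq_fun do rewrite E.
  apply: cintegrable_sum => n; apply: cintegrable_sum => k.
  by apply: cintegrableZ; apply: nice_cintegrable; exact: niceE.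
under eq_cintegral do rewrite E.
rewrite cintegral_sum; last first.
  move=> n; apply: cintegrable_sum => k.
  by apply: cintegrableZ; apply: nice_cintegrable; exact: niceE.
rewrite real_complexM real_complex_sum mulr_sumr; apply: eq_bigr => n _.
rewrite cintegral_sum; last first.
  by move=> k; apply: cintegrableZ; apply: nice_cintegrable; exact: niceE.
rewrite (bigD1 n)//= big1 ?addr0; last first.
  move=> k kn; rewrite cintegralZ; last by apply: nice_cintegrable; exact: niceE.
  rewrite [X in _ * X](_ : _ = 0) ?mulr0//.
  under eq_fun do rewrite [_ * real_complex R _]mulrC.
  apply: cintegral_cutoff => //.
    rewrite /b; apply: mulf_neq0; first by rewrite mulf_neq0// gt_eqF// pi_gt0.
    apply: mulf_neq0; last by rewrite invr_eq0.
    by rewrite subr_eq0 eqr_nat eq_sym.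
  have -> : b n k * K = (n%:R - k%:R) * pi by rewrite /b; field; rewrite gt_eqF.
  have [nk|kn'] := leqP n k.
    by rewrite -(opprB k%:R) mulNr sinN -natrB// sin_nat_pi oppr0.
  by rewrite -natrB ?sin_nat_pi// ltnW.
rewrite cintegralZ; last by apply: nice_cintegrable; exact: niceE.
rewrite mulrC -mul_conjc; congr (_ * _).
rewrite /b subrr mul0r mulr0.
under eq_cintegral do rewrite mul0r expi0 mul1r.
rewrite /cintegral /= /Rintegral.
change (complex.Complex (fine (nint (cutoff K))) (fine (\int[mu]_x (0:R)%:E)%E) = real_complex R (2 * K)).
by rewrite nint_cutoff ?(ltW K0)// integral0.
Qed.

(** The sum Z of squared coefficients is the pairing of [u] with the trigonometric polynomial p
    having these coefficients. By |u p| <= K |u|^2 + |p|^2 / (4 K) and [nint_trigpoly], the last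
    term integrates to Z / 2 and is absorbed on the left. *)
Lemma bessel u (M K s : R) (m : nat) : cmeasurable u -> 0 <= M -> 0 < K ->
  (forall x, cmod (u x) <= M * cutoff K x) ->
  ((\sum_(n < m) cmod (fourier u (s + n%:R * (2 * K)^-1)) ^+ 2)%:E <=
   (2 * K)%:E * nint (fun x => (cmod (u x) ^+ 2)%R))%E.
Proof.
move=> mu_ M0 K0 uM; have nu : nice u by split => //; exists M, K.
have ui := nice_cintegrable nu.
pose c (n : 'I_m) := fourier u (s + n%:R / (2 * K)).
pose p x := \sum_n c n * expi (2 * pi * x * (s + n%:R / (2 * K))).
rewrite -/(c _); set Z := \sum_(n < m) _.
have Z0 : 0 <= Z by apply: sumr_ge0 => n _; exact: sqr_ge0.
have mp : cmeasurable p by apply: cmeasurable_sum => n; cmeas.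
have E1 : real_complex R Z = cintegral (fun x => u x * conjc (p x)).
  transitivity (\sum_(n < m) conjc (c n) * fourier u (s + n%:R / (2 * K))).
    rewrite real_complex_sum; apply: eq_bigr => n _.
    by rewrite -mul_conjc mulrC.
  transitivity (\sum_(n < m) cintegral (fun x =>
      conjc (c n) * (u x * expi (- (2 * pi * x * (s + n%:R / (2 * K))))))).
    by apply: eq_bigr => n _; rewrite cintegralZ//; exact: cintegrable_fourier.
  rewrite -cintegral_sum; last first.
    by move=> n; apply: cintegrableZ; exact: cintegrable_fourier.
  apply: eq_cintegral => x; rewrite /p conjc_sum mulr_sumr.
  by apply: eq_bigr => n _; rewrite conjcM expiN; ring.
have [v v0 Ev] := nice_sqr_fin nu.
have up : nice (fun x => conjc (p x) * u x).
  apply: (@niceM _ _ _ (\sum_n cmod (c n))) => //; first exact: cmeasurable_conj.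
  move=> x; rewrite cmod_conj; apply: le_trans (cmod_sum _ _) _.
  by apply: ler_sum => n _; rewrite cmodM cmod_expi mulr1.
have := le_cmod_cintegral (nice_cintegrable up).
under eq_cintegral do rewrite mulrC.
rewrite -E1 cmod_real ger0_norm// => ZZ.
have P0 : 0 < 2 * K by rewrite mulr_gt0.
have : (Z%:E <= nint (fun x => (K * cmod (u x) ^+ 2 +
    (4 * K)^-1 * (cmod (p x) ^+ 2 * cutoff K x))%R))%E.
  apply: le_trans ZZ _; apply: le_nint => x; first exact: cmod_ge0.
  rewrite cmodM cmod_conj mulrC.
  have := uM x; rewrite cutoffE; case: (`|x| <= K) => /=.
    move=> _; rewrite mulr1.
    have h := sqr_ge0 (2 * K * cmod (u x) - cmod (p x)).
    have K4 : 0 < 4 * K by rewrite mulr_gt0.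
    rewrite -(ler_pM2l K4) [leRHS]mulrDr mulVKf ?gt_eqF//; lra.
  rewrite !mulr0 addr0 => u0.
  have -> : cmod (u x) = 0 by apply/eqP; rewrite eq_le u0 cmod_ge0.
  by rewrite mul0r expr0n mulr0.
have i0 : 0 <= (4 * K)^-1 by rewrite invr_ge0 mulr_ge0// ltW.
have pc0 x : 0 <= cmod (p x) ^+ 2 * cutoff K x.
  by rewrite mulr_ge0 ?sqr_ge0 ?cutoff_ge0.
rewrite nintD; last 4 first.
- by apply: measurable_funM => //; exact: measurable_cmod_sqr.
- apply: measurable_funM => //; apply: measurable_funM; last exact: measurable_cutoff.
  exact: measurable_cmod_sqr.
- by move=> x; rewrite mulr_ge0 ?sqr_ge0// ltW.
- by move=> x; rewrite mulr_ge0.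
rewrite !nintZ; first last.
- exact: ltW.
- by move=> x; rewrite sqr_ge0.
- exact: measurable_cmod_sqr.
- by [].
- by [].
- by apply: measurable_funM; [exact: measurable_cmod_sqr|exact: measurable_cutoff].
rewrite (nint_trigpoly _ _ K0) Ev -!EFinM -EFinD !lee_fin -/Z.
have -> : (4 * K)^-1 * (2 * K * Z) = Z / 2 by field; rewrite gt_eqF.
lra.
Qed.

(* Averaging Bessel's inequality over [s] in a period of the dual lattice. *)
Lemma plancherel_le u : nice u ->
  (nint (fun xi => (cmod (fourier u xi) ^+ 2)%R) <= nint (fun x => (cmod (u x) ^+ 2)%R))%E.
Proof.
move=> nu; have [mu_ [M [K [M0 K0 uM]]]] := nu.
have [v v0 Ev] := nice_sqr_fin nu.
have mF : measurable_fun setT (fun xi => cmod (fourier u xi) ^+ 2).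
  by apply: measurable_cmod_sqr; apply: measurable_fourier; exact: nice_cintegrable.
apply: nint_le_of_cutoff => // [x|n]; first exact: sqr_ge0.
pose d := (2 * K)^-1.
have d0 : 0 < d by rewrite invr_gt0 mulr_gt0.
pose m := (Num.truncn ((2 * n%:R + 1) / d)).+1.
have mn : 2 * n%:R + 1 < m%:R * d by rewrite -ltr_pdivrMr// truncnS_gt.
apply: (@le_trans _ _ (nint (fun x => cmod (fourier u x) ^+ 2 *
    \1_`[- n%:R, - n%:R + m%:R * d[%classic x))).
  apply: le_nint => x; first by rewrite mulr_ge0 ?sqr_ge0// cutoff_ge0.
  rewrite ler_wpM2l ?sqr_ge0// cutoffE indicE.
  case: (leP `|x| n%:R) => //=; rewrite ler_norml => /andP[x1 x2].
  rewrite mem_set//= in_itv/= x1 /=; lra.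
(* The Bessel constant 2 K cancels the period d, hence the constant 1 in the inequality. *)
apply: (@le_trans _ _ ((2 * K * v) * d)%:E).
  apply: nint_fold => // [x||s]; first exact: sqr_ge0.
    by rewrite !mulr_ge0// ltW.
  by rewrite -lee_fin EFinM -Ev; apply: bessel uM.
by rewrite Ev lee_fin /d mulrAC divff ?mul1r// mulf_neq0// gt_eqF.
Qed.

Definition ift w x : R[i] := cintegral (fun xi => w xi * expi (2 * pi * x * xi)).

Lemma cintegral_conj f : cintegrable f ->
  cintegral (fun x => conjc (f x)) = conjc (cintegral f).
Proof.
move=> fi; have [f1 f2] := cintegrable_ReIm fi.
apply/eqP; rewrite eq_complex; apply/andP; split; apply/eqP; rewrite /cintegral /=.
  by apply: eq_Rintegral => x _; case: (f x).
rewrite -mulN1r -RintegralZl//; apply: eq_Rintegral => x _.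
by case: (f x) => a b /=; rewrite mulN1r.
Qed.

(** Conjugation exchanges the two transforms, so measurability and Plancherel's inequality carry
    over to the inverse one. *)
Lemma ift_fourier w x : cintegrable w ->
  ift w x = conjc (fourier (fun xi => conjc (w xi)) x).
Proof.
move=> wi; rewrite /fourier -cintegral_conj; last first.
  apply: cintegrable_fourier; split; first exact/cmeasurable_conj/wi.1.
  by under eq_fun do rewrite cmod_conj; case: wi.
apply: eq_cintegral => xi; rewrite conjcM -expiN conjcK.
by congr (_ * expi _); ring.
Qed.

Lemma plancherel_ift_le w : nice w ->
  (nint (fun x => (cmod (ift w x) ^+ 2)%R) <= nint (fun xi => (cmod (w xi) ^+ 2)%R))%E.
Proof.
move=> nw; under eq_fun do rewrite (ift_fourier _ (nice_cintegrable nw)) cmod_conj.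
apply: le_trans (plancherel_le (nice_conj nw)) _.
by under eq_fun do rewrite cmod_conj.
Qed.

Lemma measurable_ift w : cintegrable w -> cmeasurable (ift w).
Proof.
move=> wi; rewrite (_ : ift w = fun x => conjc (fourier (fun xi => conjc (w xi)) x)).
  apply: cmeasurable_conj; apply: measurable_fourier.
  split; first exact/cmeasurable_conj/wi.1.
  by under eq_fun do rewrite cmod_conj; case: wi.
by apply/funext => x; exact: ift_fourier.
Qed.

End PlancherelInequality.

(** * Bump functions and multipliers *)

Section Bump.
Context {R : realType}.
Local Notation mu := (@lebesgue_measure R).
Implicit Types t x y : R.

(** This is t^(1/2) (t + |x|)^(-3/2), comparable to the dilate of [phi]. Its square is rational, so
    that pointwise comparisons become polynomial inequalities, and it has an elementary primitive on
    each half-line. *)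
Definition bump t x : R := Num.sqrt (t / (t + `|x|) ^+ 3).

Lemma tnorm_gt0 t x : 0 < t -> 0 < t + `|x|.
Proof. by move=> t0; rewrite ltr_wpDr. Qed.

Lemma bump_ge0 t x : 0 <= bump t x.
Proof. exact: sqrtr_ge0. Qed.

Lemma bump_sqr t x : 0 < t -> bump t x ^+ 2 = t / (t + `|x|) ^+ 3.
Proof.
by move=> t0; rewrite sqr_sqrtr// divr_ge0 ?exprn_ge0// ltW// tnorm_gt0.
Qed.

Lemma bumpN t x : bump t (- x) = bump t x.
Proof. by rewrite /bump normrN. Qed.

Lemma continuous_bump t : 0 < t -> continuous (bump t).
Proof.
move=> t0 x; apply: (@continuous_comp _ _ _ (fun x => t / (t + `|x|) ^+ 3) Num.sqrt);
  last exact: sqrt_continuous.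
apply: cvgM; first exact: cvg_cst.
apply: cvgV; first by rewrite expf_neq0// gt_eqF// ltr_wpDr.
have c : t + `|y| @[y --> x] --> t + `|x|.
  by apply: cvgD; [exact: cvg_cst|exact: norm_continuous].
by apply: cvgM => //; apply: cvgM.
Qed.

Lemma measurable_bump t : 0 < t -> measurable_fun setT (bump t).
Proof. by move=> t0; apply: continuous_measurable_fun; exact: continuous_bump. Qed.

Lemma nint_bump t : 0 < t -> (nint (bump t) <= 4%:E)%E.
Proof.
move=> t0; rewrite /nint ge0_symfun_integralT; last 3 first.
- by move=> x; exact: bump_ge0.
- exact: continuous_bump.
- by move=> x; rewrite /= bumpN.
rewrite (_ : [set x : R | 0 <= x] = `[0, +oo[%classic); last first.
  by apply/seteqP; split => x /=; rewrite in_itv/= andbT.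
rewrite ge0_integral_ereal_sup; [|by move=> x; exact: bump_ge0|exact: measurable_bump].
have -> : 4%:E = (2%:E * 2%:E)%E :> \bar R by rewrite -EFinM; congr EFin; ring.
rewrite lee_pmul2l//; apply: ge_ereal_sup => _ [n _ <-].
(* A primitive on the half-line; its total increment is 2, doubled by symmetry to the 4 of the
   statement. *)
pose F x : R := (- 2 * Num.sqrt t) * (Num.sqrt (t + x))^-1.
have d (x : R) : 0 <= x <= n.+1%:R -> is_derive x (1 : R) F (bump t x).
  move=> /andP[x0 _].
  have tx : 0 < t + x by rewrite ltr_wpDr.
  have s0 : 0 < Num.sqrt (t + x) by rewrite sqrtr_gt0.
  have d1 : is_derive x (1 : R) (fun y => t + y) 1.
    by have := is_deriveD (is_derive_cst t x 1) (is_derive_id x (1 : R)); rewrite add0r.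
  have d2 := is_derive1_comp (is_derive1_sqrt tx) d1.
  have d3 := @is_deriveV R (fun y : R => Num.sqrt (t + y)) x _ _ (lt0r_neq0 s0) d2.
  have d4 := is_deriveZ (- 2 * Num.sqrt t) d3.
  apply: (is_derive_eq d4).
  rewrite /= /GRing.scale /= /bump (ger0_norm x0) sqrtrM ?ltW// sqrtrV ?exprn_ge0 ?ltW//.
  have -> : Num.sqrt ((t + x) ^+ 3) = (t + x) * Num.sqrt (t + x).
    rewrite exprSr sqrtrM ?sqr_ge0// sqrtr_sqr ger0_norm//; exact: ltW.
  have E2 : t + x = Num.sqrt (t + x) ^+ 2 by rewrite sqr_sqrtr// ltW.
  by rewrite [in RHS]E2 sqrtr_sqr (ger0_norm (ltW s0)); field; exact: lt0r_neq0.
rewrite (integral_is_derive (ltr0Sn _ n) (continuous_bump t0) d).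
rewrite lee_fin /F addr0.
have s0 : 0 < Num.sqrt t by rewrite sqrtr_gt0.
have -> : - 2 * Num.sqrt t / Num.sqrt t = - 2 by rewrite mulfK ?gt_eqF.
rewrite opprK -lerBrDr subrr.
by rewrite !mulNr oppr_le0 !mulr_ge0 ?invr_ge0 ?sqrtr_ge0.
Qed.

Lemma bump_le t s x y (c : R) : 0 < t -> 0 < s -> 0 <= c ->
  t * (s + `|y|) ^+ 3 <= c ^+ 2 * (s * (t + `|x|) ^+ 3) ->
  bump t x <= c * bump s y.
Proof.
move=> t0 s0 c0 h.
have tx : 0 < t + `|x| by rewrite ltr_wpDr.
have sy : 0 < s + `|y| by rewrite ltr_wpDr.
rewrite -(@ler_pXn2r _ 2)// ?nnegrE ?bump_ge0 ?mulr_ge0 ?bump_ge0//.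
rewrite exprMn !bump_sqr// ler_pdivrMr ?exprn_gt0//.
rewrite [leRHS](_ : _ = c ^+ 2 * (s * (t + `|x|) ^+ 3) / (s + `|y|) ^+ 3); last by ring.
by rewrite ler_pdivlMr ?exprn_gt0.
Qed.

(** The constant 3 rounds up 2^(3/2), the price of a factor 2 in t + |x|. The 3 in the next two
    comparisons has the same origin. *)
Lemma bump_le_of_norm t x y : 0 < t -> t + `|y| <= 2 * (t + `|x|) ->
  bump t x <= 3 * bump t y.
Proof.
move=> t0 h; apply: bump_le => //.
have h3 : (t + `|y|) ^+ 3 <= (2 * (t + `|x|)) ^+ 3.
  by rewrite ler_pXn2r ?nnegrE ?mulr_ge0 ?(ltW (tnorm_gt0 _ _)).
rewrite [leRHS]mulrCA ler_pM2l//; apply: le_trans h3 _; rewrite exprMn.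
rewrite ler_wpM2r ?exprn_ge0 ?(ltW (tnorm_gt0 _ _))//; lra.
Qed.

Lemma bump_shift t x y : 0 < t -> `|y| <= t -> bump t (x - y) <= 3 * bump t x.
Proof.
move=> t0 yt; apply: bump_le_of_norm => //.
have := ler_normD (x - y) y; rewrite subrK; have := normr_ge0 (x - y); lra.
Qed.

Lemma bump_le_scale t s x : 0 < t -> t <= s -> s <= `|x| ->
  bump t x <= 3 * bump s x.
Proof.
move=> t0 ts sx; have s0 : 0 < s by exact: lt_le_trans ts.
apply: bump_le => //.
have h3 : (s + `|x|) ^+ 3 <= (2 * (t + `|x|)) ^+ 3.
  by rewrite ler_pXn2r ?nnegrE ?mulr_ge0 ?(ltW (tnorm_gt0 _ _))//; lra.
have p0 : 0 <= (t + `|x|) ^+ 3 by rewrite exprn_ge0// ltW// tnorm_gt0.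
rewrite exprMn in h3.
apply: (@le_trans _ _ (s * (2 ^+ 3 * (t + `|x|) ^+ 3))).
  by apply: ler_pM => //; [exact: ltW|rewrite exprn_ge0// ltW// tnorm_gt0].
rewrite [leRHS]mulrCA ler_pM2l// ler_wpM2r//; lra.
Qed.

Lemma bump_max t x : 0 < t -> bump t x <= t^-1.
Proof.
move=> t0; have := bump_sqr x t0; set b := bump t x => E.
have b0 : 0 <= b by exact: bump_ge0.
rewrite -(@ler_pXn2r _ 2)// ?nnegrE ?invr_ge0 ?(ltW t0)//.
have tx : t <= t + `|x| by rewrite lerDl.
rewrite E ler_pdivrMr ?exprn_gt0 ?ltr_wpDr// exprVn.
rewrite -(ler_pM2l (exprn_gt0 2 t0)) mulrA mulfV ?mul1r ?expf_neq0 ?gt_eqF//.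
by rewrite -exprSr ler_pXn2r ?nnegrE ?(ltW t0) ?(ltW (tnorm_gt0 _ _)).
Qed.

(** Here t + |x| <= c t, and the loss c^(3/2) is rounded up to c^2, as c >= 1. *)
Lemma le_bump t x (c : R) : 0 < t -> 0 < c -> `|x| <= (c - 1) * t ->
  t^-1 <= c ^+ 2 * bump t x.
Proof.
move=> t0 c0 xc.
have c1 : 1 <= c.
  have : 0 <= (c - 1) * t by exact: le_trans (normr_ge0 x) xc.
  by rewrite pmulr_lge0// subr_ge0.
rewrite -(@ler_pXn2r _ 2)// ?nnegrE ?invr_ge0 ?(ltW t0) ?mulr_ge0 ?exprn_ge0 ?bump_ge0 ?(ltW c0)//.
have tx0 : 0 < t + `|x| by rewrite ltr_wpDr.
have tx : t + `|x| <= c * t by lra.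
rewrite exprMn bump_sqr// mulrA ler_pdivlMr ?exprn_gt0// exprVn.
rewrite ler_pdivrMl ?exprn_gt0//.
apply: (@le_trans _ _ ((c * t) ^+ 3)).
  by rewrite ler_pXn2r ?nnegrE ?(ltW tx0) ?mulr_ge0 ?(ltW t0) ?(ltW c0).
have c3 : c ^+ 3 <= c ^+ 4 by rewrite ler_weXn2l.
have -> : t ^+ 2 * ((c ^+ 2) ^+ 2 * t) = c ^+ 4 * t ^+ 3 by ring.
by rewrite exprMn ler_wpM2r// exprn_ge0// ltW.
Qed.

(** Uniform in t, and here the exponent 3/2 counts: this bounds |x - c|^2 |b|^2 for a bad piece
    however small its scale is compared with the block. *)
Lemma bump_decay t x : 0 < t -> `|x| ^+ 2 * bump t x ^+ 2 <= 1.
Proof.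
move=> t0; have tx0 : 0 < t + `|x| by rewrite ltr_wpDr.
rewrite bump_sqr// mulrA ler_pdivrMr ?exprn_gt0// mul1r.
rewrite [leRHS]exprSr; apply: ler_pM; rewrite ?sqr_ge0 ?(ltW t0)//.
  by rewrite ler_pXn2r ?nnegrE ?normr_ge0 ?(ltW tx0)// lerDr ltW.
by rewrite lerDl.
Qed.

(** Lets [nint_bump] integrate (t + |x|)^(-2) on the frequency side, where t is the reciprocal of a
    block length. *)
Lemma inv_sqr_le_bump t x : 0 < t -> (t + `|x|) ^- 2 <= t^-1 * bump t x.
Proof.
move=> t0; have tx0 : 0 < t + `|x| by rewrite ltr_wpDr.
rewrite -(@ler_pXn2r _ 2)// ?nnegrE ?mulr_ge0 ?invr_ge0 ?exprn_ge0 ?bump_ge0 ?(ltW t0) ?(ltW tx0)//.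
rewrite exprMn bump_sqr// exprVn mulrA -exprVn.
have -> : t^-1 ^+ 2 * t = t^-1 by field; rewrite gt_eqF.
rewrite exprVn -exprM ler_pdivlMr ?exprn_gt0//.
have -> : ((t + `|x|) ^+ (2 * 2))^-1 * (t + `|x|) ^+ 3 = (t + `|x|)^-1.
  by field; rewrite gt_eqF.
by rewrite lef_pV2 ?posrE// lerDl.
Qed.

(* At least one of the two arguments is comparable to [c - c'] or larger. *)
Lemma bump_mul_le t s x c c' : 0 < s -> s <= t ->
  bump t (x - c) * bump s (x - c') <=
  9 * bump t (c - c') * (bump t (x - c) + bump s (x - c')).
Proof.
move=> s0 st; have t0 : 0 < t by exact: lt_le_trans st.
have b1 := bump_ge0 t (x - c); have b2 := bump_ge0 s (x - c').
have b3 := bump_ge0 t (c - c').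
have tri : `|c - c'| <= `|x - c| + `|x - c'|.
  by rewrite -(normrN (x - c)) opprB; have := ler_normD (c - x) (x - c'); rewrite addrA subrK.
have [h|h] := leP `|c - c'| (2 * `|x - c|).
  have := @bump_le_of_norm t (x - c) (c - c') t0.
  have h' : t + `|c - c'| <= 2 * (t + `|x - c|) by lra.
  move=> /(_ h') k.
  rewrite mulrDr; apply: (@le_trans _ _ (3 * bump t (c - c') * bump s (x - c'))).
    by rewrite ler_wpM2r.
  have := mulr_ge0 b3 b1; have := mulr_ge0 b3 b2; nra.
have h2 : `|c - c'| <= 2 * `|x - c'| by lra.
(* Now |x - c'| is at least half of |c - c'|. If |c - c'| <= t, [bump t] at c - c' is within a
   factor 4 of its upper bound 1 / t; otherwise passing from x - c' to c - c' and then from scale s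
   to scale t costs 3 twice. *)
have [h3|h3] := leP `|c - c'| t.
  have k1 := bump_max (x - c) t0.
  have k2 : t^-1 <= 2 ^+ 2 * bump t (c - c') by apply: le_bump => //; lra.
  rewrite mulrDr; apply: (@le_trans _ _ (4 * bump t (c - c') * bump s (x - c'))).
    rewrite ler_wpM2r//; apply: le_trans k1 _; apply: le_trans k2 _.
    by rewrite ler_wpM2r//; lra.
  have := mulr_ge0 b3 b1; have := mulr_ge0 b3 b2; nra.
have k1 := @bump_le_of_norm s (x - c') (c - c') s0.
have h' : s + `|c - c'| <= 2 * (s + `|x - c'|) by lra.
have k2 := bump_le_scale s0 st (ltW h3).
have k3 : bump s (x - c') <= 9 * bump t (c - c').
  by have := k1 h'; lra.
rewrite mulrDr; apply: (@le_trans _ _ (9 * bump t (c - c') * bump t (x - c))).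
  by rewrite mulrC ler_wpM2r.
by rewrite lerDl mulr_ge0// mulr_ge0.
Qed.

(** Fourth powers clear the exponents 3/4 and 1/2; what remains is (1 + |y|)^2 <= 2 (1 + y^2),
    cubed, together with 2^3 <= 2^4. *)
Lemma phi_le_bump t x : 0 < t -> dilate t phi x <= 2 * bump t x.
Proof.
move=> t0; rewrite /dilate /phi.
set y := t^-1 * x; set q := 1 + `|y| ^+ 2.
have q0 : 0 < q by rewrite ltr_wpDr// sqr_ge0.
have E : (q `^ (- (3 / 4))) ^+ 4 = (q ^+ 3)^-1.
  rewrite -powR_mulrn ?powR_ge0// -powRrM mulNr divfK// powRN; congr _^-1.
  by rewrite powR_mulrn// ltW.
have ty : t * (1 + `|y|) = t + `|x|.
  by rewrite /y normrM gtr0_norm ?invr_gt0// mulrDr mulr1 mulrA mulfV ?mul1r// gt_eqF.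
rewrite -(@ler_pXn2r _ 4)// ?nnegrE ?mulr_ge0 ?invr_ge0 ?powR_ge0 ?bump_ge0 ?(ltW t0)//.
rewrite !exprMn E (_ : bump t x ^+ 4 = (bump t x ^+ 2) ^+ 2); last by rewrite -exprM.
rewrite bump_sqr// -ty.
have y0 := normr_ge0 y.
have y1 : 0 < 1 + `|y| by rewrite ltr_wpDr.
have -> : 2 ^+ 4 * (t / (t * (1 + `|y|)) ^+ 3) ^+ 2 =
    t^-1 ^+ 4 * (2 ^+ 4 * ((1 + `|y|) ^+ 6)^-1).
  by field; rewrite !gt_eqF.
rewrite ler_wpM2l ?exprn_ge0 ?invr_ge0 ?(ltW t0)//.
rewrite ler_pdivlMr ?exprn_gt0// ler_pdivrMl ?exprn_gt0//.
have h : (1 + `|y|) ^+ 2 <= 2 * q by rewrite /q; have := sqr_ge0 (1 - `|y|); lra.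
have -> : (1 + `|y|) ^+ 6 = ((1 + `|y|) ^+ 2) ^+ 3 by rewrite -exprM.
apply: (@le_trans _ _ ((2 * q) ^+ 3)).
  by rewrite ler_pXn2r ?nnegrE ?sqr_ge0// mulr_ge0// ltW.
rewrite exprMn mulrC ler_wpM2l ?exprn_ge0 ?(ltW q0)//; lra.
Qed.

End Bump.

Section Translation.
Context {R : realType}.
Local Notation mu := (@lebesgue_measure R).

Lemma Rintegral_translate (g : R -> R) (c : R) : measurable_fun setT g ->
  Rintegral mu setT (fun x => g (x + c)) = Rintegral mu setT g.
Proof.
move=> mg; rewrite /Rintegral; congr fine; rewrite integralE [RHS]integralE.
have mE : measurable_fun setT (EFin \o g) by apply/measurable_EFinP.
congr (_ - _)%E.
  rewrite -[RHS](@integral_translate _ _ c (measurable_funepos mE)).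
    by apply: eq_integral => x _; rewrite !funeposE.
  by move=> x; exact: funepos_ge0.
rewrite -[RHS](@integral_translate _ _ c (measurable_funeneg mE)).
  by apply: eq_integral => x _; rewrite !funenegE.
by move=> x; exact: funeneg_ge0.
Qed.

Lemma cintegral_translate (f : R -> R[i]) (c : R) : cmeasurable f ->
  cintegral (fun x => f (x + c)) = cintegral f.
Proof.
move=> [f1 f2]; rewrite /cintegral; congr (_ +i* _)%C.
  exact: (@Rintegral_translate (fun x => complex.Re (f x))).
exact: (@Rintegral_translate (fun x => complex.Im (f x))).
Qed.

End Translation.

(** * Multiplier operators, bounded overlap and finite differences *)

Section Multiplier.
Context {R : realType}.
Local Notation mu := (@lebesgue_measure R).
Implicit Types f u w b m : R -> R[i].

(** What the argument uses of a Mihlin multiplier. The derivative bound becomes an increment bound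
    away from [xi0], fit for finite differences; at xi = xi0 that clause only concerns h = 0. The
    bounded support makes products with Fourier transforms compactly supported. *)
Record hm_mult m (S : set R) (xi0 : R) : Prop := HMMult {
  hm_meas : cmeasurable m;
  hm_supp : forall xi, ~ S xi -> m xi = 0;
  hm_le1 : forall xi, cmod (m xi) <= 1;
  hm_cpt : exists2 K : R, 0 < K & forall xi, S xi -> `|xi| <= K;
  hm_diff : forall xi h, 2 * `|h| <= `|xi - xi0| ->
    cmod (m (xi + h) - m xi) <= 4 * `|h| / `|xi - xi0| }.

Lemma hm_cutoff m S xi0 : hm_mult m S xi0 ->
  exists2 K : R, 0 < K & forall xi, cmod (m xi) <= cutoff K xi.
Proof.
move=> hm; have [K K0 SK] := hm_cpt hm; exists K => // xi; rewrite cutoffE.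
have [Sx|nSx] := pselect (S xi); first by rewrite SK// (hm_le1 hm).
by rewrite (hm_supp hm)// cmod0.
Qed.

Lemma nice_hm_fourier m S xi0 u : hm_mult m S xi0 -> cintegrable u ->
  nice (fun xi => m xi * fourier u xi).
Proof.
move=> hm ui; have [K K0 mK] := hm_cutoff hm.
have [M M0 uM] : exists2 M, 0 <= M & nint (fun x => cmod (u x)) = M%:E.
  have := nint_ge0 (fun x => cmod_ge0 (u x)).
  by case: ui => _; case: (nint _) => [r|//|//] _ r0; exists r => //; rewrite -lee_fin.
split; first by apply: cmeasurableM; [exact: hm_meas hm|exact: measurable_fourier].
exists M, K; split => // xi; rewrite cmodM mulrC.
apply: ler_pM; rewrite ?cmod_ge0//.
by rewrite -lee_fin -uM cmod_fourier_le.
Qed.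

Lemma multiplier_opE m u x :
  multiplier_op m u x = ift (fun xi => m xi * fourier u xi) x.
Proof. by []. Qed.

Lemma ift_sum (I : Type) (s : seq I) (w : I -> R -> R[i]) x :
  (forall i, cintegrable (w i)) ->
  ift (fun xi => \sum_(i <- s) w i xi) x = \sum_(i <- s) ift (w i) x.
Proof.
move=> wi; rewrite /ift -cintegral_sum.
  by apply: eq_cintegral => xi; rewrite mulr_suml.
by move=> i; apply: cintegrable_expi => //; meas.
Qed.

Lemma iftB u w x : cintegrable u -> cintegrable w ->
  ift (fun xi => u xi - w xi) x = ift u x - ift w x.
Proof.
move=> ui wi; rewrite /ift -cintegralB; try by apply: cintegrable_expi => //; meas.
by apply: eq_cintegral => xi; rewrite mulrBl.
Qed.

Lemma iftZ c w x : cintegrable w -> ift (fun xi => c * w xi) x = c * ift w x.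
Proof.
move=> wi; rewrite /ift -cintegralZ; last by apply: cintegrable_expi => //; meas.
by apply: eq_cintegral => xi; rewrite mulrA.
Qed.

Lemma ift_shift w x h : cintegrable w ->
  ift (fun xi => w (xi - h)) x = expi (2 * pi * x * h) * ift w x.
Proof.
move=> wi; rewrite /ift -cintegralZ; last by apply: cintegrable_expi => //; meas.
rewrite -(@cintegral_translate _ (fun xi => expi (2 * pi * x * h) *
  (w xi * expi (2 * pi * x * xi))) (- h)); last first.
  by have [mw _] := wi; cmeas.
apply: eq_cintegral => xi.
by rewrite mulrCA -expiD; congr (_ * expi _); ring.
Qed.

Lemma multiplier_op_sum (I : Type) (s : seq I) m S xi0 (u : I -> R -> R[i]) x :
  hm_mult m S xi0 -> (forall i, cintegrable (u i)) ->
  multiplier_op m (fun y => \sum_(i <- s) u i y) x =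
  \sum_(i <- s) multiplier_op m (u i) x.
Proof.
move=> hm ui; rewrite multiplier_opE -ift_sum; last first.
  by move=> i; apply: nice_cintegrable; exact: (nice_hm_fourier hm (ui _)).
by apply: eq_cintegral => xi; rewrite fourier_sum// mulr_sumr.
Qed.

Lemma multiplier_opB m S xi0 f u x :
  hm_mult m S xi0 -> cintegrable f -> cintegrable u ->
  multiplier_op m (fun y => f y - u y) x =
  multiplier_op m f x - multiplier_op m u x.
Proof.
move=> hm fi ui; rewrite multiplier_opE -iftB;
  try by apply: nice_cintegrable; exact: (nice_hm_fourier hm).
by apply: eq_cintegral => xi; rewrite fourierB// mulrBr.
Qed.

Lemma multiplier_opD m S xi0 f u x :
  hm_mult m S xi0 -> cintegrable f -> cintegrable u ->
  multiplier_op m (fun y => f y + u y) x =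
  multiplier_op m f x + multiplier_op m u x.
Proof.
move=> hm fi ui.
rewrite -[in RHS](_ : multiplier_op m (fun y => (f y + u y) - u y) x = multiplier_op m f x).
  by rewrite (multiplier_opB _ hm)//; [rewrite subrK|exact: cintegrableD].
by congr (multiplier_op m _ x); apply/funext => y; rewrite addrK.
Qed.

Lemma measurable_multiplier_op m S xi0 u : hm_mult m S xi0 -> cintegrable u ->
  cmeasurable (multiplier_op m u).
Proof.
move=> hm ui; apply: (@measurable_ift _ (fun xi => m xi * fourier u xi)).
by apply: nice_cintegrable; exact: (nice_hm_fourier hm).
Qed.

Variables (J : Type) (A : seq J) (m : J -> R -> R[i]) (S : J -> set R) (xi0 : J -> R)
  (N : R).
Hypothesis hm : forall i, hm_mult (m i) (S i) (xi0 i).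
Hypothesis overlap : forall x, \sum_(i <- A) (\1_(S i) x : R) <= N.

Let N0 : 0 <= N.
Proof. by apply: le_trans (overlap 0); apply: sumr_ge0 => i _; rewrite indicE. Qed.

Lemma hm_neq0_le_indic i z xi : ((m i xi * z != 0)%:R : R) <= \1_(S i) xi.
Proof.
rewrite indicE ler_nat; have [Sx|nSx] := pselect (S i xi).
  by rewrite mem_set//; case: (_ != 0).
by rewrite (hm_supp (hm i))// mul0r eqxx.
Qed.

Lemma nint_multiplier_sum (u : J -> R -> R[i]) : (forall i, nice (u i)) ->
  (nint (fun x => (cmod (\sum_(i <- A) multiplier_op (m i) (u i) x) ^+ 2)%R) <=
   N%:E * \sum_(i <- A) nint (fun x => (cmod (u i x) ^+ 2)%R))%E.
Proof.
move=> nu.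
have nw i : nice (fun xi => m i xi * fourier (u i) xi).
  by apply: (nice_hm_fourier (hm i)); exact: nice_cintegrable.
under eq_fun do rewrite -(ift_sum _ _ (fun i => nice_cintegrable (nw i))).
apply: le_trans (plancherel_ift_le (nice_sum A nw)) _.
have mF i : measurable_fun setT (fun xi => cmod (fourier (u i) xi) ^+ 2).
  by apply: measurable_cmod_sqr; apply: measurable_fourier; exact: nice_cintegrable.
apply: (@le_trans _ _ (nint (fun xi =>
    N * \sum_(i <- A) cmod (fourier (u i) xi) ^+ 2))).
  apply: le_nint => xi; first exact: sqr_ge0.
  apply: le_trans (@cmod_sum_sqr _ _ _ _ N _) _.
    by apply: le_trans (overlap xi); apply: ler_sum => i _; exact: hm_neq0_le_indic.
  rewrite ler_wpM2l//; apply: ler_sum => i _.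
  rewrite ler_pXn2r ?nnegrE ?cmod_ge0// cmodM ler_piMl ?cmod_ge0//.
  exact: hm_le1 (hm i) xi.
rewrite nintZ//; last 2 first.
- exact: measurable_sum.
- by move=> x; apply: sumr_ge0 => i _; exact: sqr_ge0.
rewrite nint_sum//; last by move=> i x; exact: sqr_ge0.
rewrite lee_wpmul2l// ?lee_fin//; apply: lee_sum => i _; exact: plancherel_le.
Qed.

(* Multiplying a function by [expi (2 * pi * (x - c) * h) - 1] takes a finite
   difference of step [h] on the Fourier side; this replaces differentiation of
   the multipliers. *)
Definition fdiff (c h : R) w xi : R[i] := expi (- (2 * pi * c * h)) * w (xi - h) - w xi.

Lemma nice_fdiff c h w : nice w -> nice (fdiff c h w).
Proof.
by move=> nw; apply: niceB => //; apply: niceZ; exact: nice_translate.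
Qed.

Lemma ift_fdiff c h w x : nice w ->
  ift (fdiff c h w) x = (expi (2 * pi * (x - c) * h) - 1) * ift w x.
Proof.
move=> nw; have wi := nice_cintegrable nw.
have wi' := nice_cintegrable (nice_translate (- h) nw).
rewrite iftB//; last exact: cintegrableZ.
rewrite iftZ// ift_shift// mulrA -expiD mulrBl mul1r.
by congr (expi _ * _ - _); ring.
Qed.

Lemma nint_multiplier_sum_fdiff (c h : R) (u : J -> R -> R[i]) :
  (forall i, nice (u i)) ->
  (nint (fun x => (cmod (expi (2 * pi * (x - c) * h) - 1) ^+ 2 *
      cmod (\sum_(i <- A) multiplier_op (m i) (u i) x) ^+ 2)%R) <=
   (2 * N)%:E * \sum_(i <- A) nint (fun xi =>
      (cmod (fdiff c h (fun xi => m i xi * fourier (u i) xi) xi) ^+ 2)%R))%E.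
Proof.
move=> nu; pose w i xi := m i xi * fourier (u i) xi.
have nw i : nice (w i).
  by apply: (nice_hm_fourier (hm i)); exact: nice_cintegrable.
have nd i := nice_fdiff c h (nw i).
have E x : cmod (expi (2 * pi * (x - c) * h) - 1) ^+ 2 *
      cmod (\sum_(i <- A) multiplier_op (m i) (u i) x) ^+ 2 =
    cmod (ift (fun xi => \sum_(i <- A) fdiff c h (w i) xi) x) ^+ 2.
  rewrite -exprMn -cmodM mulr_sumr ift_sum; last by move=> i; exact: nice_cintegrable.
  by congr (cmod _ ^+ 2); apply: eq_bigr => i _; rewrite ift_fdiff.
under eq_fun do rewrite E.
apply: le_trans (plancherel_ift_le (nice_sum A nd)) _.
have mF i : measurable_fun setT (fun xi => cmod (fdiff c h (w i) xi) ^+ 2).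
  by apply: measurable_cmod_sqr; have [] := nd i.
apply: (@le_trans _ _ (nint (fun xi =>
    2 * N * \sum_(i <- A) cmod (fdiff c h (w i) xi) ^+ 2))).
  apply: le_nint => xi; first exact: sqr_ge0.
  apply: cmod_sum_sqr.
  (* A difference is nonzero only where xi or xi - h lies in the support, so the overlap is at most
     2 N. *)
  apply: (@le_trans _ _ (\sum_(i <- A) (\1_(S i) (xi - h) + \1_(S i) xi))).
    apply: ler_sum => i _; rewrite /fdiff.
    have h1 := hm_neq0_le_indic i (fourier (u i) (xi - h)) (xi - h).
    have h2 := hm_neq0_le_indic i (fourier (u i) xi) xi.
    apply: le_trans (lerD h1 h2); rewrite -/(w i (xi - h)) -/(w i xi).
    rewrite -natrD ler_nat.
    have [->|] := eqVneq (w i (xi - h)) 0; last by case: (_ - _ != 0).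
    have [->|] := eqVneq (w i xi) 0; last by case: (_ - _ != 0).
    by rewrite mulr0 subr0 eqxx.
  rewrite big_split /=; have := overlap xi; have := overlap (xi - h); lra.
rewrite nintZ//; last 3 first.
- exact: measurable_sum.
- by move=> x; apply: sumr_ge0 => i _; exact: sqr_ge0.
- by rewrite mulr_ge0.
by rewrite nint_sum//; move=> i x; exact: sqr_ge0.
Qed.

End Multiplier.

Section FiniteDifference.
Context {R : realType}.
Local Notation mu := (@lebesgue_measure R).
Implicit Types f u w b m : R -> R[i].

Lemma nint_le_fin (f : R -> R) (v : R) : (forall x, 0 <= f x) ->
  (nint f <= v%:E)%E -> 0 <= v.
Proof. by move=> f0 /(le_trans (nint_ge0 f0)); rewrite lee_fin. Qed.

(** The transform vanishes at [xi], so a multiple of its defining integral can be subtracted. The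
    factor [e] recentres the phases at [c]: they then differ by 2 pi |zeta - xi| |x - c| with |x -
    c| <= 3 l, and the factor 2 of [cmod_expi_sub] makes this 12 pi l |zeta - xi|. *)
Lemma cmod_fourier_sub b (c l V zeta xi : R) : nice b -> 0 < l ->
  (forall x, 3 * l < `|x - c| -> b x = 0) ->
  (nint (fun x => cmod (b x)) <= V%:E)%E -> fourier b xi = 0 ->
  cmod (fourier b zeta) <= 12 * pi * l * `|zeta - xi| * V.
Proof.
move=> nb l0 b1 b2 b4; have bi := nice_cintegrable nb.
pose e := expi (- (2 * pi * c * (zeta - xi))).
have E : fourier b zeta = cintegral (fun x =>
    b x * (expi (- (2 * pi * x * zeta)) - e * expi (- (2 * pi * x * xi)))).
  rewrite -[LHS]subr0 -(mulr0 e) -b4 -cintegralZ; last exact: cintegrable_fourier.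
  rewrite -cintegralB; last 2 first.
  - exact: cintegrable_fourier.
  - by apply: cintegrableZ; exact: cintegrable_fourier.
  by apply: eq_cintegral => x; rewrite mulrBr [in RHS]mulrCA.
have bi' : cintegrable (fun x =>
    b x * (expi (- (2 * pi * x * zeta)) - e * expi (- (2 * pi * x * xi)))).
  apply: (@cintegrableM_bounded _ _ _ 2) => //.
    by apply: cmeasurableB; cmeas.
  move=> x; apply: le_trans (cmodB _ _) _.
  by rewrite cmodM !cmod_expi mulr1.
have p0 : 0 <= 12 * pi * l * `|zeta - xi| by rewrite !mulr_ge0 ?pi_ge0 ?(ltW l0).
rewrite -lee_fin E EFinM; apply: le_trans (le_cmod_cintegral bi') _.
apply: (@le_trans _ _ ((12 * pi * l * `|zeta - xi|)%:E *
    nint (fun x => cmod (b x)))%E); last by rewrite lee_wpmul2l// lee_fin.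
rewrite -nintZ//; [|by apply: measurable_cmod; case: nb|by move=> x; exact: cmod_ge0].
apply: le_nint => x; first exact: cmod_ge0.
rewrite cmodM mulrC; have [xl|xl] := leP `|x - c| (3 * l); last first.
  by rewrite b1// cmod0 !mulr0.
rewrite ler_wpM2r ?cmod_ge0// /e -expiD.
apply: le_trans (cmod_expi_sub _ _) _.
have -> : - (2 * pi * x * zeta) - (- (2 * pi * c * (zeta - xi)) + - (2 * pi * x * xi))
   = - (2 * pi) * (zeta - xi) * (x - c) by ring.
rewrite !normrM normrN normrM (ger0_norm (pi_ge0 R)) ger0_norm//.
have := ler_wpM2l (mulr_ge0 (pi_ge0 R) (normr_ge0 (zeta - xi))) xl.
lra.
Qed.

(** The summands belong to the differences falling on the multiplier and on the transform of the
    piece. Each carries the 2 of [cmod_sqrD]; the 4 is the bound on the integral of [bump]. *)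
Definition hm_const (B : R) : R :=
  2 * (4 * (216 * pi) ^+ 2) + 2 * ((4 * pi) ^+ 2 * B).

Lemma hm_const_ge0 (B : R) : 0 <= B -> 0 <= hm_const B.
Proof.
move=> B0; apply: addr_ge0; apply: mulr_ge0; try exact: ler0n.
  by apply: mulr_ge0; [exact: ler0n|exact: sqr_ge0].
by apply: mulr_ge0 => //; exact: sqr_ge0.
Qed.

(** Discrete Leibniz rule: [D1] carries the difference of [m], [D2] that of the transform of [b]. By
    Plancherel, [D2] is controlled by the weighted norm of |x - c| b. In [D1] the zero at [xi0]
    compensates the singularity, and the resulting bound V h / (t + |xi - xi0|), t = 1 / l, has a
    square integral of order V^2 l h^2. *)
Lemma nint_fdiff_hm m S b (xi0 c l V h B : R) :
  hm_mult m S xi0 -> nice b -> 0 < l -> 0 < h -> h <= l^-1 ->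
  (forall x, 3 * l < `|x - c| -> b x = 0) ->
  (nint (fun x => cmod (b x)) <= V%:E)%E ->
  (nint (fun x => (`|x - c| ^+ 2 * cmod (b x) ^+ 2)%R) <= (B * V ^+ 2 * l)%:E)%E ->
  fourier b xi0 = 0 ->
  (nint (fun xi => (cmod (fdiff c h (fun z => m z * fourier b z) xi) ^+ 2)%R) <=
   (hm_const B * V ^+ 2 * l * h ^+ 2)%:E)%E.
Proof.
move=> hm nb l0 h0 hl b1 b2 b3 b4; have bi := nice_cintegrable nb.
have V0 : 0 <= V by apply: nint_le_fin b2 => x; exact: cmod_ge0.
pose t := l^-1; have t0 : 0 < t by rewrite invr_gt0.
pose b' x := expi (- (2 * pi * c * h)) * (expi (2 * pi * x * h) * b x) - b x.
have nEb : nice (fun x => expi (2 * pi * x * h) * b x).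
  by apply: nice_expi => //; meas.
have nb' : nice b' by apply: niceB => //; apply: niceZ.
pose D1 xi := (m (xi - h) - m xi) *
  (expi (- (2 * pi * c * h)) * fourier b (xi - h)).
pose D2 xi := m xi * fourier b' xi.
have fb' xi : fourier b' xi =
    expi (- (2 * pi * c * h)) * fourier b (xi - h) - fourier b xi.
  rewrite fourierB//; try exact: nice_cintegrable.
    by rewrite fourierZ ?fourier_shift//; exact: nice_cintegrable.
  by apply: nice_cintegrable; exact: niceZ.
have E xi : fdiff c h (fun z => m z * fourier b z) xi = D1 xi + D2 xi.
  by rewrite /fdiff /D1 /D2 fb'; ring.
(* Three ranges of |z|. Below 2 h, [m] is merely bounded and the transform is O(h l V); this range
   yields the 216. Between 2 h and t, the increment bound h / |z| meets the cancellation |z| l V.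
   From t on, the increment bound and the trivial bound V suffice. *)
have key xi : cmod (D1 xi) <= 216 * pi * V * h / (t + `|xi - xi0|).
  rewrite cmodM [X in _ * X]cmodM cmod_expi mul1r.
  set z := xi - xi0.
  have tz : 0 < t + `|z| by exact: tnorm_gt0.
  have F1 : cmod (fourier b (xi - h)) <= V.
    by rewrite -lee_fin; apply: le_trans (cmod_fourier_le _ bi) b2.
  have F2 : cmod (fourier b (xi - h)) <= 12 * pi * l * `|z - h| * V.
    have := cmod_fourier_sub (xi - h) nb l0 b1 b2 b4.
    by rewrite (_ : xi - h - xi0 = z - h)// /z; ring.
  have zh : `|z - h| <= `|z| + h.
    by apply: le_trans (ler_normB _ _) _; rewrite (gtr0_norm h0).
  have p0 : 0 < pi :> R by exact: pi_gt0.
  have plV : 0 <= pi * l * V by rewrite !mulr_ge0 ?(ltW p0) ?(ltW l0).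
  have F0 := cmod_ge0 (fourier b (xi - h)).
  rewrite ler_pdivlMr//.
  have tl : t * l = 1 by rewrite /t mulVf// gt_eqF.
  have hl1 : h * l <= 1 by rewrite -tl; apply: ler_wpM2r => //; exact: ltW.
  have [zs|zs] := ltP `|z| (2 * h).
    have M2 : cmod (m (xi - h) - m xi) <= 2.
      apply: le_trans (cmodB _ _) _.
      have := hm_le1 hm (xi - h); have := hm_le1 hm xi; lra.
    have F3 : cmod (fourier b (xi - h)) <= 36 * h * (pi * l * V).
      apply: le_trans F2 _; have := ler_wpM2l plV zh; have := ler_wpM2l plV (ltW zs); lra.
    apply: (@le_trans _ _ (2 * (36 * h * (pi * l * V)) * (t + `|z|))).
      by rewrite ler_wpM2r ?(ltW tz)//; apply: ler_pM => //; exact: cmod_ge0.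
    have T3 : t + `|z| <= 3 * t by rewrite /t in hl *; lra.
    have c0 : 0 <= 72 * h * (pi * l * V) by rewrite mulr_ge0// mulr_ge0// ltW.
    have := ler_wpM2l c0 T3.
    have -> : 72 * h * (pi * l * V) * (3 * t) = 216 * pi * V * h * (t * l) by ring.
    rewrite tl; lra.
  have z0 : 0 < `|z| by apply: lt_le_trans zs; rewrite mulr_gt0.
  have M4 : cmod (m (xi - h) - m xi) <= 4 * h / `|z|.
    have := @hm_diff _ _ _ _ hm xi (- h).
    by rewrite normrN (gtr0_norm h0); apply.
  have F3 : cmod (fourier b (xi - h)) <= 18 * `|z| * (pi * l * V).
    apply: le_trans F2 _; have := ler_wpM2l plV zh; have := ler_wpM2l plV zs; lra.
  have M0 := cmod_ge0 (m (xi - h) - m xi).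
  have hz : 0 <= 4 * h / `|z| by exact: le_trans M4.
  have pi2 : 2 <= pi :> R by exact: pi_ge2.
  have Vh : 0 <= V * h by rewrite mulr_ge0// ltW.
  have [zt|zt] := leP t `|z|.
    apply: (@le_trans _ _ (4 * h / `|z| * V * (t + `|z|))).
      by rewrite ler_wpM2r ?(ltW tz)//; apply: ler_pM.
    apply: (@le_trans _ _ (4 * h / `|z| * V * (2 * `|z|))).
      by rewrite ler_wpM2l ?mulr_ge0//; lra.
    have -> : 4 * h / `|z| * V * (2 * `|z|) = 8 * (V * h).
      by field; rewrite gt_eqF.
    have := ler_wpM2r Vh pi2; lra.
  apply: (@le_trans _ _ (4 * h / `|z| * (18 * `|z| * (pi * l * V)) * (t + `|z|))).
    by rewrite ler_wpM2r ?(ltW tz)//; apply: ler_pM.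
  have -> : 4 * h / `|z| * (18 * `|z| * (pi * l * V)) = 72 * h * (pi * l * V).
    by field; rewrite gt_eqF.
  have c0 : 0 <= 72 * h * (pi * l * V) by rewrite mulr_ge0// mulr_ge0// ltW.
  have T2 : t + `|z| <= 2 * t by lra.
  have := ler_wpM2l c0 T2.
  have -> : 72 * h * (pi * l * V) * (2 * t) = 144 * pi * V * h * (t * l) by ring.
  rewrite tl; have := mulr_ge0 (ltW p0) Vh; lra.
have mD1 : cmeasurable D1.
  have mm := hm_meas hm; have mb := measurable_fourier bi.
  apply: cmeasurableM; last first.
    by apply: cmeasurableM; [exact: cmeasurable_cst|apply: cmeasurable_comp => //; meas].
  by apply: cmeasurableB => //; apply: cmeasurable_comp => //; meas.
have mD2 : cmeasurable D2.
  by apply: cmeasurableM; [exact: hm_meas hm|apply: measurable_fourier; exact: nice_cintegrable].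
have I1 : (nint (fun xi => (cmod (D1 xi) ^+ 2)%R) <=
    (4 * (216 * pi) ^+ 2 * V ^+ 2 * l * h ^+ 2)%:E)%E.
  have cst0 : 0 <= (216 * pi * V * h) ^+ 2 * t^-1.
    by rewrite mulr_ge0 ?sqr_ge0// invr_ge0 ltW.
  have mbt : measurable_fun setT (fun xi : R => bump t (xi - xi0)).
    apply: (@measurableT_comp _ _ _ _ _ _ (bump t)); last by meas.
    exact: measurable_bump.
  apply: (@le_trans _ _ (nint (fun xi =>
      (216 * pi * V * h) ^+ 2 * t^-1 * bump t (xi - xi0)))).
    apply: le_nint => xi; first exact: sqr_ge0.
    apply: (@le_trans _ _ ((216 * pi * V * h / (t + `|xi - xi0|)) ^+ 2)).
      rewrite ler_pXn2r ?nnegrE ?cmod_ge0// .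
      exact: le_trans (cmod_ge0 (D1 xi)) (key xi).
    rewrite exprMn -[leRHS]mulrA ler_wpM2l ?sqr_ge0// exprVn.
    exact: inv_sqr_le_bump.
  rewrite nintZ//; last by move=> x; exact: bump_ge0.
  rewrite (@nint_translate _ (bump t) (- xi0)); last 2 first.
  - exact: measurable_bump.
  - by move=> x; exact: bump_ge0.
  apply: (@le_trans _ _ (((216 * pi * V * h) ^+ 2 * t^-1)%:E * 4%:E)%E).
    by rewrite lee_wpmul2l// ?lee_fin// nint_bump.
  by rewrite -EFinM lee_fin /t invrK le_eqVlt; apply/orP; left; apply/eqP; ring.
have I2 : (nint (fun xi => (cmod (D2 xi) ^+ 2)%R) <=
    ((4 * pi) ^+ 2 * B * V ^+ 2 * l * h ^+ 2)%:E)%E.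
  apply: (@le_trans _ _ (nint (fun xi => cmod (fourier b' xi) ^+ 2))).
    apply: le_nint => xi; first exact: sqr_ge0.
    rewrite ler_pXn2r ?nnegrE ?cmod_ge0// cmodM ler_piMl ?cmod_ge0//.
    exact: hm_le1 hm xi.
  apply: le_trans (plancherel_le nb') _.
  have mxb : measurable_fun setT (fun x : R => `|x - c| ^+ 2 * cmod (b x) ^+ 2).
    apply: measurable_funM; last by apply: measurable_cmod_sqr; case: nb.
    apply: measurable_funX; apply: (@measurableT_comp _ _ _ _ _ _ (@Num.norm R R)) => //.
    by meas.
  apply: (@le_trans _ _ (nint (fun x => (4 * pi * h) ^+ 2 *
      (`|x - c| ^+ 2 * cmod (b x) ^+ 2)))).
    apply: le_nint => x; first exact: sqr_ge0.
    have -> : b' x = (expi (2 * pi * (x - c) * h) - 1) * b x.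
      rewrite /b' mulrA -expiD mulrBl mul1r; congr (expi _ * _ - _); ring.
    rewrite cmodM exprMn [leRHS]mulrA ler_wpM2r ?sqr_ge0// -[leRHS]exprMn.
    rewrite ler_pXn2r ?nnegrE ?cmod_ge0//; last first.
      by rewrite !mulr_ge0 ?pi_ge0 ?(ltW h0).
    apply: le_trans (cmod_expi_sub1 _) _.
    rewrite !normrM (ger0_norm (pi_ge0 R)) (gtr0_norm h0) ger0_norm//; lra.
  rewrite nintZ ?sqr_ge0//; last by move=> x; rewrite mulr_ge0 ?sqr_ge0.
  apply: (@le_trans _ _ (((4 * pi * h) ^+ 2)%:E * (B * V ^+ 2 * l)%:E)%E).
    by rewrite lee_wpmul2l// lee_fin sqr_ge0.
  by rewrite -EFinM lee_fin le_eqVlt; apply/orP; left; apply/eqP; ring.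
apply: (@le_trans _ _ (nint (fun xi => 2 * cmod (D1 xi) ^+ 2 + 2 * cmod (D2 xi) ^+ 2))).
  apply: le_nint => xi; first exact: sqr_ge0.
  by rewrite E; exact: cmod_sqrD.
have mD1' := measurable_cmod_sqr mD1; have mD2' := measurable_cmod_sqr mD2.
have c1 x : 0 <= cmod (D1 x) ^+ 2 by exact: sqr_ge0.
have c2 x : 0 <= cmod (D2 x) ^+ 2 by exact: sqr_ge0.
rewrite nintD; last 4 first.
- exact: measurable_funM.
- exact: measurable_funM.
- by move=> x; rewrite mulr_ge0.
- by move=> x; rewrite mulr_ge0.
rewrite !nintZ//.
apply: (@le_trans _ _ (2%:E * (4 * (216 * pi) ^+ 2 * V ^+ 2 * l * h ^+ 2)%:E +
    2%:E * ((4 * pi) ^+ 2 * B * V ^+ 2 * l * h ^+ 2)%:E)%E).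
  by apply: leeD; rewrite lee_pmul2l.
rewrite -!EFinM -EFinD lee_fin /hm_const le_eqVlt; apply/orP; left; apply/eqP; ring.
Qed.

End FiniteDifference.

(** * L^1 bounds for bad pieces on dyadic annuli *)

Section Annuli.
Context {R : realType}.
Local Notation mu := (@lebesgue_measure R).

Definition far (c l x : R) : R := (l <= `|x - c|)%R%:R.

Lemma far_ge0 c l x : 0 <= far c l x.
Proof. exact: ler0n. Qed.

Lemma far_le1 c l x : far c l x <= 1.
Proof. by rewrite /far lern1 leq_b1. Qed.

Lemma measurable_far c l : measurable_fun setT (far c l).
Proof.
rewrite (_ : far c l = \1_((fun x : R => `|x - c|) @^-1` `[l, +oo[%classic)).
  apply: measurable_indic; rewrite -[X in measurable X]setTI.
  have mg : measurable_fun setT (fun x : R => `|x - c|).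
    by apply: (@measurableT_comp _ _ _ _ _ _ (@Num.norm R R)) => //; meas.
  exact: mg.
apply/funext => x; rewrite /far indicE; congr (nat_of_bool _)%:R.
apply/idP/idP => [h|/set_mem /=]; last by rewrite in_itv/= andbT.
by apply/mem_set; rewrite /= in_itv/= andbT.
Qed.

Lemma sum_geometric_le (q : R) (n : nat) : 0 <= q -> q < 1 ->
  \sum_(k < n) q ^+ k <= (1 - q)^-1.
Proof.
move=> q0 q1; have d0 : 0 < 1 - q by rewrite subr_gt0.
have E : (1 - q) * \sum_(k < n) q ^+ k = 1 - q ^+ n.
  by rewrite -opprB mulNr -subrX1 opprB.
rewrite -(ler_pM2l d0) E mulfV ?gt_eqF// gerBl; exact: exprn_ge0.
Qed.

(** AM-GM with a free parameter: on a set of finite measure it passes from L^2 to L^1 as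
    Cauchy-Schwarz does, once [L] is chosen. *)
Lemma sqrt_le_mean (a L : R) : 0 < L -> 0 <= a ->
  Num.sqrt a <= 2^-1 * (L + L^-1 * a).
Proof.
move=> L0 a0; set r := Num.sqrt a.
have E : a = r ^+ 2 by rewrite sqr_sqrtr.
have h := sqr_ge0 (r - L).
rewrite -(ler_pM2l (_ : 0 < 2 * L)) ?mulr_gt0// E.
have -> : 2 * L * (2^-1 * (L + L^-1 * r ^+ 2)) = L ^+ 2 + r ^+ 2.
  by field; rewrite gt_eqF.
lra.
Qed.

(** Reaches the case G = 0: the parameter [L] used on the annuli is proportional to the bound and
    has to be positive. *)
Lemma nint_le_cst_gt (G C : R) (t : \bar R) : 0 <= G -> 0 <= C ->
  (forall G', G < G' -> (t <= (C * G')%:E)%E) -> (t <= (C * G)%:E)%E.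
Proof.
move=> G0 C0 h; apply/lee_addgt0Pr => e e0.
have C1 : 0 < C + 1 by rewrite ltr_wpDl.
apply: (le_trans (h (G + e / (C + 1)) _)).
  by rewrite ltrDl divr_gt0.
rewrite -EFinD lee_fin mulrDr lerD2l mulrA ler_pdivrMr//.
by rewrite mulrC ler_wpM2l ?(ltW e0)// lerDl.
Qed.

Variables (Tt : Type) (s : seq Tt) (J : Tt -> Type) (A : forall tau, seq (J tau)).
Variables (m : forall tau, J tau -> R -> R[i]) (S : forall tau, J tau -> set R).
Variables (xi0 : forall tau, J tau -> R) (N : Tt -> R).
Arguments m {tau}. Arguments S {tau}. Arguments xi0 {tau}.
Hypothesis hm : forall tau (i : J tau), hm_mult (m i) (S i) (xi0 i).
Hypothesis overlap : forall tau x, \sum_(i <- A tau) (\1_(S i) x : R) <= N tau.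

Definition sqfun (b : forall tau, J tau -> R -> R[i]) (x : R) : R :=
  \sum_(tau <- s) cmod (\sum_(i <- A tau) multiplier_op (m i) (b tau i) x) ^+ 2.

Lemma sqfun_ge0 b x : 0 <= sqfun b x.
Proof. by apply: sumr_ge0 => tau _; exact: sqr_ge0. Qed.

Lemma measurable_sqfun (b : forall tau, J tau -> R -> R[i]) :
  (forall tau i, cintegrable (b tau i)) -> measurable_fun setT (sqfun b).
Proof.
move=> bi; apply: measurable_sum => tau; apply: measurable_cmod_sqr.
by apply: cmeasurable_sum => i; exact: (measurable_multiplier_op (hm i)).
Qed.

Let N0 tau : 0 <= N tau.
Proof. by apply: le_trans (overlap tau 0); apply: sumr_ge0 => i _; rewrite indicE. Qed.

Variables (b : forall tau, J tau -> R -> R[i]) (V : forall tau, J tau -> R).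
Variables (c l B G : R).
Arguments b {tau}. Arguments V {tau}.
Hypothesis l0 : 0 < l.
Hypothesis nb : forall tau (i : J tau), nice (b i).
Hypothesis b1 : forall tau (i : J tau) x, 3 * l < `|x - c| -> b i x = 0.
Hypothesis b2 : forall tau (i : J tau), (nint (fun x => cmod (b i x)) <= (V i)%:E)%E.
Hypothesis b3 : forall tau (i : J tau),
  (nint (fun x => (`|x - c| ^+ 2 * cmod (b i x) ^+ 2)%R) <= (B * V i ^+ 2 * l)%:E)%E.
Hypothesis b4 : forall tau (i : J tau), fourier (b i) (xi0 i) = 0.
Hypothesis B0 : 0 <= B.
Hypothesis G0 : 0 <= G.
Hypothesis VG : \sum_(tau <- s) N tau * \sum_(i <- A tau) V i ^+ 2 <= G ^+ 2.

Let mS : measurable_fun setT (sqfun (@b)).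
Proof. by apply: measurable_sqfun => tau i; exact: nice_cintegrable. Qed.

Let annulus k x := far c (2 ^+ k * l) x - far c (2 ^+ k.+1 * l) x.

Let annulus_ge0 k x : 0 <= annulus k x.
Proof.
rewrite subr_ge0 /far ler_nat.
case: (leP (2 ^+ k.+1 * l) `|x - c|) => // h.
suff -> : 2 ^+ k * l <= `|x - c| by [].
apply: le_trans h; rewrite ler_wpM2r ?(ltW l0)// exprS ler_peMl ?exprn_ge0//.
lra.
Qed.

Let measurable_annulus k : measurable_fun setT (annulus k).
Proof. by apply: measurable_funB; exact: measurable_far. Qed.

Lemma nint_sqfun_annulus k :
  (nint (fun x => (annulus k x * sqfun (@b) x)%R) <=
   (hm_const B * G ^+ 2 / (16 * 4 ^+ k * l))%:E)%E.
Proof.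
have K0 : 0 <= hm_const B by exact: hm_const_ge0.
(* With this step the phase 2 pi |x - c| h runs over [pi/2, pi] on the k-th annulus; the cosine is
   nonpositive there and the weight at least 2. *)
pose h : R := (4 * 2 ^+ k * l)^-1.
have p2 : 0 < 2 ^+ k :> R by rewrite exprn_gt0.
have p4 : 0 < 4 * 2 ^+ k * l by rewrite !mulr_gt0.
have h0 : 0 < h by rewrite invr_gt0.
have hl : h <= l^-1.
  rewrite lef_pV2 ?posrE// ler_peMl ?(ltW l0)//.
  have : 1 <= 2 ^+ k :> R by rewrite exprn_ege1//; lra.
  lra.
have F0 tau x : 0 <= cmod (expi (2 * pi * (x - c) * h) - 1) ^+ 2 *
      cmod (\sum_(i <- A tau) multiplier_op (m i) (b i) x) ^+ 2.
  by rewrite mulr_ge0 ?sqr_ge0.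
have mF tau : measurable_fun setT (fun x : R =>
    cmod (expi (2 * pi * (x - c) * h) - 1) ^+ 2 *
      cmod (\sum_(i <- A tau) multiplier_op (m i) (b i) x) ^+ 2).
  apply: measurable_funM; apply: measurable_cmod_sqr; first by cmeas.
  apply: cmeasurable_sum => i; apply: (measurable_multiplier_op (hm i)).
  exact: nice_cintegrable.
apply: (@le_trans _ _ (nint (fun x => 2^-1 * \sum_(tau <- s)
    (cmod (expi (2 * pi * (x - c) * h) - 1) ^+ 2 *
      cmod (\sum_(i <- A tau) multiplier_op (m i) (b i) x) ^+ 2)))).
  apply: le_nint => x; first by rewrite mulr_ge0// sqfun_ge0.
  rewrite -mulr_sumr mulrA -/(sqfun (@b) x) ler_wpM2r ?sqfun_ge0//.
  have q0 : 0 <= 2^-1 * cmod (expi (2 * pi * (x - c) * h) - 1) ^+ 2.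
    by rewrite mulr_ge0 ?sqr_ge0.
  rewrite /annulus /far.
  have [h1|h1] := leP (2 ^+ k * l) `|x - c|; last first.
    by apply: le_trans q0; rewrite mulr0n sub0r oppr_le0 ler0n.
  have [h2|h2] := leP (2 ^+ k.+1 * l) `|x - c|; first by rewrite subrr.
  rewrite mulr0n subr0 cmod_expi_sub1_sqr.
  suff : cos (2 * pi * (x - c) * h) <= 0 by rewrite mulr1n; lra.
  have -> : cos (2 * pi * (x - c) * h) = cos (pi * (2 * `|x - c| * h)).
    by case: (ger0P (x - c)) => _; last rewrite -cosN; congr cos; ring.
  have y1 : 1 / 2 <= 2 * `|x - c| * h.
    by rewrite /h ler_pdivlMr//; lra.
  have y2 : 2 * `|x - c| * h <= 1.
    by rewrite /h ler_pdivrMr//; move: (ltW h2); rewrite exprS; lra.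
  rewrite -[X in cos X](subrK (pi / 2)) cosDpihalf oppr_le0.
  apply: sin_ge0_pi; apply/andP; split.
    by have := ler_wpM2l (pi_ge0 R) y1; lra.
  by have := ler_wpM2l (pi_ge0 R) y2; have := pi_ge0 R; lra.
rewrite nintZ//; last 2 first.
- exact: measurable_sum.
- by move=> x; exact: sumr_ge0.
rewrite nint_sum//.
apply: (@le_trans _ _ ((2^-1)%:E * (\sum_(tau <- s)
    (2 * N tau * \sum_(i <- A tau) hm_const B * V i ^+ 2 * l * h ^+ 2)%:E))%E).
  rewrite lee_wpmul2l ?lee_fin//; apply: lee_sum => tau _.
  apply: le_trans (nint_multiplier_sum_fdiff (hm (tau:=tau)) (overlap tau) c h (nb (tau:=tau))) _.
  rewrite [leRHS]EFinM -sumEFin lee_wpmul2l ?lee_fin ?mulr_ge0//; apply: lee_sum => i _.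
  exact: nint_fdiff_hm (hm i) (nb i) l0 h0 hl (@b1 tau i) (b2 i) (b3 i) (b4 i).
rewrite sumEFin -EFinM lee_fin.
have -> : 2^-1 * \sum_(tau <- s) 2 * N tau *
    \sum_(i <- A tau) hm_const B * V i ^+ 2 * l * h ^+ 2 =
  (hm_const B * l * h ^+ 2) * \sum_(tau <- s) N tau * \sum_(i <- A tau) V i ^+ 2.
  rewrite !mulr_sumr; apply: eq_bigr => tau _; rewrite !mulr_sumr.
  by apply: eq_bigr => i _; field.
have K1 : 0 <= hm_const B * l * h ^+ 2.
  by rewrite mulr_ge0 ?sqr_ge0// mulr_ge0// ltW.
apply: le_trans (ler_wpM2l K1 VG) _.
rewrite le_eqVlt; apply/orP; left; apply/eqP.
have -> : 4 ^+ k = 2 ^+ k ^+ 2 :> R by rewrite -exprM mulnC exprM; congr (_ ^+ k); ring.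
by rewrite /h; field; rewrite !gt_eqF.
Qed.

Lemma nint_sqfun_far :
  (nint (fun x => (far c l x * Num.sqrt (sqfun (@b) x))%R) <=
   ((8 + hm_const B) * G)%:E)%E.
Proof.
have K0 : 0 <= hm_const B by exact: hm_const_ge0.
have r0 x : 0 <= Num.sqrt (sqfun (@b) x) by exact: sqrtr_ge0.
have mr : measurable_fun setT (fun x : R => Num.sqrt (sqfun (@b) x)).
  exact: measurable_sqrt.
apply: nint_le_cst_gt => // [|G' GG']; first by rewrite addr_ge0.
have Gp : 0 < G' by exact: le_lt_trans GG'.
have step k : (nint (fun x => (annulus k x * Num.sqrt (sqfun (@b) x))%R) <=
    (2 * G' * (3 / 4) ^+ k + hm_const B / 32 * G' * (2 / 3) ^+ k)%:E)%E.
  (* (3/8)^k is a rational stand-in for the optimal 2^(-3k/2). The two terms of AM-GM, of orders L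
     2^k l and G'^2 / (L 4^k l), become multiples of G' (3/4)^k and G' (2/3)^k, both summable. *)
  pose L := G' / l * (3 / 8) ^+ k.
  have L0 : 0 < L by rewrite mulr_gt0 ?divr_gt0 ?exprn_gt0//; lra.
  apply: (@le_trans _ _ (nint (fun x => 2^-1 * L * annulus k x +
      2^-1 * L^-1 * (annulus k x * sqfun (@b) x)))).
    apply: le_nint => x; first by rewrite mulr_ge0.
    have := ler_wpM2l (annulus_ge0 k x) (sqrt_le_mean L0 (sqfun_ge0 (@b) x)).
    by move/le_trans; apply; rewrite le_eqVlt; apply/orP; left; apply/eqP; ring.
  have Li : 0 <= L^-1 by rewrite invr_ge0 ltW.
  have as0 x : 0 <= annulus k x * sqfun (@b) x by rewrite mulr_ge0// sqfun_ge0.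
  have mas : measurable_fun setT (fun x : R => annulus k x * sqfun (@b) x).
    exact: measurable_funM.
  rewrite nintD; last 4 first.
  - by apply: measurable_funM => //; exact: measurable_cst.
  - by apply: measurable_funM => //; exact: measurable_cst.
  - by move=> x; rewrite mulr_ge0// mulr_ge0// ltW.
  - by move=> x; rewrite mulr_ge0// mulr_ge0.
  rewrite !nintZ//; [|by rewrite mulr_ge0|by rewrite mulr_ge0// ltW].
  have a1 : (nint (annulus k) <= (4 * 2 ^+ k * l)%:E)%E.
    have p2 : 0 < 2 ^+ k :> R by rewrite exprn_gt0.
    apply: (@le_trans _ _ (nint (fun x => cutoff (2 * 2 ^+ k * l) (x - c)))).
      apply: le_nint => x //; rewrite /annulus cutoffE exprS.
      have f1 := far_le1 c (2 ^+ k * l) x.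
      have [h|h] := leP `|x - c| (2 * 2 ^+ k * l).
        by have := far_ge0 c (2 * 2 ^+ k * l) x; rewrite mulr1n; lra.
      by rewrite [X in _ - X]/far (ltW h) mulr0n subr_le0.
    rewrite (@nint_translate _ (cutoff _) (- c)); last 2 first.
    - exact: measurable_cutoff.
    - by move=> x; exact: cutoff_ge0.
    rewrite nint_cutoff ?mulr_ge0 ?(ltW l0) ?(ltW p2)// lee_fin; lra.
  apply: (@le_trans _ _ ((2^-1 * L)%:E * (4 * 2 ^+ k * l)%:E +
     (2^-1 * L^-1)%:E * (hm_const B * G ^+ 2 / (16 * 4 ^+ k * l))%:E)%E).
    apply: leeD; first by rewrite lee_wpmul2l// lee_fin mulr_ge0// ltW.
    apply: lee_wpmul2l; first by rewrite lee_fin mulr_ge0.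
    exact: nint_sqfun_annulus.
  rewrite -!EFinM -EFinD lee_fin; apply: lerD.
    have -> : (3 / 4) ^+ k = (3 / 8) ^+ k * 2 ^+ k :> R.
      by rewrite -exprMn; congr (_ ^+ k); field.
    rewrite /L le_eqVlt; apply/orP; left; apply/eqP.
    move: ((3 / 8 : R) ^+ k) (2 ^+ k : R) => a1' b1'.
    by field; rewrite gt_eqF.
  apply: (@le_trans _ _ (2^-1 * L^-1 * (hm_const B * G' ^+ 2 / (16 * 4 ^+ k * l)))).
    rewrite !ler_wpM2l ?mulr_ge0//; rewrite ler_wpM2r//.
      by rewrite invr_ge0 !mulr_ge0 ?exprn_ge0 ?(ltW l0).
    by rewrite ler_wpM2l// ler_pXn2r ?nnegrE ?(ltW Gp) ?(ltW GG').
  have e1 : 4 ^+ k != 0 :> R by rewrite expf_neq0.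
  have e2 : (3 / 8) ^+ k != 0 :> R by rewrite expf_neq0// mulf_neq0// invr_eq0.
  have -> : (2 / 3) ^+ k = ((3 / 8) ^+ k * 4 ^+ k)^-1 :> R.
    by rewrite -exprMn -exprVn; congr (_ ^+ k); field.
  rewrite /L le_eqVlt; apply/orP; left; apply/eqP.
  move: ((3 / 8 : R) ^+ k) (4 ^+ k : R) e1 e2 => a1' b1' e1 e2.
  by field; rewrite e1 e2 !gt_eqF.
apply: nint_le_of_cutoff.
- by apply: measurable_funM => //; exact: measurable_far.
- by move=> x; rewrite mulr_ge0// far_ge0.
move=> n.
(* Enough annuli to cover [-n, n]: they telescope, and [far] at radius 2^k0 l vanishes on that
   interval. *)
have [k0 hk0] : exists k0 : nat, n%:R + `|c| < 2 ^+ k0 * l.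
  exists (Num.truncn ((n%:R + `|c|) / l)).+1.
  rewrite -ltr_pdivrMr//; apply: lt_trans (truncnS_gt _) _.
  by rewrite -natrX ltr_nat ltn_expl.
apply: (@le_trans _ _ (nint (fun x => \sum_(k < k0) annulus k x * Num.sqrt (sqfun (@b) x)))).
  apply: le_nint => x; first by rewrite !mulr_ge0 ?far_ge0 ?cutoff_ge0.
  rewrite -mulr_suml mulrAC ler_wpM2r//.
  rewrite -(big_mkord xpredT (fun k => annulus k x)) /annulus.
  rewrite (@telescope_sumr_eq _ 0 k0 (fun k => - far c (2 ^+ k * l) x))//; last first.
    by move=> k _; rewrite opprK addrC.
  rewrite expr0 mul1r opprK addrC cutoffE.
  have [xn|xn] := leP `|x| n%:R; rewrite /= ?mulr1 ?mulr0; last first.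
    rewrite subr_ge0 /far ler_nat.
    case: (leP (2 ^+ k0 * l) `|x - c|) => // h.
    suff -> : l <= `|x - c| by [].
    apply: le_trans h; rewrite ler_peMl ?(ltW l0)// exprn_ege1//; lra.
  rewrite [X in _ - X](_ : _ = 0) ?subr0// /far.
  case: (leP (2 ^+ k0 * l) `|x - c|) => // h; exfalso.
  by have := ler_normB x c; lra.
rewrite nint_sum; last 2 first.
- by move=> k; exact: measurable_funM.
- by move=> k x; rewrite mulr_ge0.
apply: (@le_trans _ _ (\sum_(k < k0)
  (2 * G' * (3 / 4) ^+ k + hm_const B / 32 * G' * (2 / 3) ^+ k)%:E)%E).
  by apply: lee_sum => k _; exact: step.
rewrite sumEFin lee_fin big_split /= -!mulr_sumr.
have s1 : \sum_(k < k0) (3 / 4) ^+ k <= 4 :> R.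
  have e : (1 - 3 / 4)^-1 = 4 :> R by field.
  rewrite -[leRHS]e.
  by apply: sum_geometric_le; lra.
have s2 : \sum_(k < k0) (2 / 3) ^+ k <= 3 :> R.
  have e : (1 - 2 / 3)^-1 = 3 :> R by field.
  rewrite -[leRHS]e.
  by apply: sum_geometric_le; lra.
have G2 : 0 <= 2 * G' by rewrite mulr_ge0// ltW.
have KG : 0 <= hm_const B * G' by rewrite mulr_ge0// ltW.
have KG' : 0 <= hm_const B / 32 * G' by lra.
have := ler_wpM2l G2 s1; have := ler_wpM2l KG' s2; lra.
Qed.

End Annuli.

(** * Calderon-Zygmund decomposition *)

Section WeightedNorm.
Context {R : realType}.
Variables (K : Type) (s : seq K) (w : K -> R).
Hypothesis w0 : forall k, 0 <= w k.
Implicit Types f g : K -> R.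

(** One norm serves three times: with weights N_tau for the scalar function that is decomposed, with
    weights 1 for the square function, and with values of bumps as weights in a Cauchy-Schwarz over
    blocks. *)
Definition wl2 f : R := Num.sqrt (\sum_(k <- s) w k * f k ^+ 2).

Lemma wl2_ge0 f : 0 <= wl2 f.
Proof. exact: sqrtr_ge0. Qed.

Lemma wl2_sqr f : wl2 f ^+ 2 = \sum_(k <- s) w k * f k ^+ 2.
Proof. by rewrite sqr_sqrtr//; apply: sumr_ge0 => k _; rewrite mulr_ge0 ?sqr_ge0. Qed.

Lemma ler_wl2 f g : (forall k, `|f k| <= `|g k|) -> wl2 f <= wl2 g.
Proof.
move=> fg; apply: ler_wsqrtr; apply: ler_sum => k _; rewrite ler_wpM2l//.
by rewrite -(real_normK (num_real (f k))) -(real_normK (num_real (g k)))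
  ler_pXn2r ?nnegrE.
Qed.

Lemma wl2_cauchy_schwarz f g : \sum_(k <- s) w k * (f k * g k) <= wl2 f * wl2 g.
Proof.
set a := wl2 f; set b := wl2 g; set d := \sum_(k <- s) _.
have a0 : 0 <= a by exact: wl2_ge0.
have b0 : 0 <= b by exact: wl2_ge0.
(* The weighted square of x f - y g. The choice (x, y) = (b, a) gives the claim when a b > 0; if a
   or b vanishes, a large coefficient rules out d > 0. *)
have key x y : 0 <= x ^+ 2 * a ^+ 2 - 2 * (x * y) * d + y ^+ 2 * b ^+ 2.
  rewrite !wl2_sqr /d !mulr_sumr -sumrB -big_split /=; apply: sumr_ge0 => k _.
  have := mulr_ge0 (w0 k) (sqr_ge0 (x * f k - y * g k)).
  by move/le_trans; apply; rewrite le_eqVlt; apply/orP; left; apply/eqP; ring.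
have [ab|ab] := ltP 0 (a * b).
  rewrite -(ler_pM2l ab); have := key b a; lra.
have ab0 : a * b = 0 by apply/eqP; rewrite eq_le ab mulr_ge0.
rewrite ab0 leNgt; apply/negP => d0.
have /eqP := ab0; rewrite mulf_eq0 => /orP[/eqP az|/eqP bz].
  have := key ((b ^+ 2 + 1) / d) 1; rewrite az expr0n /= mulr0 expr1n mul1r mulr1.
  by rewrite sub0r -mulrA divfK ?gt_eqF//; have := sqr_ge0 b; lra.
have := key 1 ((a ^+ 2 + 1) / d); rewrite bz expr0n /= mulr0 expr1n !mul1r.
by rewrite -mulrA divfK ?gt_eqF// addr0; have := sqr_ge0 a; lra.
Qed.

Lemma wl2D f g : wl2 (fun k => f k + g k) <= wl2 f + wl2 g.
Proof.
rewrite -(@ler_pXn2r _ 2)// ?nnegrE ?addr_ge0 ?wl2_ge0//.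
rewrite sqrrD !wl2_sqr.
apply: (@le_trans _ _ (\sum_(k <- s) w k * f k ^+ 2 +
    (\sum_(k <- s) w k * (f k * g k)) *+ 2 + \sum_(k <- s) w k * g k ^+ 2)).
  rewrite -sumrMnl -!big_split /= le_eqVlt; apply/orP; left; apply/eqP.
  by apply: eq_bigr => k _; ring.
by rewrite lerD2r lerD2l lerMn2r wl2_cauchy_schwarz orbT.
Qed.

Lemma wl2_sum (P : Type) (r : seq P) (f : P -> K -> R) :
  wl2 (fun k => \sum_(p <- r) f p k) <= \sum_(p <- r) wl2 (f p).
Proof.
elim: r => [|p r ih].
  rewrite big_nil /wl2; under eq_bigr do rewrite big_nil expr0n /= mulr0.
  by rewrite big1 ?sqrtr0.
rewrite big_cons; apply: le_trans (lerD (lexx _) ih).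
by apply: le_trans (wl2D _ _); apply: ler_wl2 => k; rewrite big_cons.
Qed.

Lemma wl2Z (c : R) f : 0 <= c -> wl2 (fun k => c * f k) = c * wl2 f.
Proof.
move=> c0; rewrite /wl2; under eq_bigr do rewrite exprMn mulrCA.
by rewrite -mulr_sumr sqrtrM ?sqr_ge0// sqrtr_sqr ger0_norm.
Qed.

End WeightedNorm.

Section Blocks.
Context {R : realType}.
Local Notation mu := (@lebesgue_measure R).

(* Bisect until the average exceeds [lam] or a single cell is reached. *)
Lemma cz_blocks (g : nat -> R) (lam : R) (k a : nat) : (forall p, 0 <= g p) ->
  \sum_(p <- iota a (2 ^ k)) g p <= 2 * lam * (2 ^ k)%:R ->
  exists bs : seq (nat * nat), [/\
    flatten [seq iota b.1 b.2 | b <- bs] = iota a (2 ^ k),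
    forall b, b \in bs -> (0 < b.2)%N,
    forall b, b \in bs -> \sum_(p <- iota b.1 b.2) g p <= 2 * lam * b.2%:R &
    forall b, b \in bs -> b.2 != 1 -> lam * b.2%:R < \sum_(p <- iota b.1 b.2) g p].
Proof.
move=> g0; elim: k a => [|k ih] a ga.
  rewrite expn0 in ga *; exists [:: (a, 1%N)].
  by split => [|b|b|b]; rewrite ?inE; try by move=> /eqP ->.
have [h|h] := ltP (lam * (2 ^ k.+1)%:R) (\sum_(p <- iota a (2 ^ k.+1)) g p).
  exists [:: (a, 2 ^ k.+1)]%N; split => [|b|b|b]; rewrite ?inE /= ?cats0//.
  - by move=> /eqP ->; rewrite /= expn_gt0.
  - by move=> /eqP ->.
  - by move=> /eqP ->.
have E : iota a (2 ^ k.+1) = iota a (2 ^ k) ++ iota (a + 2 ^ k) (2 ^ k).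
  by rewrite expnS mul2n -addnn iotaD.
rewrite E big_cat /= expnS natrM in h.
have s1 : 0 <= \sum_(p <- iota a (2 ^ k)) g p by exact: sumr_ge0.
have s2 : 0 <= \sum_(p <- iota (a + 2 ^ k) (2 ^ k)) g p by exact: sumr_ge0.
(* Here the average over the union is at most [lam], so over each half it is at most 2 lam: this is
   the invariant carried down the bisection. *)
have [|bs1 [p1 p2 p3 p4]] := ih a; first by lra.
have [|bs2 [q1 q2 q3 q4]] := ih (a + 2 ^ k)%N; first by lra.
exists (bs1 ++ bs2); split => [|b|b|b]; rewrite ?mem_cat.
- by rewrite map_cat flatten_cat p1 q1 E.
- by move=> /orP[/p2|/q2].
- by move=> /orP[/p3|/q3].
- by move=> /orP[/p4|/q4].
Qed.

Lemma sum_blocks (bs : seq (nat * nat)) (n : nat) (F : nat -> R) :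
  flatten [seq iota b.1 b.2 | b <- bs] = iota 0 n ->
  \sum_(b <- bs) \sum_(p <- iota b.1 b.2) F p = \sum_(p <- iota 0 n) F p.
Proof.
move=> <-; elim: bs => [|b bs ih]; first by rewrite !big_nil.
by rewrite big_cons /= big_cat /= ih.
Qed.

(** As d <= t, the bump varies by at most a factor 3 on a cell; comparison with its integral, at
    most 4, gives 12. *)
Lemma riemann_bump (t d y : R) (n : nat) : 0 < d -> d <= t ->
  \sum_(p <- iota 0 n) d * bump t (y - d * p%:R) <= 12.
Proof.
move=> d0 dt; have t0 : 0 < t by exact: lt_le_trans dt.
pose I (p : nat) : R -> R := \1_(`[d * p%:R, d * p.+1%:R[%classic).
have mI p : measurable_fun setT (I p) by exact: measurable_indic.
have I0 p x : 0 <= I p x by rewrite /I indicE.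
have II x : \sum_(p <- iota 0 n) I p x <= 1.
  suff h : forall n, \sum_(p <- iota 0 n) I p x <= (x < d * n%:R)%R%:R.
    by apply: le_trans (h n) _; rewrite lern1 leq_b1.
  elim=> [|k ih]; first by rewrite big_nil ler0n.
  rewrite -addn1 iotaD big_cat big_seq1 /= add0n addn1.
  have [xk|xk] := ltP x (d * k%:R).
    rewrite [I k x](_ : _ = 0) ?addr0; last first.
      rewrite /I indicE memNset// /= in_itv/= => /andP[]; lra.
    apply: le_trans ih _; rewrite ler_nat xk.
    suff -> : x < d * k.+1%:R by [].
    by apply: lt_trans xk _; rewrite ltr_pM2l// ltr_nat.
  rewrite ltNge xk /= in ih.
  rewrite -[leRHS]add0r; apply: lerD; first exact: ih.
  rewrite /I indicE ler_nat; case: (boolP (_ \in _)) => // /set_mem /=.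
  by rewrite in_itv/= => /andP[_ ->].
have mb : measurable_fun setT (fun z : R => bump t (y - z)).
  by apply: (@measurableT_comp _ _ _ _ _ _ (bump t)); [exact: measurable_bump|meas].
have step p : ((d * bump t (y - d * p%:R))%:E <=
    nint (fun z => (3 * bump t (y - z) * I p z)%R))%E.
  have -> : (d * bump t (y - d * p%:R))%:E = nint (fun z => (bump t (y - d * p%:R) * I p z)%R).
    rewrite nintZ ?bump_ge0// nint_indic// lebesgue_measure_itv/= lte_fin.
    rewrite ltr_pM2l// ltr_nat ltnSn -EFinB -EFinM; congr EFin.
    by rewrite -natr1; ring.
  apply: le_nint => z; first by rewrite mulr_ge0 ?bump_ge0.
  rewrite /I indicE; case: (boolP (_ \in _)) => [/set_mem/=|_]; last by rewrite !mulr0.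
  rewrite in_itv/= -natr1 => /andP[z1 z2]; rewrite !mulr1.
  have := @bump_shift _ t (y - z) (d * p%:R - z) t0.
  rewrite opprB addrA subrK => E.
  have yz : `|d * p%:R - z| <= t by rewrite ler_norml; apply/andP; split; lra.
  have := @bump_shift _ t (y - z) (d * p%:R - z) t0 yz.
  by rewrite (_ : y - z - (d * p%:R - z) = y - d * p%:R)//; ring.
rewrite -lee_fin -sumEFin.
apply: (@le_trans _ _ (\sum_(p <- iota 0 n) nint (fun z => (3 * bump t (y - z) * I p z)%R))%E).
  by apply: lee_sum => p _; exact: step.
have m3 : measurable_fun setT (fun z : R => 3 * bump t (y - z)).
  by apply: measurable_funM => //; exact: measurable_cst.
rewrite -nint_sum; last 2 first.
- by move=> p; exact: measurable_funM.
- by move=> p z; rewrite mulr_ge0// mulr_ge0// bump_ge0.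
apply: (@le_trans _ _ (nint (fun z => 3 * bump t (z - y)))).
  apply: le_nint => z; first by apply: sumr_ge0 => p _; rewrite mulr_ge0// mulr_ge0// bump_ge0.
  rewrite -mulr_sumr -[in leRHS]bumpN opprB ler_piMr// mulr_ge0// bump_ge0//.
rewrite nintZ//; last 2 first.
- by apply: (@measurableT_comp _ _ _ _ _ _ (bump t)); [exact: measurable_bump|meas].
- by move=> z; exact: bump_ge0.
rewrite (@nint_translate _ (bump t) (- y)); last 2 first.
- exact: measurable_bump.
- by move=> z; exact: bump_ge0.
apply: (@le_trans _ _ (3%:E * 4%:E)%E); first by rewrite lee_pmul2l// nint_bump.
by rewrite -EFinM lee_fin; lra.
Qed.

Variables (bs : seq (nat * nat)) (n : nat) (x0 d : R).
Hypothesis d0 : 0 < d.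
Hypothesis bsn : flatten [seq iota b.1 b.2 | b <- bs] = iota 0 n.

Definition cell (p : nat) : R := x0 + d * p%:R.

Definition blen (b : nat * nat) : R := d * b.2%:R.

Lemma cell_dist b p : p \in iota b.1 b.2 -> `|cell p - cell b.1| <= blen b.
Proof.
rewrite mem_iota => /andP[p1 p2]; rewrite /cell /blen.
have -> : x0 + d * p%:R - (x0 + d * b.1%:R) = d * (p - b.1)%:R.
  by rewrite natrB//; ring.
rewrite ger0_norm ?mulr_ge0 ?(ltW d0)// ler_pM2l// ler_nat.
by rewrite leq_subLR ltnW.
Qed.

(** A block of length at most t is resolved into its cells at the cost of another factor 3, which
    reduces the sum to [riemann_bump]. *)
Lemma sum_small_blocks (t y : R) : d <= t ->
  \sum_(b <- bs) (if blen b <= t then blen b * bump t (y - cell b.1) else 0) <= 36.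
Proof.
move=> dt; have t0 : 0 < t by exact: lt_le_trans dt.
apply: (@le_trans _ _ (3 * \sum_(b <- bs) \sum_(p <- iota b.1 b.2) d * bump t (y - cell p))).
  rewrite mulr_sumr; apply: ler_sum => b _.
  case: (leP (blen b) t) => bt; last first.
    by apply: mulr_ge0 => //; apply: sumr_ge0 => p _; rewrite mulr_ge0 ?bump_ge0 ?(ltW d0).
  have -> : blen b * bump t (y - cell b.1) = \sum_(p <- iota b.1 b.2) d * bump t (y - cell b.1).
    by rewrite big_const_seq count_predT size_iota iter_addr_0 /blen -mulr_natr; ring.
  rewrite mulr_sumr big_seq [leRHS]big_seq; apply: ler_sum => p pb.
  rewrite mulrCA ler_pM2l//.
  have h : `|cell b.1 - cell p| <= t by rewrite distrC; apply: le_trans (cell_dist pb) bt.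
  have := @bump_shift _ t (y - cell p) (cell b.1 - cell p) t0 h.
  by rewrite (_ : y - cell p - (cell b.1 - cell p) = y - cell b.1)//; ring.
rewrite (sum_blocks _ bsn).
have := riemann_bump (y - x0) n d0 dt.
under [X in _ -> 3 * X <= _]eq_bigr do rewrite /cell opprD addrA.
lra.
Qed.

(* The larger of the two blocks dictates the decay of the inner product. *)
Lemma nint_sum_blocks_sqr (G : nat * nat -> R) (al : R) : 0 <= al ->
  (forall b, 0 <= G b) -> (forall b, b \in bs -> (0 < b.2)%N) ->
  (forall b, b \in bs -> G b <= 2 * al * blen b) ->
  (nint (fun x => ((\sum_(b <- bs) G b * bump (blen b) (x - cell b.1)) ^+ 2)%R) <=
   (10368 * al * \sum_(b <- bs) G b)%:E)%E.
Proof.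
move=> al0 G0 b0 Gb.
have l0 b : b \in bs -> 0 < blen b by move=> /b0 bp; rewrite mulr_gt0// ltr0n.
pose beta b x := bump (blen b) (x - cell b.1).
have be0 b x : 0 <= beta b x by exact: bump_ge0.
have mbe b : b \in bs -> measurable_fun setT (beta b).
  move=> bb; apply: (@measurableT_comp _ _ _ _ _ _ (bump (blen b))); last by meas.
  by apply: measurable_bump; exact: l0.
have nbe b : b \in bs -> (nint (beta b) <= 4%:E)%E.
  move=> bb; rewrite (@nint_translate _ (bump _) (- cell b.1)).
  - exact: nint_bump (l0 _ bb).
  - exact: measurable_bump (l0 _ bb).
  - by move=> x; exact: bump_ge0.
pose T b b' x := if blen b' <= blen b then
  9 * G b * G b' * bump (blen b) (cell b.1 - cell b'.1) * (beta b x + beta b' x) else 0.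
have T0 b b' x : 0 <= T b b' x.
  by rewrite /T; case: ifP => // _; rewrite !mulr_ge0 ?bump_ge0// addr_ge0.
have pw x : (\sum_(b <- bs) G b * beta b x) ^+ 2 <=
    2 * \sum_(b <- bs) \sum_(b' <- bs) T b b' x.
  pose q b b' := G b * beta b x * (G b' * beta b' x).
  have q0 b b' : 0 <= q b b' by rewrite !mulr_ge0.
  have -> : (\sum_(b <- bs) G b * beta b x) ^+ 2 =
      \sum_(b <- bs) \sum_(b' <- bs) q b b'.
    by rewrite expr2 mulr_suml; apply: eq_bigr => b _; rewrite mulr_sumr.
  (* Each ordered pair is charged to an order in which the first block is at least as long as the
     second; by symmetry this costs a factor 2. *)
  apply: (@le_trans _ _ (\sum_(b <- bs) \sum_(b' <- bs)
    ((if blen b' <= blen b then q b b' else 0) +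
     (if blen b <= blen b' then q b' b else 0)))).
    apply: ler_sum => b _; apply: ler_sum => b' _.
    case: (leP (blen b') (blen b)) => h; first by rewrite lerDl; case: ifP.
    by rewrite (ltW h) add0r /q mulrC.
  under eq_bigr do rewrite big_split /=.
  rewrite big_split /= [X in _ + X]exchange_big /= -mulr2n -[leLHS]mulr_natl.
  rewrite ler_wpM2l// big_seq [leRHS]big_seq; apply: ler_sum => b bb.
  rewrite big_seq [leRHS]big_seq; apply: ler_sum => b' bb'; rewrite /T.
  case: ifP => // h; rewrite /q.
  have := bump_mul_le x (cell b.1) (cell b'.1) (l0 _ bb') h.
  have GG : 0 <= G b * G b' by rewrite mulr_ge0.
  move=> /(ler_wpM2l GG) k.
  apply: (le_trans _ (le_trans k _)); rewrite le_eqVlt; apply/orP; left; apply/eqP;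
    rewrite /beta; ring.
apply: (@le_trans _ _ (nint (fun x => 2 * \sum_(b <- bs) \sum_(b' <- bs) T b b' x))).
  by apply: le_nint => x; [exact: sqr_ge0|exact: pw].
(* pass to sums of integrals, inserting the membership test so that all
   summands are measurable *)
pose T' b b' x := if (b \in bs) && (b' \in bs) then T b b' x else 0.
have T'0 b b' x : 0 <= T' b b' x by rewrite /T'; case: ifP.
have mT' b b' : measurable_fun setT (T' b b').
  rewrite /T'; case: (boolP ((b \in bs) && (b' \in bs))) => [/andP[bb bb']|_];
    last exact: measurable_cst.
  rewrite /T; case: (blen b' <= blen b); last exact: measurable_cst.
  apply: measurable_funM; first exact: measurable_cst.
  by apply: measurable_funD; exact: mbe.
have TT' x : \sum_(b <- bs) \sum_(b' <- bs) T b b' x = \sum_(b <- bs) \sum_(b' <- bs) T' b b' x.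
  rewrite big_seq [RHS]big_seq; apply: eq_bigr => b bb.
  by rewrite big_seq [RHS]big_seq; apply: eq_bigr => b' bb'; rewrite /T' bb bb'.
under eq_fun do rewrite TT'.
have nT' b b' : b \in bs -> b' \in bs -> (nint (T' b b') <= (if blen b' <= blen b then
    72 * G b * G b' * bump (blen b) (cell b.1 - cell b'.1) else 0)%:E)%E.
  move=> bb bb'; rewrite /T' bb bb' /= /T.
  case: (blen b' <= blen b); last by rewrite nint0.
  rewrite nintZ; last 3 first.
  - by apply: measurable_funD; exact: mbe.
  - by move=> x; rewrite addr_ge0.
  - by rewrite !mulr_ge0 ?bump_ge0.
  rewrite nintD//; try exact: mbe.
  apply: (@le_trans _ _ ((9 * G b * G b' * bump (blen b) (cell b.1 - cell b'.1))%:E *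
      (4%:E + 4%:E))%E).
    rewrite lee_wpmul2l ?lee_fin ?mulr_ge0 ?bump_ge0//.
    by apply: leeD; exact: nbe.
  by rewrite -EFinD -EFinM lee_fin; lra.
rewrite nintZ//; last 2 first.
- by apply: measurable_sum => b; exact: measurable_sum.
- by move=> x; apply: sumr_ge0 => b _; exact: sumr_ge0.
rewrite nint_sum; last 2 first.
- by move=> b; exact: measurable_sum.
- by move=> b x; exact: sumr_ge0.
(* 5184 is the product of 9 from [bump_mul_le], 8 from two bump integrals, 2 from the upper bound on
   [G b'], and 36 from the sum over the shorter blocks. *)
apply: (@le_trans _ _ (2%:E * (\sum_(b <- bs) (5184 * al * G b)%:E))%E); last first.
  by rewrite sumEFin -EFinM lee_fin -mulr_sumr; lra.
rewrite lee_wpmul2l// big_seq [leRHS]big_seq; apply: lee_sum => b bb.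
rewrite nint_sum//.
apply: (@le_trans _ _ (\sum_(b' <- bs) (144 * al * G b *
    (if blen b' <= blen b then blen b' * bump (blen b) (cell b.1 - cell b'.1) else 0))%:E)%E).
  rewrite big_seq [leRHS]big_seq; apply: lee_sum => b' bb'.
  apply: le_trans (nT' _ _ bb bb') _; rewrite lee_fin; case: ifP => _; last by rewrite mulr0.
  have GB : 0 <= 72 * G b * bump (blen b) (cell b.1 - cell b'.1) by rewrite !mulr_ge0 ?bump_ge0.
  by have := ler_wpM2l GB (Gb _ bb'); lra.
rewrite sumEFin lee_fin -mulr_sumr.
have db : d <= blen b by rewrite /blen ler_peMr ?(ltW d0)// ler1n b0.
have aG : 0 <= 144 * al * G b by rewrite !mulr_ge0.
by have := ler_wpM2l aG (sum_small_blocks (cell b.1) db); lra.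
Qed.

End Blocks.

(** * Localization and cancellation of one bad piece *)

Section BadPieces.
Context {R : realType}.
Local Notation mu := (@lebesgue_measure R).
Variables (f : R -> R[i]) (t vp c cb l xi0 : R).
Hypothesis nf : nice f.
Hypothesis t0 : 0 < t.
Hypothesis tl : t < l.
Hypothesis vp0 : 0 <= vp.
Hypothesis fq : forall x, cmod (f x) <= vp * bump t (x - c).
Hypothesis ccb : `|c - cb| <= l.

Let l0 : 0 < l. Proof. exact: lt_trans tl. Qed.

(** The window is centred at the start of the block, not at the cell, so that what is left outside
    is dominated by one bump common to all cells of the block. By [ccb] it stays within 3 l of the
    cell. *)
Definition loc x : R := cutoff (2 * l) (x - cb).

Lemma measurable_loc : measurable_fun setT loc.
Proof.
apply: (@measurableT_comp _ _ _ _ _ _ (cutoff (2 * l))); last by meas.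
exact: measurable_cutoff.
Qed.

Lemma loc_ge0 x : 0 <= loc x. Proof. exact: cutoff_ge0. Qed.
Lemma loc_le1 x : loc x <= 1. Proof. exact: cutoff_le1. Qed.

Lemma loc01 x : loc x = 1 /\ `|x - cb| <= 2 * l \/ loc x = 0 /\ 2 * l < `|x - cb|.
Proof.
rewrite /loc cutoffE; case: (leP `|x - cb| (2 * l)) => h; [left|right] => //.
Qed.

Lemma nint_loc : nint loc = (4 * l)%:E.
Proof.
rewrite (@nint_translate _ (cutoff (2 * l)) (- cb)).
- by rewrite nint_cutoff ?mulr_ge0 ?(ltW l0)//; congr EFin; ring.
- exact: measurable_cutoff.
- by move=> x; exact: cutoff_ge0.
Qed.

Definition piece x : R[i] := f x * real_complex R (loc x).

Lemma nice_piece : nice piece.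
Proof.
rewrite /piece; under eq_fun do rewrite mulrC; apply: (@niceM _ _ _ 1) => //.
  by apply: cmeasurable_real; exact: measurable_loc.
by move=> x; rewrite cmod_real ger0_norm ?loc_ge0 ?loc_le1.
Qed.

Lemma cmod_piece x : cmod (piece x) <= vp * bump t (x - c) * loc x.
Proof.
by rewrite cmodM cmod_real ger0_norm ?loc_ge0// ler_wpM2r ?loc_ge0.
Qed.

Lemma nint_piece : (nint (fun x => cmod (piece x)) <= (4 * vp)%:E)%E.
Proof.
apply: (@le_trans _ _ (nint (fun x => vp * bump t (x - c)))).
  apply: le_nint => x; first exact: cmod_ge0.
  by apply: le_trans (cmod_piece x) _; rewrite ler_piMr ?loc_le1 ?mulr_ge0 ?bump_ge0.
rewrite nintZ//; last 2 first.
- by apply: (@measurableT_comp _ _ _ _ _ _ (bump t)); [exact: measurable_bump|meas].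
- by move=> x; exact: bump_ge0.
rewrite (@nint_translate _ (bump t) (- c)); last 2 first.
- exact: measurable_bump.
- by move=> x; exact: bump_ge0.
apply: (@le_trans _ _ (vp%:E * 4%:E)%E).
  by rewrite lee_wpmul2l ?lee_fin ?nint_bump.
by rewrite -EFinM lee_fin mulrC.
Qed.

(** Normalized to have Fourier coefficient 1 at [xi0]. Its height 1 / (4 l) makes a multiple of
    order [vp] comparable to [vp * bump l] on the window. *)
Definition wave x : R[i] := real_complex R (loc x / (4 * l)) * expi (2 * pi * x * xi0).

Lemma nice_wave : nice wave.
Proof.
rewrite /wave; under eq_fun do rewrite mulrC; apply: nice_expi; first by meas.
split.
  apply: cmeasurable_real; apply: measurable_funM; last exact: measurable_cst.
  exact: measurable_loc.
exists (4 * l)^-1, (2 * l + `|cb|); split.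
- by rewrite invr_ge0 mulr_ge0// ltW.
- by rewrite ltr_wpDr// mulr_gt0.
move=> x; rewrite cmod_real ger0_norm ?divr_ge0 ?loc_ge0 ?mulr_ge0 ?(ltW l0)//.
rewrite mulrC ler_wpM2l ?invr_ge0 ?mulr_ge0 ?(ltW l0)// cutoffE.
have [[-> h]|[-> _]] := loc01 x; last exact: ler0n.
suff -> : `|x| <= 2 * l + `|cb| by [].
by have := ler_normD (x - cb) cb; rewrite subrK; lra.
Qed.

Lemma cmod_wave x : cmod (wave x) = loc x / (4 * l).
Proof.
by rewrite cmodM cmod_expi mulr1 cmod_real ger0_norm// divr_ge0 ?loc_ge0 ?mulr_ge0 ?(ltW l0).
Qed.

Lemma fourier_wave : fourier wave xi0 = 1.
Proof.
rewrite /fourier.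
have -> : (fun x => wave x * expi (- (2 * pi * x * xi0))) =
    (fun x => real_complex R (loc x / (4 * l))).
  by apply/funext => x; rewrite /wave -mulrA -expiD addrN expi0 mulr1.
apply/eqP; rewrite eq_complex /=; apply/andP; split; apply/eqP;
  last by rewrite /Rintegral integral0.
rewrite /Rintegral -/(nint (fun x => loc x / (4 * l))).
under eq_fun do rewrite mulrC.
rewrite nintZ ?invr_ge0 ?mulr_ge0 ?(ltW l0)//; try exact: measurable_loc; try exact: loc_ge0.
by rewrite nint_loc -EFinM /= mulVf// gt_eqF// mulr_gt0.
Qed.

Definition bad x : R[i] := piece x - fourier piece xi0 * wave x.

Lemma cmod_fourier_piece : cmod (fourier piece xi0) <= 4 * vp.
Proof.
rewrite -lee_fin; apply: le_trans nint_piece; apply: cmod_fourier_le.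
exact: nice_cintegrable nice_piece.
Qed.

Lemma nice_bad : nice bad.
Proof. by apply: niceB; [exact: nice_piece|apply: niceZ; exact: nice_wave]. Qed.

Lemma fourier_bad : fourier bad xi0 = 0.
Proof.
rewrite fourierB; [|exact: nice_cintegrable nice_piece|].
  by rewrite fourierZ ?fourier_wave ?mulr1 ?subrr//; exact: nice_cintegrable nice_wave.
by apply: cintegrableZ; exact: nice_cintegrable nice_wave.
Qed.

Lemma bad_supp x : 3 * l < `|x - c| -> bad x = 0.
Proof.
move=> xc; have [[_ h]|[E _]] := loc01 x; last first.
  by rewrite /bad /piece /wave E mul0r !(rmorph0, mulr0, mul0r, subr0).
by exfalso; have := ler_normD (x - cb) (cb - c); rewrite addrA subrK (distrC cb c); have := ccb; lra.
Qed.

Lemma cmod_bad x : cmod (bad x) <= cmod (piece x) + 4 * vp * (loc x / (4 * l)).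
Proof.
apply: le_trans (cmodB _ _) _; rewrite lerD2l cmodM cmod_wave.
by rewrite ler_wpM2r ?cmod_fourier_piece// divr_ge0 ?loc_ge0 ?mulr_ge0 ?(ltW l0).
Qed.

Lemma nint_bad : (nint (fun x => cmod (bad x)) <= (8 * vp)%:E)%E.
Proof.
have mp := measurable_cmod (nice_piece).1.
apply: (@le_trans _ _ (nint (fun x => cmod (piece x) + vp / l * loc x))).
  apply: le_nint => x; first exact: cmod_ge0.
  apply: le_trans (cmod_bad x) _; rewrite lerD2l le_eqVlt; apply/orP; left; apply/eqP.
  by field; rewrite gt_eqF.
have vl : 0 <= vp / l by rewrite divr_ge0// ltW.
rewrite nintD//; last 3 first.
- by apply: measurable_funM; [exact: measurable_cst|exact: measurable_loc].
- by move=> x; exact: cmod_ge0.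
- by move=> x; rewrite mulr_ge0 ?loc_ge0.
rewrite nintZ//; try exact: measurable_loc; try exact: loc_ge0.
rewrite nint_loc -EFinM (_ : vp / l * (4 * l) = 4 * vp); last by field; rewrite gt_eqF.
apply: le_trans (leeD nint_piece (lexx _)) _.
by rewrite -EFinD lee_fin; lra.
Qed.

(** The form B V^2 l with B = 2 and V = 8 vp is the one taken by the annulus estimate. On the window
    [bump_decay] bounds |x - c| |piece| by vp, and |x - c| <= 3 l bounds the wave part by 3 vp,
    whence 20 = 2 + 18. *)
Lemma nint_bad_sqr :
  (nint (fun x => (`|x - c| ^+ 2 * cmod (bad x) ^+ 2)%R) <= (2 * (8 * vp) ^+ 2 * l)%:E)%E.
Proof.
apply: (@le_trans _ _ (nint (fun x => 20 * vp ^+ 2 * loc x))).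
  apply: le_nint => x; first by rewrite mulr_ge0 ?sqr_ge0.
  have [[E h]|[E h]] := loc01 x; last first.
    by rewrite /bad /piece /wave E mul0r !(rmorph0, mulr0, mul0r, subr0, cmod0, expr0n).
  have h3 : `|x - c| <= 3 * l.
    by have := ler_normD (x - cb) (cb - c); rewrite addrA subrK (distrC cb c); have := ccb; lra.
  have d := bump_decay (x - c) t0.
  rewrite E mulr1.
  apply: (@le_trans _ _ (`|x - c| ^+ 2 * (2 * cmod (piece x) ^+ 2 + 2 * (vp / l) ^+ 2))).
    rewrite ler_wpM2l ?sqr_ge0//.
    have c2 : cmod (bad x) <= cmod (piece x) + vp / l.
      have := cmod_bad x; rewrite E.
      by rewrite (_ : 4 * vp * (1 / (4 * l)) = vp / l)//; field; rewrite gt_eqF.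
    have p0 := cmod_ge0 (piece x); have b0 := cmod_ge0 (bad x).
    have vl : 0 <= vp / l by rewrite divr_ge0// ltW.
    apply: (@le_trans _ _ ((cmod (piece x) + vp / l) ^+ 2)).
      by rewrite ler_pXn2r ?nnegrE ?addr_ge0.
    have := sqr_ge0 (cmod (piece x) - vp / l); lra.
  have a1 : `|x - c| ^+ 2 * cmod (piece x) ^+ 2 <= vp ^+ 2.
    apply: (@le_trans _ _ (`|x - c| ^+ 2 * (vp * bump t (x - c)) ^+ 2)).
      rewrite ler_wpM2l ?sqr_ge0// ler_pXn2r ?nnegrE ?cmod_ge0 ?mulr_ge0 ?bump_ge0//.
      by have := cmod_piece x; rewrite E mulr1.
    rewrite exprMn mulrCA ler_piMr ?sqr_ge0//.
  have a2 : `|x - c| ^+ 2 * (vp / l) ^+ 2 <= 9 * vp ^+ 2.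
    apply: (@le_trans _ _ ((3 * l) ^+ 2 * (vp / l) ^+ 2)).
      rewrite ler_wpM2r ?sqr_ge0// ler_pXn2r ?nnegrE ?normr_ge0//.
      by rewrite mulr_ge0// ltW.
    by rewrite le_eqVlt; apply/orP; left; apply/eqP; field; rewrite gt_eqF.
  lra.
rewrite nintZ ?mulr_ge0 ?sqr_ge0//; try exact: measurable_loc; try exact: loc_ge0.
rewrite nint_loc -EFinM lee_fin; have := mulr_ge0 (sqr_ge0 vp) (ltW l0).
lra.
Qed.

(** Inside the window what remains is a multiple of the wave, at most vp / l. Outside it is the tail
    of [f], where |x - cb| > 2 l allows the scale to be raised from t to l. *)
Lemma cmod_piece_compl x :
  cmod (f x - bad x) <= 18 * vp * bump l (x - cb).
Proof.
have b0 := bump_ge0 l (x - cb).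
have vb : 0 <= vp * bump l (x - cb) by rewrite mulr_ge0.
have [[E h]|[E h]] := loc01 x.
  have -> : f x - bad x = fourier piece xi0 * wave x.
    by rewrite /bad /piece E mulr1; ring.
  rewrite cmodM cmod_wave E.
  have lb : l^-1 <= 3 ^+ 2 * bump l (x - cb) by apply: le_bump => //; lra.
  have k : cmod (fourier piece xi0) * (1 / (4 * l)) <= 4 * vp * (1 / (4 * l)).
    by rewrite ler_wpM2r ?cmod_fourier_piece// divr_ge0// mulr_ge0// ltW.
  apply: le_trans k _.
  rewrite (_ : 4 * vp * (1 / (4 * l)) = vp * l^-1); last by field; rewrite gt_eqF.
  by have := ler_wpM2l vp0 lb; lra.
have -> : f x - bad x = f x.
  by rewrite /bad /piece /wave E mul0r !(rmorph0, mulr0, mul0r, subr0).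
apply: le_trans (fq x) _.
have n1 : `|x - cb| <= `|x - c| + l.
  by have := ler_normD (x - c) (c - cb); rewrite addrA subrK; have := ccb; lra.
have k1 : bump t (x - c) <= 3 * bump t (x - cb).
  by apply: bump_le_of_norm => //; have := t0; lra.
have k2 : bump t (x - cb) <= 3 * bump l (x - cb).
  by apply: bump_le_scale => //; [exact: ltW|have := l0; lra].
have k3 : bump t (x - c) <= 9 * bump l (x - cb) by lra.
by have := ler_wpM2l vp0 k3; lra.
Qed.

End BadPieces.

(** * Sharing a function among cells; its good part *)

Section GoodPart.
Context {R : realType}.
Local Notation mu := (@lebesgue_measure R).
Variables (f : R -> R[i]) (t xi0 x0 d : R) (n : nat) (v : nat -> R)
  (bs : seq (nat * nat)).
Hypothesis nf : nice f.
Hypothesis d0 : 0 < d.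
Hypothesis dt : d <= t.
Hypothesis v0 : forall p, 0 <= v p.
Hypothesis vn : forall p, (n <= p)%N -> v p = 0.
Hypothesis bsn : flatten [seq iota b.1 b.2 | b <- bs] = iota 0 n.
Hypothesis bs0 : forall b, b \in bs -> (0 < b.2)%N.

Local Notation cell := (cell x0 d).
Local Notation blen := (blen d).

Let t0 : 0 < t. Proof. exact: lt_le_trans dt. Qed.

Definition majorant x := \sum_(p <- iota 0 n) v p * bump t (x - cell p).

Hypothesis fv : forall x, cmod (f x) <= majorant x.

Let vb0 p x : 0 <= v p * bump t (x - cell p).
Proof. by rewrite mulr_ge0 ?bump_ge0. Qed.

Lemma majorant_ge0 x : 0 <= majorant x.
Proof. exact: sumr_ge0. Qed.

Lemma le_majorant p x : v p * bump t (x - cell p) <= majorant x.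
Proof.
have [np|pn] := leqP n p; first by rewrite vn// mul0r majorant_ge0.
rewrite /majorant (perm_big _ (perm_to_rem (_ : p \in iota 0 n))) ?mem_iota//.
by rewrite big_cons lerDl; exact: sumr_ge0.
Qed.

Let mvb p : measurable_fun setT (fun x : R => v p * bump t (x - cell p)).
Proof.
apply: measurable_funM; first exact: measurable_cst.
by apply: (@measurableT_comp _ _ _ _ _ _ (bump t)); [exact: measurable_bump|meas].
Qed.

Lemma measurable_majorant : measurable_fun setT majorant.
Proof. exact: measurable_sum. Qed.

(** The shares are proportional to the terms of the majorant, so each part inherits the bound by a
    single bump. Where the majorant vanishes so does [f], and the quotient is 0 by convention. *)
Definition cell_part p x : R[i] :=
  real_complex R (v p * bump t (x - cell p) / majorant x) * f x.

Let ratio_ge0 p x : 0 <= v p * bump t (x - cell p) / majorant x.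
Proof. by rewrite divr_ge0 ?majorant_ge0. Qed.

Lemma measurable_inv (g : R -> R) : measurable_fun setT g ->
  measurable_fun setT (fun x => (g x)^-1).
Proof.
move=> mg; apply: (@measurableT_comp _ _ _ _ _ _ (@GRing.inv R)) => //.
(* The inverse is x |x|^(-2) off 0, and 0 at 0; real powers are measurable. *)
have -> : @GRing.inv R = (fun x : R => x * (x ^+ 2)^-1).
  apply/funext => x; have [->|x0'] := eqVneq x 0; first by rewrite invr0 mul0r.
  by field.
apply: measurable_funM => //.
rewrite (_ : (fun x : R => (x ^+ 2)^-1) = fun x => if x == 0 then 0 else `|x| `^ (- 2)); last first.
  apply/funext => x; case: eqVneq => [->|x0']; first by rewrite expr0n invr0.
  by rewrite powRN powR_mulrn// real_normK ?num_real.
apply: measurable_fun_ifT => //.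
  exact: measurable_fun_eqr.
exact: (@measurableT_comp _ _ _ _ _ _ (fun y : R => y `^ (- 2))).
Qed.

Lemma nice_cell_part p : nice (cell_part p).
Proof.
apply: (@niceM _ _ _ 1) => //.
  apply: cmeasurable_real; apply: measurable_funM => //.
  by apply: measurable_inv; exact: measurable_majorant.
move=> x; rewrite cmod_real ger0_norm//.
have [m0|m0] := eqVneq (majorant x) 0; first by rewrite m0 invr0 mulr0.
have mp : 0 < majorant x by rewrite lt_neqAle eq_sym m0 majorant_ge0.
by rewrite ler_pdivrMr// mul1r le_majorant.
Qed.

Lemma cmod_cell_part p x : cmod (cell_part p x) <= v p * bump t (x - cell p).
Proof.
rewrite cmodM cmod_real ger0_norm//.
have [m0|m0] := eqVneq (majorant x) 0; first by rewrite m0 invr0 mulr0 mul0r.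
have mp : 0 < majorant x by rewrite lt_neqAle eq_sym m0 majorant_ge0.
rewrite -mulrA ler_piMr// mulrC ler_pdivrMr// mul1r; exact: fv.
Qed.

Lemma sum_cell_part x : \sum_(p <- iota 0 n) cell_part p x = f x.
Proof.
rewrite -mulr_suml -real_complex_sum -mulr_suml -/(majorant x).
have [m0|m0] := eqVneq (majorant x) 0; last by rewrite mulfV// mul1r.
by rewrite m0 mul0r mul0r; apply/esym/cmod0_eq0/eqP; rewrite eq_le cmod_ge0 -m0 fv.
Qed.

Definition bad_part (b : nat * nat) p x : R[i] :=
  if t < blen b then bad (cell_part p) (cell b.1) (blen b) xi0 x else 0.

Definition good_part x : R[i] :=
  f x - \sum_(b <- bs) \sum_(p <- iota b.1 b.2) bad_part b p x.

Definition bsum (b : nat * nat) : R := \sum_(p <- iota b.1 b.2) v p.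

Lemma nice_bad_part b p : nice (bad_part b p).
Proof.
rewrite /bad_part; have [h|h] := ltP t (blen b); last exact: nice0.
exact: nice_bad (nice_cell_part p) t0 h.
Qed.

Lemma nice_good_part : nice good_part.
Proof.
by apply: niceB => //; apply: nice_sum => b; apply: nice_sum => p; exact: nice_bad_part.
Qed.

Definition small_sum x : R :=
  \sum_(b <- bs) (if blen b <= t then bsum b * bump t (x - cell b.1) else 0).

Let bsum_ge0 b : 0 <= bsum b. Proof. exact: sumr_ge0. Qed.

Lemma small_sum_ge0 x : 0 <= small_sum x.
Proof. by apply: sumr_ge0 => b _; case: ifP => // _; rewrite mulr_ge0 ?bump_ge0. Qed.

Lemma measurable_small_sum : measurable_fun setT small_sum.
Proof.
apply: measurable_sum => b; case: (blen b <= t); last exact: measurable_cst.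
apply: measurable_funM; first exact: measurable_cst.
by apply: (@measurableT_comp _ _ _ _ _ _ (bump t)); [exact: measurable_bump|meas].
Qed.

(** Blocks no longer than t keep their cell parts, whose bumps are moved to the start of the block
    with a factor 3; longer ones leave the remainder bounded in [cmod_piece_compl]. *)
Lemma cmod_good_part x : cmod (good_part x) <= 3 * small_sum x +
  18 * \sum_(b <- bs) bsum b * bump (blen b) (x - cell b.1).
Proof.
have -> : good_part x = \sum_(b <- bs) \sum_(p <- iota b.1 b.2) (cell_part p x - bad_part b p x).
  rewrite /good_part -[in LHS]sum_cell_part -bsn.
  have -> : \sum_(p <- flatten [seq iota b.1 b.2 | b <- bs]) cell_part p x =
      \sum_(b <- bs) \sum_(p <- iota b.1 b.2) cell_part p x.
    by rewrite big_flatten big_map.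
  by rewrite -sumrB; apply: eq_bigr => b _; rewrite -sumrB.
apply: le_trans (cmod_sum _ _) _; rewrite /small_sum !mulr_sumr -big_split /=.
apply: ler_sum => b _; apply: le_trans (cmod_sum _ _) _.
rewrite /bad_part; have [h|h] := leP (blen b) t.
  apply: (@le_trans _ _ (3 * (bsum b * bump t (x - cell b.1)))).
    rewrite mulr_suml mulr_sumr big_seq [leRHS]big_seq; apply: ler_sum => p pb.
    rewrite subr0; apply: le_trans (cmod_cell_part p x) _; rewrite mulrCA ler_wpM2l//.
    have hp : `|cell p - cell b.1| <= t by apply: le_trans h; exact: cell_dist.
    have := @bump_shift _ t (x - cell b.1) (cell p - cell b.1) t0 hp.
    by rewrite (_ : x - cell b.1 - (cell p - cell b.1) = x - cell p)//; ring.
  by rewrite lerDl !mulr_ge0 ?bump_ge0.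
rewrite mulr0 add0r mulr_suml mulr_sumr big_seq [leRHS]big_seq; apply: ler_sum => p pb.
rewrite mulrA; apply: (@cmod_piece_compl _ _ t (v p) (cell p)) => //.
- exact: nice_cell_part.
- by move=> y; exact: cmod_cell_part.
- exact: cell_dist.
Qed.

(* Cauchy-Schwarz with weights [blen b / bsum b], then a Riemann sum. *)
Lemma nint_small_sum_sqr :
  (nint (fun x => (small_sum x ^+ 2)%R) <=
   (144 * \sum_(b <- bs) bsum b ^+ 2 / blen b)%:E)%E.
Proof.
pose g (b : nat * nat) x : R := if blen b <= t then bump t (x - cell b.1) else 0.
have g0 b x : 0 <= g b x by rewrite /g; case: ifP => // _; exact: bump_ge0.
have mg b : measurable_fun setT (g b).
  rewrite /g; case: (blen b <= t); last exact: measurable_cst.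
  by apply: (@measurableT_comp _ _ _ _ _ _ (bump t)); [exact: measurable_bump|meas].
have ng b : (nint (g b) <= 4%:E)%E.
  rewrite /g; case: (blen b <= t); last by rewrite nint0 lee_fin.
  rewrite (@nint_translate _ (bump t) (- cell b.1)).
  - exact: nint_bump.
  - exact: measurable_bump.
  - by move=> x; exact: bump_ge0.
have l0 b : b \in bs -> 0 < blen b by move=> /bs0 bp; rewrite mulr_gt0// ltr0n.
have bl0 b : 0 <= blen b by rewrite mulr_ge0// ltW.
have c0 b : 0 <= bsum b ^+ 2 / blen b by rewrite divr_ge0 ?sqr_ge0.
have pw x : small_sum x ^+ 2 <= 36 * \sum_(b <- bs) bsum b ^+ 2 / blen b * g b x.
  have cs := @wl2_cauchy_schwarz _ _ bs (fun b => g b x) (fun b => g0 b x)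
    (fun b => bsum b / Num.sqrt (blen b)) (fun b => Num.sqrt (blen b)).
  have E : small_sum x = \sum_(b <- bs) g b x *
      (bsum b / Num.sqrt (blen b) * Num.sqrt (blen b)).
    rewrite /small_sum big_seq [RHS]big_seq; apply: eq_bigr => b bb.
    rewrite divfK ?gt_eqF ?sqrtr_gt0 ?l0// /g.
    by case: ifP => _; rewrite ?mul0r// mulrC.
  rewrite -E in cs.
  apply: (@le_trans _ _ ((wl2 bs (g^~ x) (fun b => bsum b / Num.sqrt (blen b)) *
     wl2 bs (g^~ x) (fun b => Num.sqrt (blen b))) ^+ 2)).
    by rewrite ler_pXn2r ?nnegrE ?mulr_ge0 ?wl2_ge0 ?small_sum_ge0.
  rewrite exprMn !wl2_sqr// [leLHS]mulrC; apply: ler_pM.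
  - by apply: sumr_ge0 => b _; rewrite mulr_ge0 ?sqr_ge0.
  - by apply: sumr_ge0 => b _; rewrite mulr_ge0 ?sqr_ge0.
  - apply: (le_trans _ (sum_small_blocks x0 d0 bsn x dt)).
    rewrite le_eqVlt; apply/orP; left; apply/eqP; apply: eq_bigr => b _.
    by rewrite sqr_sqrtr// /g; case: ifP => _; rewrite ?mul0r// mulrC.
  - rewrite le_eqVlt; apply/orP; left; apply/eqP; apply: eq_bigr => b _.
    by rewrite exprMn exprVn sqr_sqrtr// mulrC.
apply: (@le_trans _ _ (nint (fun x => 36 * \sum_(b <- bs) bsum b ^+ 2 / blen b * g b x))).
  by apply: le_nint => x; [exact: sqr_ge0|exact: pw].
have mc b : measurable_fun setT (fun x => bsum b ^+ 2 / blen b * g b x).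
  by apply: measurable_funM => //; exact: measurable_cst.
rewrite nintZ//; last 2 first.
- exact: measurable_sum.
- by move=> x; apply: sumr_ge0 => b _; rewrite mulr_ge0.
rewrite nint_sum//; last by move=> b x; rewrite mulr_ge0.
apply: (@le_trans _ _ (36%:E * \sum_(b <- bs) (4 * (bsum b ^+ 2 / blen b))%:E)%E).
  rewrite lee_wpmul2l// ?lee_fin//; apply: lee_sum => b _; rewrite nintZ//.
  have -> : (4 * (bsum b ^+ 2 / blen b))%:E = ((bsum b ^+ 2 / blen b)%:E * 4%:E)%E.
    by rewrite -EFinM; congr EFin; ring.
  by rewrite lee_wpmul2l// lee_fin.
by rewrite sumEFin -EFinM lee_fin -mulr_sumr; lra.
Qed.

End GoodPart.

(** * Weak type estimate for discretized finite families *)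

Section Core.
Context {R : realType}.
Local Notation mu := (@lebesgue_measure R).
Variables (Tt : Type) (s : seq Tt) (J : Tt -> Type) (A : forall tau, seq (J tau)).
Variables (m : forall tau, J tau -> R -> R[i]) (S : forall tau, J tau -> set R).
Variables (xi0 : forall tau, J tau -> R) (N : Tt -> R).
Arguments m {tau}. Arguments S {tau}. Arguments xi0 {tau}.
Hypothesis hm : forall tau (i : J tau), hm_mult (m i) (S i) (xi0 i).
Hypothesis overlap : forall tau x, \sum_(i <- A tau) (\1_(S i) x : R) <= N tau.

Let N0 tau : 0 <= N tau.
Proof. by apply: le_trans (overlap tau 0); apply: sumr_ge0 => i _; rewrite indicE. Qed.

(** Listing the pairs (tau, i) turns the nested sums into a single weighted l^2 norm, to which
    Minkowski's inequality applies. *)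
Definition flat : seq {tau : Tt & J tau} :=
  [seq existT J tau i | tau <- s, i <- A tau].

Definition fweight (k : {tau : Tt & J tau}) : R := N (projT1 k).

Lemma fweight_ge0 k : 0 <= fweight k. Proof. exact: N0. Qed.

Definition fnorm (v : forall tau, J tau -> R) : R :=
  wl2 flat fweight (fun k => v (projT1 k) (projT2 k)).

Lemma fnorm_sqr v :
  fnorm v ^+ 2 = \sum_(tau <- s) N tau * \sum_(i <- A tau) v tau i ^+ 2.
Proof.
rewrite wl2_sqr; last exact: fweight_ge0.
rewrite big_allpairs_dep; apply: eq_bigr => tau _.
by rewrite mulr_sumr; apply: eq_bigr.
Qed.

Lemma fnorm_ge0 v : 0 <= fnorm v. Proof. exact: wl2_ge0. Qed.

Lemma sqrt_sqfunE (b : forall tau, J tau -> R -> R[i]) x :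
  Num.sqrt (sqfun s A (@m) b x) = wl2 s (fun=> 1)
   (fun tau => cmod (\sum_(i <- A tau) multiplier_op (m i) (b tau i) x)).
Proof. by rewrite /wl2; under [in RHS]eq_bigr do rewrite mul1r. Qed.

Variables (f : forall tau, J tau -> R -> R[i]) (t : forall tau, J tau -> R)
  (v : forall tau, J tau -> nat -> R) (x0 d : R) (k : nat).
Arguments f {tau}. Arguments t {tau}. Arguments v {tau}.
Local Notation n := (2 ^ k)%N.
Hypothesis nf : forall tau (i : J tau), nice (f i).
Hypothesis d0 : 0 < d.
Hypothesis dt : forall tau (i : J tau), d <= t i.
Hypothesis v0 : forall tau (i : J tau) p, 0 <= v i p.
Hypothesis vn : forall tau (i : J tau) p, (n <= p)%N -> v i p = 0.
Hypothesis fv : forall tau (i : J tau) x, cmod (f i x) <= majorant (t i) x0 d n (v i) x.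

Definition cell_norm (p : nat) : R := fnorm (fun tau i => v i p).

(** Squaring 3 small + 18 large gives 18 small^2 + 648 large^2. The small part has 2592 = 18 times
    144, by [nint_small_sum_sqr], and 2 from block averages being at most 2 al; 10368 is the
    constant of [nint_sum_blocks_sqr]. *)
Definition good_const : R := 2592 * 2 + 648 * 10368.

(** The summands come from Chebyshev with 4 / al^2 for the good part, from the length 4 [blen] of
    the enlarged blocks, and from Markov with 2 / al for bad pieces of mass bound 8 v. *)
Definition core_const : R := 4 * good_const + 4 + 16 * (8 + hm_const 2).

Variable al : R.
Hypothesis al0 : 0 < al.

Section WithBlocks.
Variable bs : seq (nat * nat).
Hypothesis bsn : flatten [seq iota b.1 b.2 | b <- bs] = iota 0 n.
Hypothesis bs0 : forall b, b \in bs -> (0 < b.2)%N.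

Definition bnorm (b : nat * nat) : R := \sum_(p <- iota b.1 b.2) cell_norm p.

Hypothesis bsG : forall b, b \in bs -> bnorm b <= 2 * al * blen d b.
Hypothesis bsl : forall b, b \in bs -> b.2 != 1%N -> al * blen d b < bnorm b.

Local Notation cell := (cell x0 d).
Local Notation blen := (blen d).

Let good tau (i : J tau) := good_part (f i) (t i) (xi0 i) x0 d n (v i) bs.
Let badp b p tau (i : J tau) := bad_part (f i) (t i) (xi0 i) x0 d n (v i) b p.

Let bnorm_ge0 b : 0 <= bnorm b.
Proof. by apply: sumr_ge0 => p _; exact: fnorm_ge0. Qed.

Let ngood tau (i : J tau) : nice (good i).
Proof. by apply: nice_good_part => //; exact: vn. Qed.

Let nbad b p tau (i : J tau) : nice (badp b p i).
Proof. by apply: nice_bad_part => //; exact: vn. Qed.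

Lemma fnorm_bsum b : fnorm (fun tau i => bsum (v i) b) <= bnorm b.
Proof. exact: (@wl2_sum _ _ flat fweight fweight_ge0 _ (iota b.1 b.2)). Qed.

Lemma total_bnorm : \sum_(b <- bs) bnorm b = \sum_(p <- iota 0 n) cell_norm p.
Proof. exact: sum_blocks. Qed.

Let blen0 b : b \in bs -> 0 < blen b.
Proof. by move=> /bs0 bp; rewrite mulr_gt0// ltr0n. Qed.

(** After Plancherel with overlap for each tau there are two sources. The [small] sums give bsum^2 /
    blen, whose weighted total over the indices is at most 2 al times the block norm. The [large]
    sums are first combined over the indices: Minkowski reduces them to one scalar sum of bumps, and
    [nint_sum_blocks_sqr] applies. *)
Lemma nint_sqfun_good : (nint (sqfun s A (@m) good) <=
  (good_const * al * \sum_(b <- bs) bnorm b)%:E)%E.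
Proof.
pose small tau (i : J tau) x := small_sum (t i) x0 d (v i) bs x.
pose large tau (i : J tau) x := \sum_(b <- bs) bsum (v i) b * bump (blen b) (x - cell b.1).
(* Measurability of a bump is drawn from a positive length, known for members of [bs]; hence the
   inserted membership test. *)
have mlarge tau (i : J tau) : measurable_fun setT (large tau i).
  rewrite /large (_ : (fun x => _) = (fun x => \sum_(b <- bs)
    (if b \in bs then bsum (v i) b * bump (blen b) (x - cell b.1) else 0))).
    apply: measurable_sum => b; case: (boolP (b \in bs)) => bb; last exact: measurable_cst.
    apply: measurable_funM; first exact: measurable_cst.
    apply: (@measurableT_comp _ _ _ _ _ _ (bump (blen b))); last by meas.
    exact: measurable_bump (blen0 bb).
  by apply/funext => x; rewrite big_seq [RHS]big_seq; apply: eq_bigr => b ->.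
have msmall tau (i : J tau) : measurable_fun setT (small tau i).
  exact: measurable_small_sum.
have bs_ge0 tau (i : J tau) b : 0 <= bsum (v i) b by exact: sumr_ge0.
have [K1 [K10 K1E]] : exists K : R, 0 <= K /\ K = 2592.
  by exists 2592; split; [exact: ler0n|].
have [K2 [K20 K2E]] : exists K : R, 0 <= K /\ K = 648.
  by exists 648; split; [exact: ler0n|].
have [K3 [K30 K3E]] : exists K : R, 0 <= K /\ K = 10368.
  by exists 10368; split; [exact: ler0n|].
have ptw tau (i : J tau) x : cmod (good i x) ^+ 2 <=
    18 * small tau i x ^+ 2 + K2 * large tau i x ^+ 2.
  have := @cmod_good_part _ (f i) (t i) (xi0 i) x0 d n (v i) bs (nf i) d0 (dt i)
    (v0 i) (vn i) bsn (fv i) x.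
  rewrite -/(small tau i x) -/(large tau i x) => h.
  apply: (@le_trans _ _ ((3 * small tau i x + 18 * large tau i x) ^+ 2)).
    by rewrite ler_pXn2r ?nnegrE ?cmod_ge0//; exact: le_trans (cmod_ge0 _) h.
  by rewrite K2E; have := sqr_ge0 (3 * small tau i x - 18 * large tau i x); lra.
have i1 : (nint (sqfun s A (@m) good) <= \sum_(tau <- s)
    ((N tau)%:E * \sum_(i <- A tau) nint (fun x => (cmod (good i x) ^+ 2)%R)))%E.
  rewrite nint_sum; last 2 first.
  - move=> tau; apply: measurable_cmod_sqr; apply: cmeasurable_sum => i.
    by apply: (measurable_multiplier_op (hm i)); exact: nice_cintegrable.
  - by move=> tau x; exact: sqr_ge0.
  by apply: lee_sum => tau _; exact: (nint_multiplier_sum (hm (tau:=tau)) (overlap tau)).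
apply: le_trans i1 _.
pose Q x := \sum_(tau <- s) N tau * \sum_(i <- A tau) large tau i x ^+ 2.
have mQ : measurable_fun setT Q.
  apply: measurable_sum => tau; apply: measurable_funM; first exact: measurable_cst.
  by apply: measurable_sum => i; exact: measurable_funX.
have QE x : Q x = fnorm (fun tau i => large tau i x) ^+ 2 by rewrite fnorm_sqr.
have Qle x : Q x <= (\sum_(b <- bs) bnorm b * bump (blen b) (x - cell b.1)) ^+ 2.
  rewrite QE ler_pXn2r ?nnegrE ?fnorm_ge0//; last first.
    by apply: sumr_ge0 => b _; rewrite mulr_ge0 ?bump_ge0.
  apply: le_trans (@wl2_sum _ _ flat fweight fweight_ge0 _ bs
    (fun b q => bsum (v (projT2 q)) b * bump (blen b) (x - cell b.1))) _.
  apply: ler_sum => b _.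
  rewrite [leRHS]mulrC; apply: le_trans (ler_wpM2l (bump_ge0 _ _) (fnorm_bsum b)).
  rewrite -wl2Z ?bump_ge0//; apply: ler_wl2; first exact: fweight_ge0.
  by move=> q; rewrite mulrC.
have bl_ge0 b : 0 <= blen b by rewrite mulr_ge0// ltW.
have i2 : (\sum_(tau <- s) ((N tau)%:E *
      \sum_(i <- A tau) nint (fun x => (cmod (good i x) ^+ 2)%R)) <=
    (K1 * \sum_(tau <- s) N tau * \sum_(i <- A tau)
        \sum_(b <- bs) bsum (v i) b ^+ 2 / blen b)%:E + K2%:E * nint Q)%E.
  have e1 : (K2%:E * nint Q = \sum_(tau <- s) ((N tau)%:E *
      \sum_(i <- A tau) (K2%:E * nint (fun x => (large tau i x ^+ 2)%R))))%E.
    rewrite nint_sum; last 2 first.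
    - move=> tau; apply: measurable_funM; first exact: measurable_cst.
      by apply: measurable_sum => i; exact: measurable_funX.
    - by move=> tau x; rewrite mulr_ge0//; apply: sumr_ge0 => i _; exact: sqr_ge0.
    rewrite ge0_sume_distrr; last first.
      move=> tau _; apply: nint_ge0 => x; rewrite mulr_ge0//.
      by apply: sumr_ge0 => i _; exact: sqr_ge0.
    apply: eq_bigr => tau _; rewrite nintZ//; last 2 first.
    - by apply: measurable_sum => i; exact: measurable_funX.
    - by move=> x; apply: sumr_ge0 => i _; exact: sqr_ge0.
    rewrite muleCA; congr (_ * _)%E.
    rewrite nint_sum; [|by move=> i; exact: measurable_funX|by move=> i x; exact: sqr_ge0].
    rewrite ge0_sume_distrr// => i _; apply: nint_ge0 => x; exact: sqr_ge0.
  rewrite e1 mulr_sumr -sumEFin -big_split /=; apply: lee_sum => tau _.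
  set S1 := \sum_(i <- A tau) \sum_(b <- bs) _ / _.
  have S10 : 0 <= S1.
    apply: sumr_ge0 => i _; apply: sumr_ge0 => b _; apply: divr_ge0; last exact: bl_ge0.
    exact: sqr_ge0.
  have -> : (K1 * (N tau * S1))%:E = ((N tau)%:E * (K1 * S1)%:E)%E.
    by rewrite -EFinM; congr EFin; ring.
  have c0 : (0 <= (K1 * S1)%:E)%E by rewrite lee_fin mulr_ge0.
  have d0' : (0 <= \sum_(i <- A tau) (K2%:E * nint (fun x => (large tau i x ^+ 2)%R)))%E.
    by apply: sume_ge0 => i _; apply: mule_ge0 => //; apply: nint_ge0 => x; exact: sqr_ge0.
  rewrite -(ge0_muleDr _ c0 d0') /S1.
  rewrite lee_wpmul2l ?lee_fin// mulr_sumr -sumEFin -big_split /=; apply: lee_sum => i _.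
  apply: (@le_trans _ _ (nint (fun x => 18 * small tau i x ^+ 2 + K2 * large tau i x ^+ 2))).
    by apply: le_nint => x; [exact: sqr_ge0|exact: ptw].
  have ms2 : measurable_fun setT (fun x => small tau i x ^+ 2) by exact: measurable_funX.
  have ml2 : measurable_fun setT (fun x => large tau i x ^+ 2) by exact: measurable_funX.
  rewrite nintD; last 4 first.
  - by apply: measurable_funM => //; exact: measurable_cst.
  - by apply: measurable_funM => //; exact: measurable_cst.
  - by move=> x; rewrite mulr_ge0 ?sqr_ge0.
  - by move=> x; rewrite mulr_ge0 ?sqr_ge0.
  rewrite !nintZ//; try by move=> x; exact: sqr_ge0.
  apply: leeD => //.
  have := @nint_small_sum_sqr _ (t i) x0 d n (v i) bs d0 (dt i) (v0 i) bsn bs0.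
  move=> h; apply: le_trans (lee_wpmul2l _ h) _; first by rewrite lee_fin.
  by rewrite -EFinM lee_fin K1E; lra.
apply: le_trans i2 _.
have nQ : (nint Q <= (K3 * al * \sum_(b <- bs) bnorm b)%:E)%E.
  rewrite K3E; apply: le_trans (nint_sum_blocks_sqr x0 d0 bsn (ltW al0) bnorm_ge0 bs0 bsG).
  apply: le_nint => x; last exact: Qle.
  by rewrite QE sqr_ge0.
have s1 : \sum_(tau <- s) N tau * \sum_(i <- A tau) \sum_(b <- bs) bsum (v i) b ^+ 2 / blen b <=
    2 * al * \sum_(b <- bs) bnorm b.
  have -> : \sum_(tau <- s) N tau * \sum_(i <- A tau) \sum_(b <- bs) bsum (v i) b ^+ 2 / blen b =
      \sum_(b <- bs) fnorm (fun tau i => bsum (v i) b) ^+ 2 / blen b.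
    under [RHS]eq_bigr do rewrite fnorm_sqr mulr_suml.
    rewrite exchange_big /=; apply: eq_bigr => tau _.
    rewrite exchange_big /= mulr_sumr; apply: eq_bigr => b _.
    by rewrite -mulr_suml mulrA.
  rewrite mulr_sumr big_seq [leRHS]big_seq; apply: ler_sum => b bb.
  rewrite ler_pdivrMr ?blen0//.
  have h := fnorm_bsum b; have h0 := fnorm_ge0 (fun tau i => bsum (v i) b).
  have := bsG bb; have := bnorm_ge0 b => h1 h2.
  rewrite expr2; apply: (@le_trans _ _ (bnorm b * bnorm b)); first exact: ler_pM.
  by have := ler_wpM2l h1 h2; lra.
apply: (@le_trans _ _ ((K1 * (2 * al * \sum_(b <- bs) bnorm b))%:E +
   K2%:E * (K3 * al * \sum_(b <- bs) bnorm b)%:E)%E).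
  apply: leeD; first by rewrite lee_fin ler_wpM2l.
  by rewrite lee_wpmul2l ?lee_fin.
by rewrite -EFinM -EFinD lee_fin /good_const -K1E -K2E -K3E; lra.
Qed.

(** Cells are treated one at a time because the weight |x - c| must vanish at the centre of the
    piece for [bump_decay] to apply. The L^1 bounds then add over the cells of a block to a multiple
    of [bnorm]. *)
Lemma nint_sqfun_bad b p : b \in bs -> p \in iota b.1 b.2 ->
  (nint (fun x => (far (cell p) (blen b) x * Num.sqrt (sqfun s A (@m) (badp b p) x))%R) <=
   ((8 + hm_const 2) * (8 * cell_norm p))%:E)%E.
Proof.
move=> bb pb; have l0 := blen0 bb.
have cd := cell_dist x0 d0 pb.
have ti tau (i : J tau) : 0 < t i by exact: lt_le_trans (dt i).
have ncp tau (i : J tau) : nice (cell_part (f i) (t i) x0 d n (v i) p).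
  by apply: nice_cell_part => //; exact: vn.
have ccp tau (i : J tau) y : cmod (cell_part (f i) (t i) x0 d n (v i) p y) <=
    v i p * bump (t i) (y - cell p).
  exact: cmod_cell_part.
apply: (@nint_sqfun_far _ _ s _ A (@m) (@S) (@xi0) N hm overlap (badp b p)
  (fun tau i => 8 * v i p) (cell p) (blen b) 2) => //.
- move=> tau i x xc; rewrite /badp /bad_part; case: ifP => // _.
  exact: (bad_supp _ _ cd xc).
- move=> tau i; rewrite /badp /bad_part; case: ltP => h.
    exact: nint_bad (ncp tau i) (ti tau i) h (v0 i p) (ccp tau i).
  by under eq_fun do rewrite cmod0; rewrite nint0 lee_fin mulr_ge0.
- move=> tau i; rewrite /badp /bad_part; case: ltP => h.
    exact: nint_bad_sqr (ncp tau i) (ti tau i) h (v0 i p) (ccp tau i) cd.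
  under eq_fun do rewrite cmod0 expr0n mulr0; rewrite nint0 lee_fin.
  by rewrite mulr_ge0 ?(ltW l0)// mulr_ge0 ?sqr_ge0.
- move=> tau i; rewrite /badp /bad_part; case: ltP => h.
    exact: (fourier_bad _ _ (ncp tau i) (ti tau i) h).
  rewrite /fourier; under eq_cintegral do rewrite mul0r; exact: cintegral_cst0.
- by rewrite mulr_ge0// fnorm_ge0.
- rewrite exprMn fnorm_sqr mulr_sumr; apply: ler_sum => tau _.
  rewrite mulrCA ler_wpM2l// mulr_sumr; apply: ler_sum => i _.
  by rewrite exprMn.
Qed.

(** A single cell has length d <= t i. Blocks for which the bisection gives no lower bound on the
    average thus produce no bad part. *)
Lemma bad_part_cell b p tau (i : J tau) x : b.2 = 1%N -> badp b p i x = 0.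
Proof.
move=> b1; rewrite /badp /bad_part /blen b1 mulr1.
by rewrite ltNge dt.
Qed.

(** [E] sums indicators of enlarged blocks with more than one cell. If it is below 1, x lies outside
    all of them; then al^2 < 2 U + 2 Q^2, which forces U >= al^2 / 4 or Q >= al / 2. *)
Lemma indicator_bound x : ((al ^+ 2 < sqfun s A (@m) (@f) x)%R%:R : R) <=
  4 / al ^+ 2 * sqfun s A (@m) good x +
  \sum_(b <- bs) (if b.2 != 1%N then cutoff (2 * blen b) (x - cell b.1) else 0) +
  2 / al * \sum_(b <- bs) \sum_(p <- iota b.1 b.2)
    far (cell p) (blen b) x * Num.sqrt (sqfun s A (@m) (badp b p) x).
Proof.
set U := sqfun _ _ _ good x; set E := \sum_(b <- bs) (if _ then _ else _).
set Q := \sum_(b <- bs) \sum_(p <- _) _.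
have U0 : 0 <= U by exact: sqfun_ge0.
have E0 : 0 <= E by apply: sumr_ge0 => b _; case: ifP => // _; exact: cutoff_ge0.
have Q0 : 0 <= Q.
  by apply: sumr_ge0 => b _; apply: sumr_ge0 => p _; rewrite mulr_ge0 ?far_ge0 ?sqrtr_ge0.
have a1 : 0 <= 4 / al ^+ 2 * U by rewrite mulr_ge0// divr_ge0 ?sqr_ge0.
have a3 : 0 <= 2 / al * Q by rewrite mulr_ge0// divr_ge0// ltW.
have [h|_] := ltP (al ^+ 2) (sqfun s A (@m) (@f) x); last by rewrite !addr_ge0.
have [e1|e1] := leP 1 E; first by rewrite /=; lra.
suff k2 : al ^+ 2 < 2 * U + 2 * Q ^+ 2.
  have [u|u] := leP (al ^+ 2 / 4) U.
    have : 1 <= 4 / al ^+ 2 * U.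
      by rewrite mulrAC ler_pdivlMr ?exprn_gt0//; lra.
    rewrite /=; lra.
  have q : (al / 2) ^+ 2 <= Q ^+ 2 by rewrite exprMn exprVn; lra.
  rewrite ler_pXn2r ?nnegrE ?divr_ge0 ?(ltW al0)// in q.
  have : 1 <= 2 / al * Q by rewrite mulrAC ler_pdivlMr//; lra.
  by rewrite /=; lra.
apply: lt_le_trans h _.
pose W tau := \sum_(b <- bs) \sum_(p <- iota b.1 b.2)
   \sum_(i <- A tau) multiplier_op (m i) (badp b p i) x.
have dec tau : \sum_(i <- A tau) multiplier_op (m i) (f i) x =
    \sum_(i <- A tau) multiplier_op (m i) (good i) x + W tau.
  have -> : W tau = \sum_(i <- A tau) \sum_(b <- bs) \sum_(p <- iota b.1 b.2)
      multiplier_op (m i) (badp b p i) x.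
    rewrite /W; under eq_bigr do rewrite exchange_big /=.
    by rewrite exchange_big.
  rewrite -big_split /=; apply: eq_bigr => i _.
  have nb2 : cintegrable (fun y => \sum_(b <- bs) \sum_(p <- iota b.1 b.2) badp b p i y).
    apply: nice_cintegrable; apply: nice_sum => b; apply: nice_sum => p; exact: nbad.
  have nb1 b : cintegrable (fun y => \sum_(p <- iota b.1 b.2) badp b p i y).
    by apply: nice_cintegrable; apply: nice_sum => p; exact: nbad.
  rewrite -[X in multiplier_op _ X](_ : (fun y => good i y +
      \sum_(b <- bs) \sum_(p <- iota b.1 b.2) badp b p i y) = f i); last first.
    by apply/funext => y; rewrite /good /good_part subrK.
  rewrite (multiplier_opD _ (hm i))//; last exact: nice_cintegrable.
  congr (_ + _); rewrite (multiplier_op_sum _ _ (hm i))//; apply: eq_bigr => b _.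
  rewrite (multiplier_op_sum _ _ (hm i))// => p.
  by apply: nice_cintegrable; exact: nbad.
have Wle : \sum_(tau <- s) cmod (W tau) ^+ 2 <= Q ^+ 2.
  have -> : \sum_(tau <- s) cmod (W tau) ^+ 2 = wl2 s (fun=> 1) (fun tau => cmod (W tau)) ^+ 2.
    by rewrite wl2_sqr//; under [RHS]eq_bigr do rewrite mul1r.
  rewrite ler_pXn2r ?nnegrE ?wl2_ge0//.
  pose w b p tau := cmod (\sum_(i <- A tau) multiplier_op (m i) (badp b p i) x).
  apply: (@le_trans _ _ (wl2 s (fun=> 1) (fun tau =>
      \sum_(b <- bs) \sum_(p <- iota b.1 b.2) w b p tau))).
    apply: ler_wl2 => // tau; rewrite !ger0_norm ?cmod_ge0//; last first.
      by apply: sumr_ge0 => b _; apply: sumr_ge0 => p _; exact: cmod_ge0.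
    by apply: le_trans (cmod_sum _ _) _; apply: ler_sum => b _; exact: cmod_sum.
  apply: le_trans (wl2_sum _ _ _ _) _ => //.
  rewrite /Q big_seq [leRHS]big_seq; apply: ler_sum => b bb.
  apply: le_trans (wl2_sum _ _ _ _) _ => //.
  rewrite big_seq [leRHS]big_seq; apply: ler_sum => p pb.
  rewrite -[leLHS]/(wl2 s (fun=> 1) (fun tau => w b p tau)) /w -sqrt_sqfunE.
  have [b1|b1] := eqVneq b.2 1%N.
    rewrite (_ : sqfun _ _ _ _ _ = 0) ?sqrtr0 ?mulr0// /sqfun big1// => tau _.
    rewrite big1 ?cmod0 ?expr0n// => i _.
    rewrite (_ : badp b p i = fun=> 0); last by apply/funext => y; exact: bad_part_cell.
    rewrite multiplier_opE /ift /fourier.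
    under eq_cintegral do under eq_cintegral do rewrite mul0r.
    by under eq_cintegral do rewrite cintegral_cst0 mulr0 mul0r; exact: cintegral_cst0.
  (* Outside the interval of radius 2 [blen b] about the start of the block, x is at distance at
     least [blen b] from each of its cells. *)
  suff -> : far (cell p) (blen b) x = 1 by rewrite mul1r.
  have c1 : cutoff (2 * blen b) (x - cell b.1) < 1.
    apply: le_lt_trans e1.
    rewrite /E (perm_big _ (perm_to_rem bb)) big_cons b1 lerDl.
    by apply: sumr_ge0 => b' _; case: ifP => // _; exact: cutoff_ge0.
  have c2 : 2 * blen b < `|x - cell b.1|.
    by rewrite ltNge; apply/negP => h; move: c1; rewrite cutoffE h mulr1n ltxx.
  rewrite /far; suff -> : blen b <= `|x - cell p| by [].
  have := cell_dist x0 d0 pb.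
  by have := ler_normD (x - cell p) (cell p - cell b.1); rewrite addrA subrK; lra.
apply: (@le_trans _ _ (2 * U + 2 * \sum_(tau <- s) cmod (W tau) ^+ 2)); last by lra.
rewrite /U /sqfun !mulr_sumr -big_split /=; apply: ler_sum => tau _.
have aux (z y w : R[i]) : z = y + w -> cmod z ^+ 2 <= 2 * cmod y ^+ 2 + 2 * cmod w ^+ 2.
  by move=> ->; exact: cmod_sqrD.
exact: aux (dec tau).
Qed.

Lemma weak_type_blocks :
  (al%:E * mu [set x | (al ^+ 2 < sqfun s A (@m) (@f) x)%R] <=
   (core_const * \sum_(p <- iota 0 n) cell_norm p)%:E)%E.
Proof.
have mU : measurable_fun setT (sqfun s A (@m) good).
  by apply: (measurable_sqfun s A hm) => tau i; exact: nice_cintegrable.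
have mf : measurable_fun setT (sqfun s A (@m) (@f)).
  by apply: (measurable_sqfun s A hm) => tau i; exact: nice_cintegrable.
have mset : measurable [set x | (al ^+ 2 < sqfun s A (@m) (@f) x)%R].
  rewrite (_ : [set x | _] = sqfun s A (@m) (@f) @^-1` `]al ^+ 2, +oo[%classic).
    by rewrite -[X in measurable X]setTI; exact: mf.
  by apply/seteqP; split => x /=; rewrite in_itv/= andbT.
have mq b p : measurable_fun setT (fun x =>
    far (cell p) (blen b) x * Num.sqrt (sqfun s A (@m) (badp b p) x)).
  apply: measurable_funM; first exact: measurable_far.
  apply: measurable_sqrt; apply: (measurable_sqfun s A hm) => tau i.
  exact: nice_cintegrable.
have q0 b p x : 0 <= far (cell p) (blen b) x * Num.sqrt (sqfun s A (@m) (badp b p) x).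
  by rewrite mulr_ge0 ?far_ge0 ?sqrtr_ge0.
have ec0 (b : nat * nat) (x : R) :
    0 <= (if b.2 != 1%N then cutoff (2 * blen b) (x - cell b.1) else 0).
  by case: ifP => // _; exact: cutoff_ge0.
have mec (b : nat * nat) : measurable_fun setT (fun x : R =>
    if b.2 != 1%N then cutoff (2 * blen b) (x - cell b.1) else 0).
  case: (b.2 != 1%N); last exact: measurable_cst.
  apply: (@measurableT_comp _ _ _ _ _ _ (cutoff (2 * blen b))); last by meas.
  exact: measurable_cutoff.
have a0 : 0 <= 4 / al ^+ 2 by rewrite divr_ge0 ?sqr_ge0.
have a1 : 0 <= 2 / al by rewrite divr_ge0// ltW.
set G := \sum_(p <- iota 0 n) cell_norm p.
have G0 : 0 <= G by apply: sumr_ge0 => p _; exact: fnorm_ge0.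
have GE : \sum_(b <- bs) bnorm b = G by exact: total_bnorm.
have tot : (mu [set x | (al ^+ 2 < sqfun s A (@m) (@f) x)%R] <=
    (core_const * G / al)%:E)%E.
  rewrite -nint_indic//.
  apply: (@le_trans _ _ (nint (fun x =>
    4 / al ^+ 2 * sqfun s A (@m) good x +
    \sum_(b <- bs) (if b.2 != 1%N then cutoff (2 * blen b) (x - cell b.1) else 0) +
    2 / al * \sum_(b <- bs) \sum_(p <- iota b.1 b.2)
      far (cell p) (blen b) x * Num.sqrt (sqfun s A (@m) (badp b p) x)))).
    apply: le_nint => x; first by rewrite indicE.
    apply: le_trans (indicator_bound x); rewrite indicE ler_nat.
    by case: (boolP (_ \in _)) => // /set_mem /= ->.
  have m1 : measurable_fun setT (fun x => 4 / al ^+ 2 * sqfun s A (@m) good x).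
    exact: (measurable_funM (measurable_cst _) mU).
  have m2 : measurable_fun setT (fun x : R => \sum_(b <- bs)
      (if b.2 != 1%N then cutoff (2 * blen b) (x - cell b.1) else 0)).
    exact: measurable_sum.
  have m3 : measurable_fun setT (fun x => \sum_(b <- bs) \sum_(p <- iota b.1 b.2)
      far (cell p) (blen b) x * Num.sqrt (sqfun s A (@m) (badp b p) x)).
    by apply: measurable_sum => b; exact: measurable_sum.
  have p1 x : 0 <= 4 / al ^+ 2 * sqfun s A (@m) good x by rewrite mulr_ge0 ?sqfun_ge0.
  have p2 (x : R) : 0 <= \sum_(b <- bs)
      (if b.2 != 1%N then cutoff (2 * blen b) (x - cell b.1) else 0).
    exact: sumr_ge0.
  have p3 x : 0 <= \sum_(b <- bs) \sum_(p <- iota b.1 b.2)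
      far (cell p) (blen b) x * Num.sqrt (sqfun s A (@m) (badp b p) x).
    by apply: sumr_ge0 => b _; exact: sumr_ge0.
  rewrite nintD; last 4 first.
  - exact: (measurable_funD m1 m2).
  - exact: (measurable_funM (measurable_cst _) m3).
  - by move=> x; rewrite addr_ge0.
  - by move=> x; rewrite mulr_ge0.
  rewrite nintD// !nintZ//; last by move=> x; exact: sqfun_ge0.
  have m4 (b : nat * nat) : measurable_fun setT (fun x => \sum_(p <- iota b.1 b.2)
      far (cell p) (blen b) x * Num.sqrt (sqfun s A (@m) (badp b p) x)).
    exact: measurable_sum.
  have p4 (b : nat * nat) x : 0 <= \sum_(p <- iota b.1 b.2)
      far (cell p) (blen b) x * Num.sqrt (sqfun s A (@m) (badp b p) x).
    exact: sumr_ge0.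
  rewrite (nint_sum bs mec ec0) (nint_sum bs m4 p4).
  have b1 : ((4 / al ^+ 2)%:E * nint (sqfun s A (@m) good) <=
      (4 * good_const * G / al)%:E)%E.
    apply: (@le_trans _ _ ((4 / al ^+ 2)%:E * (good_const * al * G)%:E)%E).
      rewrite lee_wpmul2l ?lee_fin// -GE; exact: nint_sqfun_good.
    rewrite -EFinM lee_fin le_eqVlt; apply/orP; left; apply/eqP.
    by field; rewrite gt_eqF.
  (* An enlarged block has length 4 [blen b], at most 4 / al times its norm, since its average
     exceeds al. *)
  have b2 : (\sum_(b <- bs) nint (fun x : R =>
      (if b.2 != 1%N then cutoff (2 * blen b) (x - cell b.1) else 0)%R) <=
      (4 * G / al)%:E)%E.
    apply: (@le_trans _ _ (\sum_(b <- bs) (4 / al * bnorm b)%:E)%E); last first.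
      rewrite sumEFin -mulr_sumr GE lee_fin le_eqVlt.
      by apply/orP; left; apply/eqP; ring.
    rewrite big_seq [leRHS]big_seq; apply: lee_sum => b bb.
    have [e|e] := eqVneq b.2 1%N.
      by rewrite /= nint0 lee_fin mulr_ge0// divr_ge0// ltW.
    have l0 := blen0 bb.
    rewrite /= (@nint_translate _ (cutoff (2 * blen b)) (- cell b.1)); last 2 first.
    - exact: measurable_cutoff.
    - by move=> x; exact: cutoff_ge0.
    rewrite nint_cutoff; last by apply: mulr_ge0 => //; exact: ltW.
    have -> : 4 / al * bnorm b = 4 * bnorm b / al by ring.
    by rewrite lee_fin ler_pdivlMr//; have := bsl bb e; lra.
  have b3 : ((2 / al)%:E * \sum_(b <- bs) nint (fun x =>
      (\sum_(p <- iota b.1 b.2) far (cell p) (blen b) x *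
         Num.sqrt (sqfun s A (@m) (badp b p) x))%R) <=
      (16 * (8 + hm_const 2) * G / al)%:E)%E.
    apply: (@le_trans _ _ ((2 / al)%:E * (\sum_(b <- bs)
        (8 * (8 + hm_const 2) * bnorm b)%:E))%E); last first.
      rewrite sumEFin -mulr_sumr GE -EFinM lee_fin le_eqVlt.
      by apply/orP; left; apply/eqP; ring.
    rewrite lee_wpmul2l ?lee_fin// big_seq [leRHS]big_seq; apply: lee_sum => b bb.
    rewrite nint_sum// /bnorm mulr_sumr -sumEFin big_seq [leRHS]big_seq.
    apply: lee_sum => p pb; apply: le_trans (nint_sqfun_bad bb pb) _.
    by rewrite lee_fin; lra.
  apply: le_trans (leeD (leeD b1 b2) b3) _.
  rewrite -!EFinD lee_fin /core_const le_eqVlt; apply/orP; left; apply/eqP; ring.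
apply: (@le_trans _ _ (al%:E * (core_const * G / al)%:E)%E).
  by rewrite lee_pmul2l.
by rewrite -EFinM lee_fin mulrC divfK ?gt_eqF.
Qed.

End WithBlocks.

(** The hypothesis bounds the average over the whole grid by 2 al, the entry condition of the
    bisection; it is later met by taking k large. *)
Lemma core_weak_type : \sum_(p <- iota 0 n) cell_norm p <= 2 * (al * d) * n%:R ->
  (al%:E * mu [set x | (al ^+ 2 < sqfun s A (@m) (@f) x)%R] <=
   (core_const * \sum_(p <- iota 0 n) cell_norm p)%:E)%E.
Proof.
move=> hG.
have [bs [b1 b2 b3 b4]] := cz_blocks (fun p => fnorm_ge0 (fun tau i => v i p)) hG.
apply: (weak_type_blocks b1 b2) => b bb.
  by apply: le_trans (b3 b bb) _; rewrite /blen mulrA mulrA.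
by move=> bn; apply: le_lt_trans (b4 b bb bn); rewrite /blen mulrA.
Qed.

End Core.

(** * Discretization and truncation *)

Section Cells.
Context {R : realType}.
Local Notation mu := (@lebesgue_measure R).

Definition cell_ind (x0 d : R) (p : nat) : R -> R :=
  \1_(`[cell x0 d p, cell x0 d p.+1[%classic).

Lemma cell_ind_ge0 x0 d p x : 0 <= cell_ind x0 d p x.
Proof. by rewrite /cell_ind indicE. Qed.

Lemma measurable_cell_ind x0 d p : measurable_fun setT (cell_ind x0 d p).
Proof. exact: measurable_indic. Qed.

Lemma cell_indE x0 d p x :
  cell_ind x0 d p x = (cell x0 d p <= x < cell x0 d p.+1)%R%:R.
Proof.
rewrite /cell_ind indicE; congr (nat_of_bool _)%:R; apply/idP/idP.
  by move=> /set_mem /=; rewrite in_itv.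
by move=> h; apply/mem_set; rewrite /= in_itv.
Qed.

Lemma sum_cell_ind (x0 d : R) (n : nat) x : 0 < d ->
  \sum_(p <- iota 0 n) cell_ind x0 d p x = (cell x0 d 0 <= x < cell x0 d n)%R%:R.
Proof.
move=> d0; elim: n => [|n ih].
  rewrite big_nil; case: (boolP (_ <= x < _)) => // /andP[h1 h2].
  by have := le_lt_trans h1 h2; rewrite ltxx.
rewrite -addn1 iotaD big_cat big_seq1 /= add0n addn1 ih cell_indE -natrD.
congr (_%:R).
have cn : cell x0 d n < cell x0 d n.+1 by rewrite /cell ltrD2l ltr_pM2l// ltr_nat.
have c0 : cell x0 d 0 <= cell x0 d n by rewrite /cell lerD2l ler_pM2l// ler_nat.
case: (leP (cell x0 d n) x) => h.
  by rewrite andbF (le_trans c0 h).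
by rewrite andFb addn0 (lt_trans h cn) !andbT.
Qed.

Lemma nint_tail (g : R -> R) (e : R) : measurable_fun setT g ->
  (forall x, 0 <= g x) -> (nint g < +oo)%E -> 0 < e ->
  exists2 K : R, 0 < K & (nint (fun x => (g x * (1 - cutoff K x))%R) <= e%:E)%E.
Proof.
move=> mg g0 gi e0.
have mc (n : nat) : measurable_fun setT (fun x => g x * cutoff n%:R x).
  by apply: measurable_funM => //; exact: measurable_cutoff.
have [v v0 Ev] : exists2 v, 0 <= v & nint g = v%:E.
  have := nint_ge0 g0; case: (nint g) gi => [r|//|//] _ r0.
  by exists r => //; rewrite -lee_fin.
have [n hn] : exists n : nat, ((v - e)%:E < nint (fun x => (g x * cutoff n.+1%:R x)%R))%E.
  apply: contrapT => /forallNP h.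
  suff : (nint g <= (v - e)%:E)%E by rewrite Ev lee_fin; lra.
  apply: nint_le_of_cutoff => // n.
  have := h n => /negP; rewrite -leNgt; apply: le_trans.
  apply: le_nint => x; first by rewrite mulr_ge0// cutoff_ge0.
  by rewrite ler_wpM2l// cutoff_mono// ler_nat.
exists n.+1%:R; first by rewrite ltr0n.
have c1 x : 0 <= 1 - cutoff n.+1%:R x :> R by rewrite subr_ge0 cutoff_le1.
have : nint g = (nint (fun x => (g x * cutoff n.+1%:R x)%R) +
    nint (fun x => (g x * (1 - cutoff n.+1%:R x))%R))%E.
  rewrite -nintD.
  - by congr nint; apply/funext => x; ring.
  - exact: mc.
  - apply: measurable_funM => //; apply: measurable_funB; first exact: measurable_cst.
    exact: measurable_cutoff.
  - by move=> x; rewrite mulr_ge0// cutoff_ge0.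
  - by move=> x; rewrite mulr_ge0.
have gc0 x : 0 <= g x * cutoff n.+1%:R x by rewrite mulr_ge0// cutoff_ge0.
have gt0 x : 0 <= g x * (1 - cutoff n.+1%:R x) by rewrite mulr_ge0.
have gv (h : R -> R) : (forall x, 0 <= h x <= g x) ->
    exists2 u, 0 <= u & nint h = u%:E.
  move=> hg; apply: (@nint_fin _ _ v) => [x|]; first by have /andP[] := hg x.
  by rewrite -Ev; apply: le_nint => x; have /andP[] := hg x.
have [|a _ Ea] := gv (fun x => g x * cutoff n.+1%:R x).
  by move=> x; rewrite gc0 ler_piMr// cutoff_le1.
have [|b _ Eb] := gv (fun x => g x * (1 - cutoff n.+1%:R x)).
  by move=> x; rewrite gt0 ler_piMr// gerBl cutoff_ge0.
move: hn; rewrite Ev Ea Eb lte_fin lee_fin -EFinD => h [] h'; lra.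
Qed.

(** The transform is bounded by the L^1 norm and [m] lives on a band of length 2 K. As K depends on
    the multiplier, this only serves to make truncation errors small and never enters the
    constants. *)
Lemma cmod_multiplier_op_le m (S : set R) (xi0 K : R) u x :
  hm_mult m S xi0 -> cintegrable u -> 0 < K -> (forall xi, cmod (m xi) <= cutoff K xi) ->
  ((cmod (multiplier_op m u x))%:E <= (2 * K)%:E * nint (fun y => cmod (u y)))%E.
Proof.
move=> hm ui K0 mK.
have [M M0 uM] : exists2 M, 0 <= M & nint (fun x => cmod (u x)) = M%:E.
  have := nint_ge0 (fun x => cmod_ge0 (u x)).
  by case: ui => _; case: (nint _) => [r|//|//] _ r0; exists r => //; rewrite -lee_fin.
have wi := nice_cintegrable (nice_hm_fourier hm ui).
have wi' : cintegrable (fun xi => m xi * fourier u xi * expi (2 * pi * x * xi)).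
  by apply: cintegrable_expi => //; meas.
apply: le_trans (le_cmod_cintegral wi') _.
apply: (@le_trans _ _ (nint (fun xi => M * cutoff K xi))).
  apply: le_nint => xi; first exact: cmod_ge0.
  rewrite cmodM cmod_expi mulr1 cmodM mulrC; apply: ler_pM; rewrite ?cmod_ge0//.
  by rewrite -lee_fin -uM cmod_fourier_le.
rewrite nintZ//; try exact: measurable_cutoff; try by move=> y; exact: cutoff_ge0.
by rewrite nint_cutoff ?(ltW K0)// uM -!EFinM lee_fin mulrC.
Qed.

End Cells.

Section BumpConvolution.
Context {R : realType}.
Local Notation mu := (@lebesgue_measure R).
Variables (t : R) (F : R -> R).
Hypothesis t0 : 0 < t.
Hypothesis mF : measurable_fun setT F.
Hypothesis F0 : forall x, 0 <= F x.

Definition bconv x : \bar R := nint (fun y : R => bump t (x - y) * F y).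

Let h (xy : R * R) : \bar R := (bump t (xy.1 - xy.2) * F xy.2)%:E.

Let h0 xy : (0 <= h xy)%E.
Proof. by rewrite lee_fin mulr_ge0 ?bump_ge0. Qed.

Let mh : measurable_fun setT h.
Proof.
apply/measurable_EFinP; apply: measurable_funM.
  apply: (@measurableT_comp _ _ _ _ _ _ (bump t)); first exact: measurable_bump.
  by apply: measurable_funB; [exact: measurable_fst|exact: measurable_snd].
by apply: (@measurableT_comp _ _ _ _ _ _ F) => //; exact: measurable_snd.
Qed.

Lemma measurable_bconv : measurable_fun setT bconv.
Proof. exact: (@measurable_fun_fubini_tonelli_F _ _ _ _ _ mu h mh h0). Qed.

Lemma integral_bconv : (\int[mu]_x bconv x <= 4%:E * nint F)%E.
Proof.
rewrite /bconv /nint (@fubini_tonelli _ _ _ _ _ mu mu h mh h0) /=.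
apply: (@le_trans _ _ (\int[mu]_y (4 * F y)%:E)%E).
  apply: le_integral_nonmeasurable => y.
    by apply: integral_ge0 => x _; exact: h0.
  change (nint (fun x : R => (bump t (x - y) * F y)%R) <= (4 * F y)%:E)%E.
  under eq_fun do rewrite mulrC.
  have mb : measurable_fun setT (fun x : R => bump t (x - y)).
    by apply: (@measurableT_comp _ _ _ _ _ _ (bump t)); [exact: measurable_bump|meas].
  rewrite nintZ//; last by move=> x; exact: bump_ge0.
  rewrite (@nint_translate _ (bump t) (- y)); last 2 first.
  - exact: measurable_bump.
  - by move=> x; exact: bump_ge0.
  rewrite [leRHS]EFinM muleC lee_wpmul2r ?lee_fin//; exact: nint_bump.
by rewrite -[leLHS]/(nint (fun y => 4 * F y)%R) nintZ.
Qed.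

Lemma bconv_ge0 x : (0 <= bconv x)%E.
Proof. by apply: nint_ge0 => y; rewrite mulr_ge0 ?bump_ge0. Qed.

Lemma convolution_le_bconv x : (convolution (dilate t phi) F x <= 2%:E * bconv x)%E.
Proof.
have mb : measurable_fun setT (fun y : R => bump t (x - y) * F y).
  apply: measurable_funM => //.
  by apply: (@measurableT_comp _ _ _ _ _ _ (bump t)); [exact: measurable_bump|meas].
rewrite /bconv -nintZ//; last by move=> y; rewrite mulr_ge0 ?bump_ge0.
apply: le_nint => y.
  by rewrite mulr_ge0// /dilate mulr_ge0 ?invr_ge0 ?(ltW t0)// /phi powR_ge0.
by rewrite mulrA ler_wpM2r// phi_le_bump.
Qed.

End BumpConvolution.

Section Truncation.
Context {R : realType}.
Local Notation mu := (@lebesgue_measure R).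

Lemma ae_imply (P Q : R -> Prop) : (forall x, P x -> Q x) ->
  {ae mu, forall x, P x} -> {ae mu, forall x, Q x}.
Proof.
move=> PQ [M [mM M0 sM]]; exists M; split => // x /= nQ.
by apply: sM => /= Px; exact: nQ (PQ x Px).
Qed.

Variables (f : R -> R[i]) (F : R -> R) (t C1 d : R).
Hypothesis mf : cmeasurable f.
Hypothesis mF : measurable_fun setT F.
Hypothesis F0 : forall x, 0 <= F x.
Hypothesis Fi : (nint F < +oo)%E.
Hypothesis t0 : 0 < t.
Hypothesis C10 : 0 <= C1.
Hypothesis d0 : 0 < d.
Hypothesis dt : d <= t.
Hypothesis fF : {ae mu, forall x, ((cmod (f x))%:E <= C1%:E * bconv t F x)%E}.

Lemma cintegrable_of_bconv : cintegrable f.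
Proof.
split=> //; apply: (@le_lt_trans _ _ (C1%:E * (4%:E * nint F))%E).
  apply: (@le_trans _ _ (\int[mu]_x (C1%:E * bconv t F x))%E).
    apply: ae_ge0_le_integral => //.
    - by move=> x _; rewrite lee_fin cmod_ge0.
    - by apply/measurable_EFinP; exact: measurable_cmod.
    - by move=> x _; apply: mule_ge0 => //; exact: bconv_ge0.
    - apply: emeasurable_funM; first exact: measurable_cst.
      exact: measurable_bconv.
    - by apply: ae_imply fF => x h _.
  rewrite ge0_integralZl_EFin//; last 2 first.
  - by move=> x _; exact: bconv_ge0.
  - exact: measurable_bconv.
  by rewrite lee_wpmul2l ?lee_fin//; exact: integral_bconv.
have [v v0 ->] : exists2 v, 0 <= v & nint F = v%:E.
  have := nint_ge0 F0; case: (nint F) Fi => [r|//|//] _ r0.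
  by exists r => //; rewrite -lee_fin.
by rewrite -!EFinM ltry.
Qed.

Variable k : nat.
Local Notation n := (2 ^ k)%N.
Definition half_width : R := d * n%:R / 2.
Local Notation x0 := (- half_width).
Local Notation cell := (cell x0 d).
Local Notation cell_ind := (cell_ind x0 d).

Definition mass p : R := fine (nint (fun y => F y * cell_ind p y)).

Let mFc p : measurable_fun setT (fun y => F y * cell_ind p y).
Proof. by apply: measurable_funM => //; exact: measurable_cell_ind. Qed.

Let Fc0 p y : 0 <= F y * cell_ind p y.
Proof. by rewrite mulr_ge0// cell_ind_ge0. Qed.

Lemma massE p : nint (fun y => F y * cell_ind p y) = (mass p)%:E.
Proof.
rewrite /mass fineK// ge0_fin_numE; last exact: nint_ge0.
apply: le_lt_trans Fi; apply: le_nint => y //.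
by rewrite ler_piMr// /cell_ind indicE lern1 leq_b1.
Qed.

Lemma mass_ge0 p : 0 <= mass p.
Proof. by rewrite -lee_fin -massE nint_ge0. Qed.

(** The 3 pays for moving the points of a cell to its left end inside a bump; C1 is the constant of
    the pointwise bound. The value 0 beyond the grid is the convention of the discretized
    estimate. *)
Definition cell_mass p : R := if (p < n)%N then 3 * C1 * mass p else 0.

Lemma cell_mass_ge0 p : 0 <= cell_mass p.
Proof. by rewrite /cell_mass; case: ifP => // _; rewrite !mulr_ge0// mass_ge0. Qed.

Lemma cell_mass_out p : (n <= p)%N -> cell_mass p = 0.
Proof. by rewrite /cell_mass ltnNge => ->. Qed.

Definition maj x : R := majorant t x0 d n cell_mass x.

Lemma maj_ge0 x : 0 <= maj x.
Proof. by apply: majorant_ge0 => p; exact: cell_mass_ge0. Qed.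

(** The bound on [f] holds almost everywhere and involves [F] off the grid as well. Capping |f| at
    [maj] and cutting to the grid enforces the discretized bound everywhere. Where [f] vanishes the
    quotient is 0 by convention, harmless once multiplied by [f]. *)
Definition trunc_ratio x : R :=
  Num.min 1 (maj x * (cmod (f x))^-1) * cutoff half_width x.

Definition trunc x : R[i] := real_complex R (trunc_ratio x) * f x.

Lemma trunc_ratio01 x : 0 <= trunc_ratio x <= 1.
Proof.
have h : 0 <= Num.min 1 (maj x * (cmod (f x))^-1) <= 1.
  by rewrite le_min ler01 ge_min lexx mulr_ge0 ?maj_ge0 ?invr_ge0 ?cmod_ge0.
move: h => /andP[h1 h2]; rewrite /trunc_ratio mulr_ge0 ?cutoff_ge0//=.
by rewrite mulr_ile1 ?cutoff_ge0 ?cutoff_le1.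
Qed.

Lemma cmod_trunc x : cmod (trunc x) <= maj x.
Proof.
have /andP[r0 r1] := trunc_ratio01 x.
rewrite cmodM cmod_real ger0_norm//.
have [->|fx] := eqVneq (cmod (f x)) 0; first by rewrite mulr0 maj_ge0.
have fp : 0 < cmod (f x) by rewrite lt_neqAle eq_sym fx cmod_ge0.
rewrite -ler_pdivlMr//.
apply: (@le_trans _ _ (Num.min 1 (maj x * (cmod (f x))^-1))).
  rewrite ler_piMr ?cutoff_le1//.
  by rewrite le_min ler01 mulr_ge0 ?maj_ge0 ?invr_ge0 ?cmod_ge0.
by rewrite ge_min lexx orbT.
Qed.

Lemma nice_trunc : nice trunc.
Proof.
have hw : 0 < half_width by rewrite divr_gt0 ?mulr_gt0 ?ltr0n ?expn_gt0.
split.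
  apply: cmeasurableM => //; apply: cmeasurable_real.
  apply: measurable_funM; last exact: measurable_cutoff.
  apply: measurable_minr; first exact: measurable_cst.
  apply: measurable_funM.
    by apply: (measurable_majorant _ _ _ d0 dt).
  by apply: measurable_inv; exact: measurable_cmod.
exists (\sum_(p <- iota 0 n) cell_mass p * t^-1), half_width; split => //.
  by apply: sumr_ge0 => p _; rewrite mulr_ge0 ?cell_mass_ge0 ?invr_ge0 ?(ltW t0).
move=> x; have [xh|xh] := leP `|x| half_width; last first.
  have c0 : cutoff half_width x = 0 by rewrite cutoffE leNgt xh.
  by rewrite /trunc /trunc_ratio c0 !mulr0 rmorph0 mul0r cmod0.
rewrite cutoffE xh mulr1; apply: le_trans (cmod_trunc x) _.
by apply: ler_sum => p _; rewrite ler_wpM2l ?cell_mass_ge0// bump_max.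
Qed.

Lemma bconv_cells_le x :
  (C1%:E * nint (fun y => (bump t (x - y) * (F y * \sum_(p <- iota 0 n) cell_ind p y))%R)
   <= (maj x)%:E)%E.
Proof.
have mb : measurable_fun setT (fun y : R => bump t (x - y)).
  by apply: (@measurableT_comp _ _ _ _ _ _ (bump t)); [exact: measurable_bump|meas].
have E : nint (fun y => (bump t (x - y) * (F y * \sum_(p <- iota 0 n) cell_ind p y))%R) =
    (\sum_(p <- iota 0 n) nint (fun y => (bump t (x - y) * (F y * cell_ind p y))%R))%E.
  rewrite -nint_sum.
  - by congr nint; apply/funext => y; rewrite !mulr_sumr.
  - by move=> p; exact: measurable_funM.
  - by move=> p y; rewrite mulr_ge0 ?bump_ge0.
rewrite E ge0_sume_distrr; last first.
  by move=> p _; apply: nint_ge0 => y; rewrite mulr_ge0 ?bump_ge0.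
rewrite /maj /majorant -sumEFin big_seq [leRHS]big_seq; apply: lee_sum => p.
rewrite mem_iota /= add0n => pn.
apply: (@le_trans _ _ (C1%:E * (3 * bump t (x - cell p) * mass p)%:E)%E); last first.
  by rewrite -EFinM lee_fin /cell_mass pn le_eqVlt; apply/orP; left; apply/eqP; ring.
rewrite lee_wpmul2l ?lee_fin// [leRHS]EFinM -massE -nintZ//; last first.
  by rewrite mulr_ge0 ?bump_ge0.
apply: le_nint => y; first by rewrite mulr_ge0 ?bump_ge0.
rewrite cell_indE; have [/andP[y1 y2]|_] := boolP (_ <= y < _); last by rewrite !mulr0n !mulr0.
rewrite ler_wpM2r ?mulr_ge0//.
have h : `|y - cell p| <= t.
  rewrite ger0_norm ?subr_ge0//.
  by move: y2; rewrite /cell -natr1 mulrDr mulr1; have := dt; lra.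
have := @bump_shift _ t (x - cell p) (y - cell p) t0 h.
by rewrite (_ : x - cell p - (y - cell p) = x - y)//; ring.
Qed.

(** Off the grid the error is a tail of [f]. On the grid, [maj] dominates the contribution of the
    part of [F] carried by the grid, so the excess of |f| is at most C1 times the convolution with
    the tail of [F], whose integral is at most 4 times that tail. *)
Lemma nint_trunc_le (K : R) : K < half_width ->
  (nint (fun x => cmod (f x - trunc x)%R) <=
   nint (fun x => (cmod (f x) * (1 - cutoff K x))%R) +
   (4 * C1)%:E * nint (fun y => (F y * (1 - cutoff K y))%R))%E.
Proof.
move=> Kh; pose F2 y := F y * (1 - cutoff K y).
have c1 y : 0 <= 1 - cutoff K y by rewrite subr_ge0 cutoff_le1.
have F20 y : 0 <= F2 y by rewrite mulr_ge0.
have m1 : measurable_fun setT (fun y : R => 1 - cutoff K y).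
  by apply: measurable_funB; [exact: measurable_cst|exact: measurable_cutoff].
have mF2 : measurable_fun setT F2 by exact: measurable_funM.
have mft : measurable_fun setT (fun x : R => cmod (f x - trunc x)).
  by apply: measurable_cmod; apply: cmeasurableB => //; case: nice_trunc.
have mcf : measurable_fun setT (fun x : R => cmod (f x) * (1 - cutoff K x)).
  by apply: measurable_funM => //; exact: measurable_cmod.
have mbc := measurable_bconv t0 mF2 F20.
have b0 x := bconv_ge0 t F20 x.
apply: (@le_trans _ _ (\int[mu]_x ((cmod (f x) * (1 - cutoff K x))%:E + C1%:E * bconv t F2 x))%E).
  apply: ae_ge0_le_integral => //.
  - by move=> x _; rewrite lee_fin cmod_ge0.
  - exact/measurable_EFinP.
  - move=> x _; apply: adde_ge0; first by rewrite lee_fin mulr_ge0 ?cmod_ge0.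
    by apply: mule_ge0.
  - apply: emeasurable_funD; first exact/measurable_EFinP.
    by apply: emeasurable_funM => //; exact: measurable_cst.
  apply: ae_imply fF => x h _.
  have /andP[r0 r1] := trunc_ratio01 x.
  have E : cmod (f x - trunc x) = (1 - trunc_ratio x) * cmod (f x).
    rewrite /trunc -{1}[f x]mul1r -mulrBl cmodM.
    have -> : 1 - real_complex R (trunc_ratio x) = real_complex R (1 - trunc_ratio x).
      by rewrite rmorphB rmorph1.
    by rewrite cmod_real ger0_norm// subr_ge0.
  have fx0 := cmod_ge0 (f x).
  have [xh|xh] := leP `|x| half_width; last first.
    have -> : cutoff K x = 0 by rewrite cutoffE leNgt (lt_trans Kh xh).
    rewrite subr0 mulr1 -[leLHS]adde0; apply: leeD; last exact: mule_ge0.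
    by rewrite lee_fin E ler_piMl// gerBl.
  rewrite -[leLHS]add0e; apply: leeD; first by rewrite lee_fin mulr_ge0.
  have tr : trunc_ratio x = Num.min 1 (maj x * (cmod (f x))^-1).
    by rewrite /trunc_ratio cutoffE xh mulr1.
  rewrite E tr; have [fz|fz] := eqVneq (cmod (f x)) 0.
    by rewrite fz mulr0 mule_ge0.
  have fp : 0 < cmod (f x) by rewrite lt_neqAle eq_sym fz.
  have [mm|mm] := leP 1 (maj x * (cmod (f x))^-1).
    by rewrite subrr mul0r mule_ge0.
  rewrite mulrBl mul1r divfK// EFinB leeBlDr//.
  apply: le_trans h _.
  pose F1 y := F y * \sum_(p <- iota 0 n) cell_ind p y.
  have F10 y : 0 <= F1 y by rewrite mulr_ge0// sumr_ge0// => p _; exact: cell_ind_ge0.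
  have mF1 : measurable_fun setT F1.
    apply: measurable_funM => //; apply: measurable_sum => p; exact: measurable_cell_ind.
  have mb : measurable_fun setT (fun y : R => bump t (x - y)).
    by apply: (@measurableT_comp _ _ _ _ _ _ (bump t)); [exact: measurable_bump|meas].
  apply: (@le_trans _ _ (C1%:E * (bconv t F2 x + nint (fun y => (bump t (x - y) * F1 y)%R)))%E).
    rewrite lee_wpmul2l ?lee_fin// /bconv -nintD.
    - apply: le_nint => y; first by rewrite mulr_ge0 ?bump_ge0.
      rewrite -mulrDr ler_wpM2l ?bump_ge0// /F1 /F2 -mulrDr ler_peMr//.
      rewrite sum_cell_ind//.
      have -> : cell 0 = - half_width by rewrite /cell mulr0 addr0.
      have -> : cell n = half_width by rewrite /cell /half_width; field.
      have [_|hy] := boolP (_ <= y < _); first by rewrite mulr1n lerDr.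
      rewrite mulr0n addr0 cutoffE; suff -> : (`|y| <= K) = false by rewrite mulr0n subr0.
      apply/negbTE; rewrite -ltNge; apply: (lt_le_trans Kh).
      move: hy; rewrite negb_and -ltNge -leNgt => /orP[hy|hy].
        by rewrite -normrN; apply: le_trans (ler_norm (- y)); lra.
      exact: le_trans hy (ler_norm y).
    - exact: measurable_funM.
    - exact: measurable_funM.
    - by move=> y; rewrite mulr_ge0 ?bump_ge0.
    - by move=> y; rewrite mulr_ge0 ?bump_ge0.
  have n2 : (0 <= nint (fun y => (bump t (x - y) * F1 y)%R))%E.
    by apply: nint_ge0 => y; rewrite mulr_ge0 ?bump_ge0.
  by rewrite (ge0_muleDr _ (b0 x) n2); apply: leeD => //; exact: bconv_cells_le.
rewrite ge0_integralD//; last 4 first.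
- by move=> x _; rewrite lee_fin mulr_ge0 ?cmod_ge0.
- exact/measurable_EFinP.
- by move=> x _; apply: mule_ge0.
- by apply: emeasurable_funM => //; exact: measurable_cst.
apply: leeD => //; rewrite ge0_integralZl_EFin//.
apply: (@le_trans _ _ (C1%:E * (4%:E * nint F2))%E).
  by rewrite lee_wpmul2l ?lee_fin// integral_bconv.
by rewrite muleA -EFinM [_ * 4]mulrC.
Qed.

End Truncation.

(** * Weak type estimate for finite families of general functions *)

Section FiniteFamilies.
Context {R : realType}.
Local Notation mu := (@lebesgue_measure R).

Lemma exists_pos_lower (T : eqType) (r : seq T) (g : T -> R) :
  (forall x, 0 < g x) -> exists2 d, 0 < d & forall x, x \in r -> d <= g x.
Proof.
move=> g0; elim: r => [|x r [d d0 ih]]; first by exists 1.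
exists (Num.min d (g x)); first by rewrite lt_min d0 g0.
move=> y; rewrite inE => /predU1P[->|/ih h]; first by rewrite ge_min lexx orbT.
by rewrite ge_min h.
Qed.

Lemma near_seq (T : eqType) (r : seq T) (P : T -> nat -> Prop) :
  (forall x, \forall k \near \oo, P x k) ->
  \forall k \near \oo, forall x, x \in r -> P x k.
Proof.
move=> hP; elim: r => [|x r ih]; first by near=> k.
near=> k => y; rewrite inE => /predU1P[->|yr].
  by near: k; exact: hP.
by move: y yr; near: k; exact: ih.
Unshelve. all: by end_near. Qed.

Lemma core_const_gt0 : 0 < @core_const R.
Proof.
rewrite /core_const /good_const.
have h := @hm_const_ge0 R 2 (ler0n _ _); lra.
Qed.

Lemma half_lt (u v w a : R) : a < u -> u <= v + w -> w <= a / 2 -> a / 2 < v.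
Proof. lra. Qed.

Variables (Tt : eqType) (s : seq Tt) (J : Tt -> eqType) (A : forall tau, seq (J tau)).
Variables (m : forall tau, J tau -> R -> R[i]) (S : forall tau, J tau -> set R).
Variables (xi0 : forall tau, J tau -> R) (N : Tt -> R).
Arguments m {tau}. Arguments S {tau}. Arguments xi0 {tau}.
Hypothesis hm : forall tau (i : J tau), hm_mult (m i) (S i) (xi0 i).
Hypothesis overlap : forall tau x, \sum_(i <- A tau) (\1_(S i) x : R) <= N tau.

Let N0 tau : 0 <= N tau.
Proof. by apply: le_trans (overlap tau 0); apply: sumr_ge0 => i _; rewrite indicE. Qed.

Local Notation fnorm := (fnorm s A N).

Lemma wl2_cmod_perturb (a b : Tt -> R[i]) (c : Tt -> R) (e : R) : 0 <= e ->
  (forall tau, tau \in s -> cmod (a tau - b tau) <= e * c tau) ->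
  wl2 s (fun=> 1) (fun tau => cmod (a tau)) <=
  wl2 s (fun=> 1) (fun tau => cmod (b tau)) + e * wl2 s (fun=> 1) c.
Proof.
move=> e0 h; rewrite -wl2Z//.
apply: le_trans (wl2D _ _ _ _) => //.
rewrite /wl2; apply: ler_wsqrtr; rewrite big_seq [leRHS]big_seq.
apply: ler_sum => tau ts; rewrite !mul1r.
have h1 : cmod (a tau) <= cmod (b tau) + e * c tau.
  have := cmodD (b tau) (a tau - b tau); rewrite addrC subrK => /le_trans; apply.
  by rewrite lerD2l h.
by rewrite ler_pXn2r// nnegrE ?cmod_ge0//; apply: le_trans h1; exact: cmod_ge0.
Qed.

Lemma sqfun_perturb (f g : forall tau, J tau -> R -> R[i]) (x e : R) : 0 <= e ->
  (forall tau (i : J tau), tau \in s -> i \in A tau ->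
     cmod (multiplier_op (m i) (f tau i) x - multiplier_op (m i) (g tau i) x) <= e) ->
  Num.sqrt (sqfun s A (@m) f x) <= Num.sqrt (sqfun s A (@m) g x) +
    e * wl2 s (fun=> 1) (fun tau => (size (A tau))%:R).
Proof.
move=> e0 h.
have E1 := sqrt_sqfunE s A (@m) f x.
have E2 := sqrt_sqfunE s A (@m) g x.
have aux (u v w z c : R) : u = w -> v = z -> w <= z + c -> u <= v + c.
  by move=> -> ->.
apply: (aux _ _ _ _ _ E1 E2) => {E1 E2 aux}.
apply: wl2_cmod_perturb => // tau ts; rewrite -sumrB.
apply: le_trans (cmod_sum _ _) _.
apply: (@le_trans _ _ (\sum_(i <- A tau) e)).
  by rewrite big_seq [leRHS]big_seq; apply: ler_sum => i iA; exact: h.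
by rewrite big_const_seq count_predT iter_addr_0 mulr_natr.
Qed.

Variables (f : forall tau, J tau -> R -> R[i]) (F : forall tau, J tau -> R -> R)
  (t : forall tau, J tau -> R) (C1 : R).
Arguments f {tau}. Arguments F {tau}. Arguments t {tau}.
Hypothesis t0 : forall tau (i : J tau), 0 < t i.
Hypothesis C10 : 0 < C1.
Hypothesis mf : forall tau (i : J tau), cmeasurable (f i).
Hypothesis mF : forall tau (i : J tau), measurable_fun setT (F i).
Hypothesis F0 : forall tau (i : J tau) x, 0 <= F i x.
Hypothesis Fi : forall tau (i : J tau), (nint (F i) < +oo)%E.
Hypothesis fF : forall tau (i : J tau),
  {ae mu, forall x, ((cmod (f i x))%:E <= C1%:E * bconv (t i) (F i) x)%E}.

Let fi tau (i : J tau) : cintegrable (f i).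
Proof. exact: (cintegrable_of_bconv (mf i) (mF i) (F0 i) (Fi i) (t0 i) (ltW C10) (fF i)). Qed.

Definition Fnorm x : R := fnorm (fun tau i => F i x).

Lemma measurable_Fnorm : measurable_fun setT Fnorm.
Proof.
rewrite /Fnorm /fnorm /wl2; apply: measurable_sqrt; apply: measurable_sum => q.
by apply: measurable_funM; [exact: measurable_cst|apply: measurable_funX].
Qed.

Lemma Fnorm_ge0 x : 0 <= Fnorm x. Proof. exact: fnorm_ge0. Qed.

(* Minkowski's integral inequality on one cell, by testing against the vector of
   integrals itself. *)
Lemma fnorm_mass d k p : 0 < d ->
  ((fnorm (fun tau i => mass (F i) d k p))%:E <=
   nint (fun x => (Fnorm x * cell_ind (- half_width d k) d p x)%R))%E.
Proof.
move=> d0; set c := cell_ind _ _ _.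
have c0 x : 0 <= c x by exact: cell_ind_ge0.
have mc : measurable_fun setT c by exact: measurable_cell_ind.
set V := fnorm _.
have V0 : 0 <= V by exact: fnorm_ge0.
have [->|Vn] := eqVneq V 0.
  by apply: nint_ge0 => x; rewrite mulr_ge0 ?Fnorm_ge0.
have Vp : 0 < V by rewrite lt_neqAle eq_sym Vn.
rewrite -(@lee_pmul2l _ V%:E)// -EFinM -expr2.
pose a (q : {tau : Tt & J tau}) := mass (F (projT2 q)) d k p.
have a0 q : 0 <= a q by apply: mass_ge0 => //; exact: F0.
have wl0 := @fweight_ge0 _ _ _ _ _ N overlap.
have -> : V ^+ 2 = \sum_(q <- flat s A) fweight N q * a q ^+ 2.
  by rewrite wl2_sqr// => q; exact: N0.
have mt (q : {tau : Tt & J tau}) :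
    measurable_fun setT (fun x => F (projT2 q) x * c x) by exact: measurable_funM.
have tp (q : {tau : Tt & J tau}) x : 0 <= F (projT2 q) x * c x by rewrite mulr_ge0.
have wa (q : {tau : Tt & J tau}) : 0 <= fweight N q * a q by rewrite mulr_ge0// N0.
have E : ((\sum_(q <- flat s A) fweight N q * a q ^+ 2)%:E =
    nint (fun x => (\sum_(q <- flat s A) fweight N q * a q * (F (projT2 q) x * c x))%R))%E.
  rewrite nint_sum.
  - rewrite -sumEFin; apply: eq_bigr => q _.
    by rewrite nintZ// massE// -EFinM expr2 mulrA.
  - by move=> q; apply: measurable_funM => //; exact: measurable_cst.
  - by move=> q x; rewrite mulr_ge0.
rewrite E -nintZ//; last 2 first.
- by apply: measurable_funM => //; exact: measurable_Fnorm.
- by move=> x; rewrite mulr_ge0 ?Fnorm_ge0.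
apply: le_nint => x; first by apply: sumr_ge0 => q _; rewrite mulr_ge0.
have := @wl2_cauchy_schwarz _ _ (flat s A) (fweight N) (fun q => N0 (projT1 q)) a
  (fun q => F (projT2 q) x).
rewrite -/V -/(Fnorm x) => /(ler_wpM2r (c0 x)).
rewrite mulr_suml -mulrA => h; apply: le_trans h; rewrite le_eqVlt; apply/orP; left; apply/eqP.
by apply: eq_bigr => q _; ring.
Qed.

Lemma sum_fnorm_mass d k : 0 < d ->
  ((\sum_(p <- iota 0 (2 ^ k)) fnorm (fun tau i => mass (F i) d k p))%:E <=
   nint Fnorm)%E.
Proof.
move=> d0; rewrite -sumEFin.
apply: (@le_trans _ _ (\sum_(p <- iota 0 (2 ^ k))
   nint (fun x => (Fnorm x * cell_ind (- half_width d k) d p x)%R))%E).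
  by apply: lee_sum => p _; exact: fnorm_mass.
rewrite -nint_sum; last 2 first.
- by move=> p; apply: measurable_funM; [exact: measurable_Fnorm|exact: measurable_cell_ind].
- by move=> p x; rewrite mulr_ge0 ?Fnorm_ge0 ?cell_ind_ge0.
apply: le_nint => x.
  by apply: sumr_ge0 => p _; rewrite mulr_ge0 ?Fnorm_ge0 ?cell_ind_ge0.
by rewrite -mulr_sumr sum_cell_ind// ler_piMr ?Fnorm_ge0// lern1 leq_b1.
Qed.

Lemma near_half_width (d K : R) : 0 < d -> \forall k \near \oo, K < half_width d k.
Proof.
move=> d0; exists (Num.truncn (2 * K / d)).+1 => // k /= hk.
rewrite /half_width ltr_pdivlMr// [K * 2]mulrC [d * _]mulrC -ltr_pdivrMr//.
apply: lt_le_trans (truncnS_gt _) _.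
by rewrite ler_nat; apply: leq_trans hk _; exact: ltnW (ltn_expl k _).
Qed.

Lemma near_trunc d (i : {tau : Tt & J tau}) e : 0 < d -> d <= t (projT2 i) -> 0 < e ->
  \forall k \near \oo, (nint (fun x => cmod (f (projT2 i) x -
     trunc (f (projT2 i)) (F (projT2 i)) (t (projT2 i)) C1 d k x)%R) <= e%:E)%E.
Proof.
move=> d0 dt e0; case: i dt => tau i /= dt.
have e2 : 0 < e / 2 by rewrite divr_gt0.
have [fm fiy] := fi i.
have [K1 K10 h1] := nint_tail (measurable_cmod fm) (fun x => cmod_ge0 (f i x)) fiy e2.
have e3 : 0 < e / (8 * C1) by rewrite divr_gt0// mulr_gt0.
have [K2 K20 h2] := nint_tail (mF i) (F0 i) (Fi i) e3.
near=> k.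
have hK1 : Num.max K1 K2 < half_width d k by near: k; exact: near_half_width.
have cm (g : R -> R) (K : R) : (forall x, 0 <= g x) -> K <= Num.max K1 K2 ->
    (nint (fun x => (g x * (1 - cutoff (Num.max K1 K2) x))%R) <=
     nint (fun x => (g x * (1 - cutoff K x))%R))%E.
  move=> g0 KK; apply: le_nint => x.
    by rewrite mulr_ge0// subr_ge0 cutoff_le1.
  by rewrite ler_wpM2l// lerB// cutoff_mono.
apply: le_trans (nint_trunc_le (mf i) (mF i) (F0 i) (Fi i) (t0 i) (ltW C10) d0 dt (fF i) hK1) _.
apply: (@le_trans _ _ ((e / 2)%:E + (4 * C1)%:E * (e / (8 * C1))%:E)%E).
  apply: leeD.
    apply: le_trans h1; apply: (cm (fun x => cmod (f i x))) => [x|].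
      exact: cmod_ge0.
    by rewrite le_max lexx.
  rewrite lee_wpmul2l ?lee_fin ?mulr_ge0 ?(ltW C10)//.
  apply: le_trans h2; apply: (cm (F i)) => //.
  by rewrite le_max lexx orbT.
rewrite -EFinM -EFinD lee_fin le_eqVlt; apply/orP; left; apply/eqP.
by field; rewrite gt_eqF.
Unshelve. all: by end_near. Qed.

(** The discretized estimate is applied to truncated data at height al / 2, on a grid so large that
    truncation moves the square function by at most al / 2 everywhere. In the constant, 2 comes from
    halving al and 3 C1 from [cell_mass]. *)
Lemma finite_weak_type (al : R) : 0 < al ->
  (al%:E * mu [set x | (al ^+ 2 < sqfun s A (@m) (@f) x)%R] <=
   (6 * C1 * @core_const R)%:E * nint Fnorm)%E.
Proof.
move=> al0.
have K0 : 0 < 6 * C1 * @core_const R.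
  by rewrite mulr_gt0 ?core_const_gt0// mulr_gt0.
have [Fy|Fy] := leP +oo%E (nint Fnorm).
  have -> : nint Fnorm = +oo%E by apply/eqP; rewrite eq_le leey Fy.
  by rewrite gt0_muley ?lte_fin// leey.
have [q q0 Eq] : exists2 q, 0 <= q & nint Fnorm = q%:E.
  have := nint_ge0 Fnorm_ge0; case: (nint Fnorm) Fy => [r|//|//] _ r0.
  by exists r => //; rewrite -lee_fin.
have [d d0 dt] := @exists_pos_lower _ (flat s A) (fun q => t (projT2 q))
  (fun q => t0 (projT2 q)).
pose W := wl2 s (fun=> 1) (fun tau => (size (A tau))%:R : R).
have W0 : 0 <= W by exact: wl2_ge0.
pose e := al / 2 / (1 + W).
have e0 : 0 < e by rewrite !divr_gt0// ltr_pwDl.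
(* k is large for two reasons: the grid average has to be at most twice the height al / 2, which
   rests on the finite integral of [Fnorm], and the truncation errors have to be uniformly small. *)
have sel : exists k : nat, (3 * C1 * q <= al * d * (2 ^ k)%:R) /\
    forall z : {tau : Tt & J tau}, z \in flat s A -> forall x,
     cmod (multiplier_op (m (projT2 z)) (f (projT2 z)) x -
      multiplier_op (m (projT2 z))
        (trunc (f (projT2 z)) (F (projT2 z)) (t (projT2 z)) C1 d k) x) <= e.
  near \oo => k; exists k; split.
    suff : 3 * C1 * q / al / 2 < half_width d k.
      rewrite /half_width ltr_pM2r ?invr_gt0// ltr_pdivrMr//; lra.
    by near: k; exact: near_half_width.
  have : forall z : {tau : Tt & J tau}, z \in flat s A -> d <= t (projT2 z) -> forall x,
     cmod (multiplier_op (m (projT2 z)) (f (projT2 z)) x -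
      multiplier_op (m (projT2 z))
        (trunc (f (projT2 z)) (F (projT2 z)) (t (projT2 z)) C1 d k) x) <= e.
    near: k; apply: near_seq => z.
    have [dz|dz] := leP d (t (projT2 z)); last first.
      by near=> k.
    have [K K0' mK] := hm_cutoff (hm (projT2 z)).
    have eK : 0 < e / (2 * K) by rewrite divr_gt0// mulr_gt0.
    have := near_trunc d0 dz eK; apply: filterS => k hk _ x.
    have nt : nice (trunc (f (projT2 z)) (F (projT2 z)) (t (projT2 z)) C1 d k).
      apply: nice_trunc => //; exact: ltW.
    rewrite -(multiplier_opB _ (hm (projT2 z)) (fi (projT2 z)) (nice_cintegrable nt)).
    have ci : cintegrable (fun y => f (projT2 z) y -
        trunc (f (projT2 z)) (F (projT2 z)) (t (projT2 z)) C1 d k y).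
      have := cintegrableD (fi (projT2 z)) (nice_cintegrable (niceN nt)).
      by [].
    rewrite -lee_fin.
    apply: le_trans (cmod_multiplier_op_le x (hm (projT2 z)) ci K0' mK) _.
    apply: le_trans (lee_wpmul2l _ hk) _; first by rewrite lee_fin mulr_ge0// ltW.
    by rewrite -EFinM lee_fin mulrC divfK// gt_eqF// mulr_gt0.
  by move=> h z zs; apply: h => //; exact: dt.
have {sel} [k [hk1 hk2]] := sel.
(* [core_weak_type] speaks of all indices, while d bounds from below only the scales in the finite
   list; the other indices receive the zero function and the scale d. *)
pose inF tau (i : J tau) := existT (fun tau => J tau : Type) tau i \in flat s A.
have inFP tau (i : J tau) : tau \in s -> i \in A tau -> inF tau i.
  by move=> ts iA; apply/allpairsPdep; exists tau, i.
pose f1 tau (i : J tau) := if inF tau i then trunc (f i) (F i) (t i) C1 d k else fun=> 0.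
pose t1 tau (i : J tau) := if inF tau i then t i else d.
pose v1 tau (i : J tau) := if inF tau i then cell_mass (F i) C1 d k else fun=> 0.
have cwt := @core_weak_type R Tt s J A (@m) (@S) (@xi0) N hm overlap f1 t1 v1
  (- half_width d k) d k.
have al2 : 0 < al / 2 by rewrite divr_gt0.
have nf1 tau (i : J tau) : nice (f1 tau i).
  rewrite /f1; case: ifPn => [h|_]; last exact: nice0.
  by apply: nice_trunc => //; [exact: ltW|exact: (dt _ h)].
have dt1 tau (i : J tau) : d <= t1 tau i.
  by rewrite /t1; case: ifPn => // h; exact: (dt _ h).
have v10 tau (i : J tau) p : 0 <= v1 tau i p.
  by rewrite /v1; case: ifPn => // h; apply: cell_mass_ge0 => //; exact: ltW.
have v1n tau (i : J tau) p : (2 ^ k <= p)%N -> v1 tau i p = 0.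
  by move=> kp; rewrite /v1; case: ifPn => // h; exact: cell_mass_out.
have fv1 tau (i : J tau) x :
    cmod (f1 tau i x) <= majorant (t1 tau i) (- half_width d k) d (2 ^ k) (v1 tau i) x.
  rewrite /f1 /t1 /v1; case: ifPn => h.
    by apply: cmod_trunc => //; exact: ltW.
  by rewrite cmod0; apply: majorant_ge0.
have cn : \sum_(p <- iota 0 (2 ^ k)) cell_norm s A N v1 p <= 3 * C1 * q.
  have := sum_fnorm_mass k d0; rewrite Eq lee_fin => h.
  have C3 : 0 <= 3 * C1 by rewrite mulr_ge0// ltW.
  apply: le_trans (ler_wpM2l C3 h); rewrite mulr_sumr; apply: ler_sum => p _.
  rewrite -wl2Z//; apply: ler_wl2 => [z|[tau i] /=]; first exact: N0.
  have m0 : 0 <= mass (F i) d k p by apply: mass_ge0 => //; exact: F0.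
  apply: (@le_trans _ _ (v1 tau i p)); first by rewrite ger0_norm.
  apply: le_trans (ler_norm _).
  rewrite /v1; case: ifPn => _; last by rewrite mulr_ge0.
  by rewrite /cell_mass; case: ifP => // _; rewrite mulr_ge0.
have hG : \sum_(p <- iota 0 (2 ^ k)) cell_norm s A N v1 p <= 2 * (al / 2 * d) * (2 ^ k)%:R.
  by apply: le_trans cn _; apply: le_trans hk1 _; rewrite le_eqVlt; apply/orP; left; apply/eqP; field.
have := cwt nf1 d0 dt1 v10 v1n fv1 (al / 2) al2 hG => {}cwt.
have sub : [set x | (al ^+ 2 < sqfun s A (@m) (@f) x)%R] `<=`
    [set x | ((al / 2) ^+ 2 < sqfun s A (@m) f1 x)%R].
  move=> x /= h.
  have p1 := @sqfun_perturb (@f) f1 x e (ltW e0).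
  have {}p1 : Num.sqrt (sqfun s A (@m) (@f) x) <= Num.sqrt (sqfun s A (@m) f1 x) + e * W.
    apply: p1 => tau i ts iA; have iF := inFP _ _ ts iA.
    by rewrite /f1 iF; exact: (hk2 _ iF x).
  have a1 : al < Num.sqrt (sqfun s A (@m) (@f) x).
    rewrite -(@ltr_pXn2r _ 2)// ?nnegrE ?sqrtr_ge0 ?(ltW al0)//.
    by rewrite sqr_sqrtr// sqfun_ge0.
  have a2 : e * W <= al / 2.
    rewrite /e mulrAC ler_pdivrMr ?ltr_pwDl// ler_wpM2l ?(ltW al2)// lerDr//.
  have a3 : al / 2 < Num.sqrt (sqfun s A (@m) f1 x) by exact: half_lt a1 p1 a2.
  by rewrite -(sqr_sqrtr (sqfun_ge0 s A (@m) f1 x)) ltr_pXn2r ?nnegrE ?sqrtr_ge0 ?(ltW al2).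
have ms (g : forall tau, J tau -> R -> R[i]) (a : R) :
    (forall tau i, cintegrable (g tau i)) ->
    measurable [set x | (a < sqfun s A (@m) g x)%R].
  move=> gi; have mg := measurable_sqfun s A hm gi.
  rewrite (_ : [set x | _] = sqfun s A (@m) g @^-1` `]a, +oo[%classic).
    by rewrite -[X in measurable X]setTI; exact: mg.
  by apply/seteqP; split => x /=; rewrite in_itv/= andbT.
apply: (@le_trans _ _ (al%:E * mu [set x | ((al / 2) ^+ 2 < sqfun s A (@m) f1 x)%R])%E).
  apply: lee_wpmul2l; first by rewrite lee_fin ltW.
  apply: le_measure; last exact: sub.
  - by rewrite inE; apply: ms; exact: fi.
  - by rewrite inE; apply: ms => tau i; exact: nice_cintegrable.
apply: (@le_trans _ _ (2%:E * (@core_const R * \sum_(p <- iota 0 (2 ^ k)) cell_norm s A N v1 p)%:E)%E).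
  have -> : al%:E = (2%:E * (al / 2)%:E)%E by rewrite -EFinM; congr EFin; field.
  by rewrite -muleA; apply: lee_wpmul2l => //; rewrite lee_fin.
rewrite Eq -!EFinM lee_fin.
have h := ler_wpM2l (ler0n R 2) (ler_wpM2l (ltW core_const_gt0) cn).
by apply: le_trans h _; rewrite le_eqVlt; apply/orP; left; apply/eqP; ring.
Unshelve. all: by end_near. Qed.

End FiniteFamilies.

(** * Mihlin multipliers *)

Section HormanderMihlin.
Context {R : realType}.
Local Notation mu := (@lebesgue_measure R).
Implicit Types (m f : R -> R[i]) (g : R -> R).

Lemma measurable_continuous_off g (c : R) :
  (forall x, x != c -> {for x, continuous g}) -> measurable_fun setT g.
Proof.
move=> cg; have m1 : measurable [set c] by exact: measurable_set1.
rewrite -(setUv [set c]); apply/measurable_funU => //; first exact: measurableC.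
split; first exact: measurable_fun_set1.
apply: open_continuous_measurable_fun; first exact/closed_openC/closed_eq.
by move=> x; rewrite inE /= => /eqP; exact: cg.
Qed.

(** Between y and y + h the distance to 0 stays at least |y| / 2, so the derivative is at most 2 /
    |y| there and the mean value theorem applies. *)
Lemma norm_increment_le g (y h : R) :
  (forall x : R, x != 0 -> derivable g x 1) ->
  (forall x : R, x != 0 -> `|x| * `|derive1 g x| <= 1) ->
  2 * `|h| <= `|y| -> `|g (y + h) - g y| <= 2 * `|h| / `|y|.
Proof.
move=> dg bg hy.
have [->|h0] := eqVneq h 0; first by rewrite addr0 subrr !normr0 mulr0 mul0r.
have hp : 0 < `|h| by rewrite normr_gt0.
have yp : 0 < `|y| by lra.
pose a := Num.min y (y + h); pose b := Num.max y (y + h).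
have ab : a < b.
  rewrite /a /b; case: (ltP y (y + h)) => // k; rewrite lt_neqAle k andbT.
  by rewrite -subr_eq0 addrAC subrr add0r.
have ba : b - a = `|h|.
  rewrite /a /b; case: (ltP y (y + h)) => k.
    by rewrite gtr0_norm; lra.
  by rewrite ler0_norm; lra.
have gab : `|g (y + h) - g y| = `|g b - g a|.
  by rewrite /a /b; case: (ltP y (y + h)) => // k; rewrite distrC.
have far c : a <= c <= b -> `|y| <= 2 * `|c|.
  move=> /andP[ac cb].
  have yc : `|y - c| <= `|h|.
    rewrite -ba ler_norml; move: ac cb; rewrite /a /b.
    by case: (ltP y (y + h)) => k; lra.
  have := ler_normD (y - c) c; rewrite subrK; lra.
have nz c : a <= c <= b -> c != 0.
  by move=> /far; rewrite -normr_gt0; lra.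
have [c cab E] : exists2 c, c \in `]a, b[%R & g b - g a = derive1 g c * (b - a).
  apply: MVT => // [x|].
    rewrite in_itv/= => /andP[h1 h2].
    rewrite derive1E; apply: DeriveDef => //; apply: dg; apply: nz; by rewrite !ltW.
  apply: derivable_within_continuous => x; rewrite in_itv/= => hx; apply: dg; exact: nz.
have cc : a <= c <= b by move: cab; rewrite in_itv/= => /andP[h1 h2]; rewrite !ltW.
rewrite gab E ba normrM normr_id ler_pdivlMr//.
have := bg c (nz c cc); have := far c cc.
have := normr_ge0 (derive1 g c).
set u := `|derive1 g c|; set v := `|c| => u0 k1 k2.
have : u * `|y| <= 2 by apply: le_trans (ler_wpM2l u0 k1) _; rewrite mulrCA [u * v]mulrC; lra.
by move=> k; rewrite mulrAC ler_pM2r.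
Qed.

(** The norm leaves the value at [xi0] arbitrary; [m'] has the value 0 there, and one point does not
    affect the operator. The 4 in the increment bound is 2 for each of the real and imaginary
    parts. *)
Lemma hm_mult_of_HM m (I : interval R) (xi0 : R) : bounded_set [set` I] ->
  (forall xi, xi \notin I -> m xi = 0) ->
  HM_multiplier (fun xi => m (xi + xi0)) ->
  (HM_norm (fun xi => m (xi + xi0)%R) <= 1)%E ->
  cmeasurable m /\ exists2 m', hm_mult m' [set` I] xi0 &
    forall xi, xi != xi0 -> m' xi = m xi.
Proof.
move=> bI sm [dm _] nm.
pose n xi := m (xi + xi0).
have bnd j xi : (j <= 1)%N -> xi != 0 -> `|xi| ^+ j * cmod (cderive j n xi) <= 1.
  move=> j1 xi0'; rewrite -lee_fin; apply: le_trans nm.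
  by apply: ereal_sup_ubound; exists j, xi.
have mn : cmeasurable n.
  split; apply: (@measurable_continuous_off _ 0) => x x0;
    apply: differentiable_continuous; apply/derivable1_diffP; by case: (dm x x0).
have mm : cmeasurable m.
  have -> : m = (fun xi => n (xi - xi0)) by apply/funext => xi; rewrite /n subrK.
  by apply: cmeasurable_comp => //; meas.
split => //; exists (fun xi => real_complex R (\1_(~` [set xi0]) xi) * m xi); last first.
  move=> xi h; rewrite indicE mem_set /=; last exact/eqP.
  by rewrite rmorph1 mul1r.
have m'E xi : xi != xi0 -> real_complex R (\1_(~` [set xi0]) xi) * m xi = m xi.
  by move=> h; rewrite indicE mem_set /=; [rewrite rmorph1 mul1r|exact/eqP].
have m'0 : real_complex R (\1_(~` [set xi0]) xi0) * m xi0 = 0.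
  by rewrite indicE memNset; [rewrite rmorph0 mul0r|move=> /= h; apply: h].
split.
- apply: cmeasurableM => //; apply: cmeasurable_real.
  by apply: measurable_indic; apply: measurableC; exact: measurable_set1.
- by move=> xi /= h; rewrite sm ?mulr0//; apply/negP.
- move=> xi; have [->|h] := eqVneq xi xi0; first by rewrite m'0 cmod0.
  rewrite m'E//.
  have := bnd 0%N (xi - xi0) isT; rewrite subr_eq0 => /(_ h).
  rewrite expr0 mul1r; apply: le_trans; rewrite /cderive /= /n subrK.
  by case: (m xi).
- have [M [_ hM]] := bI.
  exists (Num.max M 0 + 1); first by rewrite ltr_wpDl// le_max lexx orbT.
  by move=> xi /= xiI; apply: hM xiI; rewrite ltr_pwDr// le_max lexx.
- move=> xi h hxi.
  have [E|nE] := eqVneq xi xi0.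
    have -> : h = 0.
      by move: hxi; rewrite E subrr normr0 pmulr_rle0// normr_le0 => /eqP.
    by rewrite addr0 subrr cmod0 !normr0 mulr0 mul0r.
  have nE2 : xi + h != xi0.
    apply/negP => /eqP E; move: hxi; rewrite -E (_ : xi - (xi + h) = - h); last by ring.
    move=> hh; have h0 : h = 0.
      by apply/eqP; rewrite -normr_le0; rewrite normrN in hh; lra.
    by move: E nE; rewrite h0 addr0 => ->; rewrite eqxx.
  rewrite !m'E//; apply: le_trans (cmod_le_Re_Im _) _.
  have E1 (z w : R[i]) : complex.Re (z - w) = complex.Re z - complex.Re w by case: z; case: w.
  have E2 (z w : R[i]) : complex.Im (z - w) = complex.Im z - complex.Im w by case: z; case: w.
  rewrite E1 E2.
  pose rr (p : R[i] -> R) (x : R) := p (n x).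
  have key p : (forall x, x != 0 -> derivable (rr p) x 1) ->
      (forall x, x != 0 -> `|x| * `|derive1 (rr p) x| <= 1) ->
      `|p (m (xi + h)) - p (m xi)| <= 2 * `|h| / `|xi - xi0|.
    move=> d1 d2; have := norm_increment_le d1 d2 hxi.
    by rewrite /rr /n subrK addrAC subrK.
  have -> : 4 * `|h| / `|xi - xi0| = 2 * `|h| / `|xi - xi0| + 2 * `|h| / `|xi - xi0|.
    by rewrite -mulrDl -mulrDl; congr (_ * _ / _); ring.
  apply: lerD; apply: key => x x0.
  + by case: (dm x x0).
  + apply: le_trans (bnd 1%N x isT x0); rewrite expr1 ler_wpM2l//.
    exact: (normRe_le_cmod (cderive 1 n x)).
  + by case: (dm x x0).
  + apply: le_trans (bnd 1%N x isT x0); rewrite expr1 ler_wpM2l//.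
    exact: (normIm_le_cmod (cderive 1 n x)).
Qed.

Lemma eq_multiplier_op m m' f (c : R) : cmeasurable m -> cmeasurable m' ->
  cintegrable f -> (forall xi, xi != c -> m' xi = m xi) ->
  multiplier_op m f = multiplier_op m' f.
Proof.
move=> mm mm' fi h; apply/funext => x; apply: (@ae_eq_cintegral _ _ _ c).
- apply: cmeasurableM; last by apply: cmeasurable_expi; meas.
  by apply: cmeasurableM => //; exact: measurable_fourier.
- apply: cmeasurableM; last by apply: cmeasurable_expi; meas.
  by apply: cmeasurableM => //; exact: measurable_fourier.
- by move=> xi xic; rewrite h.
Qed.

End HormanderMihlin.

(** * Limits of partial sums *)

Section LimitsInMeasure.
Context {R : realType}.
Local Notation mu := (@lebesgue_measure R).

Lemma sum_fsetD (J : choiceType) (V : nmodType) (A C : {fset J}) (h : J -> V) :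
  fsubset A C ->
  \sum_(i <- C) h i = \sum_(i <- A) h i + \sum_(i <- fsetD C A) h i.
Proof.
move=> AC; rewrite (big_fsetID _ (mem A)) /=; congr (_ + _).
  by rewrite (_ : [fset x in C | _]%fset = A)//; apply/fsetP => i;
    rewrite !inE /= andb_idl// => /(fsubsetP AC).
by rewrite (_ : [fset x in C | _]%fset = fsetD C A)//; apply/fsetP => i;
    rewrite !inE /= andbC.
Qed.

Lemma measurable_gt (h : R -> R) (a : R) : measurable_fun setT h ->
  measurable [set x | (a < h x)%R].
Proof.
move=> mh; rewrite (_ : [set x | _] = h @^-1` `]a, +oo[%classic).
  by rewrite -[X in measurable X]setTI; exact: mh.
by apply/seteqP; split => x /=; rewrite in_itv/= andbT.
Qed.

Lemma cvge0P (K : Type) (G : set_system K) (u : K -> \bar R) : Filter G ->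
  (forall k, 0 <= u k)%E ->
  (forall e : R, 0 < e -> \forall k \near G, (u k <= e%:E)%E) <->
  u @ G --> 0%E.
Proof.
move=> FG u0; split => [h|].
  apply/fine_cvgP; split.
    apply: filterS (h 1 ltr01) => k hk.
    by rewrite ge0_fin_numE//; apply: le_lt_trans hk (ltry _).
  apply/cvgr0Pnorm_le => e e0; apply: filterS (h e e0) => k hk /=.
  have uf : u k \is a fin_num.
    by rewrite ge0_fin_numE//; apply: le_lt_trans hk (ltry _).
  by rewrite ger0_norm ?fine_ge0// -lee_fin fineK.
move=> /fine_cvgP[uf /cvgr0Pnorm_le h] e e0.
near=> k.
have ufk : u k \is a fin_num by near: k.
have : `|fine (u k)| <= e by near: k; exact: h.
by rewrite ger0_norm ?fine_ge0// -lee_fin fineK.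
Unshelve. all: by end_near. Qed.

Lemma limn_esup_near (u : nat -> R) n (r : R) :
  (forall k, (n <= k)%N -> `|u k - u n| <= r) ->
  `|fine (limn_esup (EFin \o u)) - u n| <= r.
Proof.
move=> h; set l := limn_esup _.
have hk k : (n <= k)%N -> u n - r <= u k <= u n + r.
  by move=> /h; rewrite ler_norml => /andP[]; lra.
have l1 : (l <= (u n + r)%:E)%E.
  rewrite /l limn_esup_lim (cvg_lim _ (@cvg_esups_inf _ _))//.
  apply: (@le_trans _ _ (esups (EFin \o u) n)); first by apply: ereal_inf_lbound; exists n.
  by apply: ge_ereal_sup => _ [k /= nk <-]; rewrite lee_fin; have /andP[] := hk k nk.
have l2 : ((u n - r)%:E <= l)%E.
  rewrite /l limn_esup_lim (cvg_lim _ (@cvg_esups_inf _ _))//.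
  apply: le_ereal_inf_tmp => _ [k _ <-].
  apply: (@le_trans _ _ (u (maxn n k))%:E).
    by rewrite lee_fin; have /andP[] := hk _ (leq_maxl n k).
  by apply: ereal_sup_ubound; exists (maxn n k) => //=; exact: leq_maxr.
have lf : l \is a fin_num.
  by rewrite fin_numElt (lt_le_trans (ltNyr _) l2) (le_lt_trans l1 (ltry _)).
rewrite ler_norml; move: l1 l2; rewrite -(fineK lf) !lee_fin; lra.
Qed.

Lemma sum_half_pow n k : (n <= k)%N ->
  \sum_(n <= j < k) (2^-1 : R) ^+ j <= 2 * 2^-1 ^+ n.
Proof.
move=> nk; suff -> : \sum_(n <= j < k) (2^-1 : R) ^+ j = 2 * 2^-1 ^+ n - 2 * 2^-1 ^+ k.
  by rewrite gerBl mulr_ge0// exprn_ge0.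
elim: k nk => [|k ih]; first by rewrite leqn0 => /eqP->; rewrite big_geq// subrr.
rewrite leq_eqVlt => /predU1P[->|]; first by rewrite big_geq// subrr.
by rewrite ltnS => nk; rewrite big_nat_recr//= ih// exprS; field.
Qed.

Variables (h : nat -> R -> R[i]) (mh : forall n, cmeasurable (h n)).

(** Upper limits made finite by [fine] are measurable without any convergence; at points that escape
    all late [jump] sets this is the limit. *)
Definition seq_limit x : R[i] :=
  (fine (limn_esup (fun n => (complex.Re (h n x))%:E)) +i*
   fine (limn_esup (fun n => (complex.Im (h n x))%:E)))%C.

Lemma measurable_seq_limit : cmeasurable seq_limit.
Proof.
split; rewrite /seq_limit /=.
  apply: (@measurableT_comp _ _ _ _ _ _ (@fine R)); first exact: fine_measurable.
  apply: measurable_fun_limn_esup => n.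
  by apply/measurable_EFinP; case: (mh n).
apply: (@measurableT_comp _ _ _ _ _ _ (@fine R)); first exact: fine_measurable.
  apply: measurable_fun_limn_esup => n.
by apply/measurable_EFinP; case: (mh n).
Qed.

Definition jump n : set R := [set x | (2^-1 ^+ n < cmod (h n.+1 x - h n x))%R].

Lemma measurable_jump n : measurable (jump n).
Proof. by apply: measurable_gt; apply: measurable_cmod; exact: cmeasurableB. Qed.

Lemma seq_limit_near n x : (forall k, (n <= k)%N -> ~ jump k x) ->
  cmod (h n x - seq_limit x) <= 4 * 2^-1 ^+ n.
Proof.
move=> nj.
have nj' k : (n <= k)%N -> cmod (h k.+1 x - h k x) <= 2^-1 ^+ k.
  by move=> /nj /negP; rewrite -leNgt.
have hk k : (n <= k)%N -> cmod (h k x - h n x) <= 2 * 2^-1 ^+ n.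
  move=> nk; apply: le_trans (sum_half_pow nk).
  elim: k nk => [|k ih]; first by rewrite leqn0 => /eqP->; rewrite big_geq// subrr cmod0.
  rewrite leq_eqVlt => /predU1P[->|]; first by rewrite big_geq// subrr cmod0.
  rewrite ltnS => nk; rewrite big_nat_recr//=.
  have -> : h k.+1 x - h n x = (h k x - h n x) + (h k.+1 x - h k x) by ring.
  by apply: le_trans (cmodD _ _) _; rewrite lerD ?ih ?nj'.
have key (p : R[i] -> R) : (forall z w, `|p z - p w| <= cmod (z - w)) ->
    `|p (h n x) - fine (limn_esup (fun n => (p (h n x))%:E))| <= 2 * 2^-1 ^+ n.
  move=> hp; rewrite distrC; apply: (@limn_esup_near (fun n => p (h n x))) => k nk.
  exact: le_trans (hp _ _) (hk k nk).
apply: le_trans (cmod_le_Re_Im _) _.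
have -> : 4 * 2^-1 ^+ n = 2 * 2^-1 ^+ n + 2 * 2^-1 ^+ n :> R by ring.
have kR := key (fun z => complex.Re z); have kI := key (fun z => complex.Im z).
rewrite /seq_limit; move: kR kI; case: (h n x) => a b /= kR kI.
apply: lerD.
  by apply: kR => z w; have := normRe_le_cmod (z - w); case: z; case: w.
by apply: kI => z w; have := normIm_le_cmod (z - w); case: z; case: w.
Qed.

Hypothesis jump_small : forall n, (mu (jump n) <= (2^-1 ^+ n)%:E)%E.

(** Quantitative Borel-Cantelli: the jumps from n on have a union of measure at most 2 2^(-n), and
    off it the distance to the limit is at most 4 2^(-n). *)
Lemma seq_limit_measure n (e : R) : 4 * 2^-1 ^+ n <= e ->
  (mu [set x | (e < cmod (h n x - seq_limit x))%R] <= (2 * 2^-1 ^+ n)%:E)%E.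
Proof.
move=> ne; pose U := \bigcup_k jump (n + k).
have mU : measurable U by apply: bigcup_measurable => k _; exact: measurable_jump.
apply: (@le_trans _ _ (mu U)).
  apply: le_measure; rewrite ?inE//.
    apply: measurable_gt; apply: measurable_cmod; apply: cmeasurableB => //.
    exact: measurable_seq_limit.
  move=> x /= hx; apply: contrapT => nU.
  move: hx; apply/negP; rewrite -leNgt; apply: le_trans ne.
  apply: seq_limit_near => k nk jk; apply: nU; exists (k - n)%N => //.
  by rewrite subnKC.
apply: (@le_trans _ _ (\sum_(k <oo) mu (jump (n + k)))%E).
  by apply: measure_sigma_subadditive => // k; exact: measurable_jump.
apply: lime_le.
  by apply: is_cvg_nneseries => k _ _; exact: measure_ge0.
near=> k.
apply: (@le_trans _ _ (\sum_(0 <= j < k) (2^-1 ^+ (n + j))%:E)%E).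
  by apply: lee_sum => j _; exact: jump_small.
rewrite sumEFin lee_fin; apply: le_trans (sum_half_pow (leq_addr k n)).
have -> : \sum_(n <= j < n + k) (2^-1 : R) ^+ j = \sum_(0 <= j < k) 2^-1 ^+ (n + j).
  by rewrite -{1}[n]add0n big_addn addKn; apply: eq_bigr => j _; rewrite addnC.
by [].
Unshelve. all: by end_near. Qed.

End LimitsInMeasure.

(** * Convergence in measure of infinite sums *)

Section UnconditionalSum.
Context {R : realType}.
Local Notation mu := (@lebesgue_measure R).
Variables (J : choiceType) (T : J -> R -> R[i]) (F : J -> R -> R) (w K rho : R).
Hypothesis mT : forall i, cmeasurable (T i).
Hypothesis mF : forall i, measurable_fun setT (F i).
Hypothesis w0 : 0 <= w.
Hypothesis K0 : 0 < K.

Definition l2sum (B : {fset J}) x : R := Num.sqrt (w * \sum_(i <- B) F i x ^+ 2).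

Hypothesis weak_type : forall (B : {fset J}) (al : R), 0 < al ->
  (al%:E * mu [set x | (al < cmod (\sum_(i <- B) T i x))%R] <= K%:E * nint (l2sum B))%E.
Hypothesis l2sum_le : forall B, (nint (l2sum B) <= rho%:E)%E.

Lemma l2sum_ge0 B x : 0 <= l2sum B x. Proof. exact: sqrtr_ge0. Qed.

Lemma measurable_l2sum B : measurable_fun setT (l2sum B).
Proof.
apply: measurable_sqrt; apply: measurable_funM; first exact: measurable_cst.
by apply: measurable_sum => i; exact: measurable_funX.
Qed.

Let q B := fine (nint (l2sum B)).

Let qE B : nint (l2sum B) = (q B)%:E.
Proof.
rewrite /q fineK// ge0_fin_numE ?nint_ge0//; last by move=> x; exact: l2sum_ge0.
by apply: le_lt_trans (l2sum_le B) (ltry _).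
Qed.

(** From b^2 = (s - a)(s + a) <= 2 s (s - a) and AM-GM, b <= de s + (s - a) / (2 de). Being linear
    in b, a and s, this can be integrated. *)
Let arith (de s a b : R) : 0 < de -> 0 <= a -> a <= s -> 0 <= b ->
  b ^+ 2 = s ^+ 2 - a ^+ 2 -> b + (2 * de)^-1 * a <= (de + (2 * de)^-1) * s.
Proof.
move=> de0 a0 as_ b0 E.
rewrite -lerBrDr (_ : _ - _ = de * s + (s - a) / (2 * de)); last first.
  by field; rewrite gt_eqF.
have s0 : 0 <= s by exact: le_trans as_.
have X0 : 0 <= de * s by rewrite mulr_ge0// ltW.
have Y0 : 0 <= (s - a) / (2 * de) by rewrite divr_ge0 ?subr_ge0// mulr_ge0// ltW.
rewrite -(@ler_pXn2r _ 2)// ?nnegrE ?addr_ge0// E.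
have k : 4 * (de * s) * ((s - a) / (2 * de)) = 2 * s * (s - a).
  by field; rewrite gt_eqF.
have := sqr_ge0 (de * s - (s - a) / (2 * de)).
move: k; set X := de * s; set Y := (s - a) / (2 * de) => k h.
have p := sqr_ge0 (s - a).
have -> : (X + Y) ^+ 2 = (X - Y) ^+ 2 + 4 * X * Y by ring.
have -> : s ^+ 2 - a ^+ 2 = 2 * s * (s - a) - (s - a) ^+ 2 by ring.
by rewrite k; move: h p; set u := (X - Y) ^+ 2; set v := (s - a) ^+ 2; set z := 2 * s * _; lra.
Qed.

(* If A nearly maximizes the integral of [l2sum], the L^2-orthogonality
   b^2 = s^2 - a^2 forces the sums over sets disjoint from A to be small. *)
Lemma l2sum_tail (eta : R) : 0 < eta ->
  exists A, forall B, fdisjoint A B -> (nint (l2sum B) <= eta%:E)%E.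
Proof.
move=> eta0; pose E := range q.
have r0 : 0 <= rho.
  by rewrite -lee_fin; apply: le_trans (l2sum_le fset0); apply: nint_ge0 => x; exact: l2sum_ge0.
have hsE : has_sup E.
  split; first by exists (q fset0), fset0.
  by exists rho => _ [B _ <-]; rewrite -lee_fin -qE.
pose M := sup E.
have qM B : q B <= M by apply: sup_upper_bound => //; exists B.
have M0 : 0 <= M.
  by apply: le_trans (qM fset0); rewrite -lee_fin -qE; apply: nint_ge0 => x; exact: l2sum_ge0.
(* Chosen so that de M <= eta / 2; the defect eta de from the supremum then costs the other eta /
   2. *)
pose de := eta / (2 * (M + 1)).
have de0 : 0 < de by rewrite divr_gt0// mulr_gt0// ltr_wpDl.
have ep0 : 0 < eta * de by rewrite mulr_gt0.
have [_ [A _ <-] hA] := sup_adherent ep0 hsE; rewrite -/M in hA.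
exists A => B AB.
rewrite qE lee_fin.
pose C := fsetU A B.
have CA : fsetD C A = B.
  apply/fsetP => i; rewrite !inE; have [iA|//] := boolP (i \in A) => /=.
  by apply/esym/negbTE; move/fdisjointP: AB => /(_ i iA).
have AC : fsubset A C by exact: fsubsetUl.
have c0 : 0 <= (2 * de)^-1 by rewrite invr_ge0 mulr_ge0// ltW.
have pw x : l2sum B x + (2 * de)^-1 * l2sum A x <= (de + (2 * de)^-1) * l2sum C x.
  have ss (D : {fset J}) : 0 <= w * \sum_(i <- D) F i x ^+ 2.
    by rewrite mulr_ge0// sumr_ge0// => i _; exact: sqr_ge0.
  have S : \sum_(i <- C) F i x ^+ 2 = \sum_(i <- A) F i x ^+ 2 + \sum_(i <- B) F i x ^+ 2.
    by rewrite (sum_fsetD _ AC) CA.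
  apply: arith => //; rewrite ?l2sum_ge0//.
    by apply: ler_wsqrtr; rewrite S mulrDr lerDl.
  by rewrite !sqr_sqrtr// S; ring.
have := le_nint (fun x => addr_ge0 (l2sum_ge0 B x) (mulr_ge0 c0 (l2sum_ge0 A x))) pw.
rewrite nintD; [|exact: measurable_l2sum| | |]; last 3 first.
- by apply: measurable_funM; [exact: measurable_cst|exact: measurable_l2sum].
- by move=> x; exact: l2sum_ge0.
- by move=> x; rewrite mulr_ge0// l2sum_ge0.
have z (D : {fset J}) c : 0 <= c -> nint (fun x => c * l2sum D x) = (c * q D)%:E.
  move=> hc; rewrite EFinM -qE; apply: nintZ => //; first exact: measurable_l2sum.
  by move=> x; exact: l2sum_ge0.
rewrite !z ?qE// ?addr_ge0// ?(ltW de0)// -EFinD lee_fin => h.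
have h2 : (de + (2 * de)^-1) * q C <= (de + (2 * de)^-1) * M.
  by rewrite ler_wpM2l// addr_ge0// ltW.
have h3 : (2 * de)^-1 * (M - q A) <= (2 * de)^-1 * (eta * de).
  by rewrite ler_wpM2l//; lra.
have h4 : (2 * de)^-1 * (eta * de) = eta / 2 by field; rewrite gt_eqF.
have h5 : de * M <= eta / 2.
  have -> : eta / 2 = de * (M + 1) by rewrite /de; field; rewrite gt_eqF// ltr_wpDl.
  by apply: ler_wpM2l; [exact: ltW|rewrite lerDl].
lra.
Qed.

(** [l2sum_tail] and the weak type bound give increasing finite sets A n such that a finite sum
    disjoint from A n exceeds a height al only on measure 4^(-n) / al. Consecutive partial sums then
    have small jumps, and the sum over any finite set containing A n stays close to their limit. *)
Theorem ex_sums_to : exists g, sums_to T g.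
Proof.
have ex n : exists A : {fset J}, forall B, fdisjoint A B ->
    (nint (l2sum B) <= ((2^-1 ^+ n * 2^-1 ^+ n) / K)%:E)%E.
  by apply: l2sum_tail; rewrite divr_gt0// mulr_gt0// exprn_gt0.
pose A0 n := projT1 (cid (ex n)).
pose A n := (\big[@fsetU J/fset0]_(k <- iota 0 n.+1) A0 k)%fset.
have AS n : A n.+1 = fsetU (A n) (A0 n.+1).
  by rewrite /A -[in iota 0 n.+2]addn1 iotaD big_cat /= big_seq1 add0n.
have A0A n : fsubset (A0 n) (A n).
  rewrite /A -addn1 iotaD big_cat /= big_seq1 add0n; exact: fsubsetUr.
have tail n B : fdisjoint (A n) B ->
    (nint (l2sum B) <= ((2^-1 ^+ n * 2^-1 ^+ n) / K)%:E)%E.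
  move=> AB; apply: (projT2 (cid (ex n))); apply: fdisjointWl AB; exact: A0A.
have wt n B (al : R) : 0 < al -> fdisjoint (A n) B ->
    (mu [set x | (al < cmod (\sum_(i <- B) T i x))%R] <=
     (2^-1 ^+ n * 2^-1 ^+ n / al)%:E)%E.
  move=> al0 AB; rewrite -(@lee_pmul2l _ al%:E)//; apply: le_trans (weak_type B al0) _.
  apply: le_trans (lee_wpmul2l _ (tail n B AB)) _; first by rewrite lee_fin ltW.
  by rewrite -!EFinM lee_fin le_eqVlt; apply/orP; left; apply/eqP; field; rewrite !gt_eqF.
pose h n x := \sum_(i <- A n) T i x.
have mh n : cmeasurable (h n) by exact: cmeasurable_sum.
have e0 n : 0 < 2^-1 ^+ n :> R by rewrite exprn_gt0.
have js n : (mu (jump h n) <= (2^-1 ^+ n)%:E)%E.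
  have -> : jump h n = [set x | (2^-1 ^+ n < cmod (\sum_(i <- fsetD (A n.+1) (A n)) T i x))%R].
    rewrite /jump /h; apply/seteqP; split => x /=;
    by rewrite (@sum_fsetD _ _ (A n) (A n.+1)) ?AS ?fsubsetUl// addrAC subrr add0r.
  apply: le_trans (wt n _ _ (e0 n) _) _.
    by apply/fdisjointP => i iA; rewrite inE iA.
  by rewrite lee_fin mulfK// gt_eqF.
have mg := measurable_seq_limit mh.
exists (seq_limit h); split => //.
have FT : Filter (@totally J) by exact: (@filter_filter _ _ (totally_filter)).
move=> e eps0; apply/cvge0P => // de de0.
pose b : R := Num.min (e / 8) (Num.min (de / 4) (de * e / 4)).
have [n hn] : exists n, 2^-1 ^+ n < Num.min b 1.
  have b0 : 0 < Num.min b 1.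
    by rewrite !lt_min ltr01 andbT !divr_gt0// mulr_gt0.
  have : (fun n => (2^-1 : R) ^+ n) @ \oo --> 0.
    by apply: cvg_expr; rewrite ger0_norm// invf_lt1// ltr1n.
  move=> /cvgr0Pnorm_lt /(_ _ b0) [n _ hn]; exists n.
  by have := hn n (leqnn n); rewrite /= ger0_norm// ltW.
move: hn; rewrite !lt_min => /andP[/and3P[n1 n2 n3] n4].
exists (A n) => //= B AB.
pose D := fsetD B (A n).
apply: (@le_trans _ _ (mu ([set x | (e / 2 < cmod (\sum_(i <- D) T i x))%R] `|`
    [set x | (e / 2 < cmod (h n x - seq_limit h x))%R]))).
  have mD : cmeasurable (fun x => \sum_(i <- D) T i x) by exact: cmeasurable_sum.
  apply: le_measure; rewrite ?inE.
  - apply: measurable_gt; apply: measurable_cmod; apply: cmeasurableB => //.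
    exact: cmeasurable_sum.
  - apply: measurableU; apply: measurable_gt; apply: measurable_cmod => //.
    exact: cmeasurableB.
  - move=> x /=; rewrite (sum_fsetD _ AB) -/(h n x) -/D => hx.
    have [h1|h1] := ltP (e / 2) (cmod (\sum_(i <- D) T i x)); [by left|right].
    move: hx; set u := \sum_(i <- D) _ in h1 *; set v := seq_limit h x.
    have -> : h n x + u - v = u + (h n x - v) by ring.
    move=> /lt_le_trans /(_ (cmodD _ _)); lra.
have mD : measurable [set x | (e / 2 < cmod (\sum_(i <- D) T i x))%R].
  by apply: measurable_gt; apply: measurable_cmod; exact: cmeasurable_sum.
have mG : measurable [set x | (e / 2 < cmod (h n x - seq_limit h x))%R].
  by apply: measurable_gt; apply: measurable_cmod; exact: cmeasurableB.
apply: le_trans (measureU2 mu mD mG) _.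
have -> : de%:E = ((de / 2)%:E + (de / 2)%:E)%E by rewrite -EFinD; congr EFin; lra.
apply: leeD.
  apply: le_trans (wt n D _ _ _) _.
  - by rewrite divr_gt0.
  - by apply/fdisjointP => i iA; rewrite inE iA.
  rewrite lee_fin ler_pdivrMr ?divr_gt0//.
  have : 2^-1 ^+ n * 2^-1 ^+ n <= 2^-1 ^+ n :> R by rewrite ler_piMr// ltW.
  lra.
apply: le_trans (seq_limit_measure mh js _) _; first by lra.
by rewrite lee_fin; lra.
Qed.

End UnconditionalSum.

(** * Passage to the limit in the square function *)

Section SquareFunctionOfLimits.
Context {R : realType}.
Local Notation mu := (@lebesgue_measure R).

Lemma sum_le_esum (J : choiceType) (s : seq J) (h : J -> \bar R) :
  uniq s -> (forall i, 0 <= h i)%E ->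
  (\sum_(i <- s) h i <= \esum_(i in [set: J]) h i)%E.
Proof.
move=> us h0; apply: esum_ge; exists [set` s]; first by split.
by rewrite -fsbig_seq.
Qed.

Lemma le_sum_subseq (J : eqType) (r s : seq J) (h : J -> R) :
  uniq r -> uniq s -> {subset r <= s} -> (forall i, 0 <= h i) ->
  \sum_(i <- r) h i <= \sum_(i <- s) h i.
Proof.
move=> ur us rs h0; rewrite [leRHS](bigID (mem r)) /= -[X in _ <= X + _]big_filter.
rewrite (perm_big [seq i <- s | i \in r]) /=; first by rewrite lerDl sumr_ge0.
apply: uniq_perm => //; first exact: filter_uniq.
by move=> i; rewrite mem_filter /= andb_idr// => /rs.
Qed.

Definition enum_upto (M : nat) : seq int := pmap (@pickle_inv int) (iota 0 M).

Lemma enum_upto_uniq M : uniq (enum_upto M).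
Proof. by apply: (pmap_uniq (@pickle_invK int)); exact: iota_uniq. Qed.

Lemma mem_enum_upto M i : (i \in enum_upto M) = (choice.pickle i < M)%N.
Proof.
rewrite /enum_upto mem_pmap; apply/mapP/idP => [[k]|iM].
  rewrite mem_iota /= add0n => kM E.
  by have := @pickle_invK int k; rewrite -E /= => ->.
by exists (choice.pickle i); rewrite ?mem_iota// pickleK_inv.
Qed.

(** A strict inequality for a supremum over finite sets is already reached along the increasing
    enumeration, so superlevel sets become increasing unions of measurable sets. *)
Lemma lt_esum_int (a : R) (h : int -> R) : (forall i, 0 <= h i) ->
  (a%:E < \esum_(i in [set: int]) (h i)%:E)%E <->
  exists M, a < \sum_(i <- enum_upto M) h i.
Proof.
move=> h0; split; last first.
  move=> [M aM]; apply: lt_le_trans (sum_le_esum (enum_upto_uniq M) _) => //.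
  by rewrite sumEFin lte_fin.
move=> ah; apply: contrapT => nM; move: ah; apply/negP; rewrite -leNgt.
apply: ge_ereal_sup => _ [X [fX _] <-].
rewrite fsbig_finite//= sumEFin lee_fin.
pose M := (\max_(i <- fset_set X) choice.pickle i).+1.
apply: (@le_trans _ _ (\sum_(i <- enum_upto M) h i)).
  apply: le_sum_subseq => //; [exact: fset_uniq|exact: enum_upto_uniq|].
  move=> i iX; rewrite mem_enum_upto ltnS.
  by apply: leq_bigmax_seq.
by rewrite leNgt; apply/negP => aM; apply: nM; exists M.
Qed.

Lemma measure_seqU (I : eqType) (s : seq I) (V : I -> set R) :
  (forall i, measurable (V i)) ->
  measurable [set x | exists2 i, i \in s & V i x] /\
  (mu [set x | exists2 i, i \in s & V i x] <= \sum_(i <- s) mu (V i))%E.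
Proof.
move=> mV; elim: s => [|i s [mU ih]].
  rewrite (_ : [set x | _] = set0); first by rewrite measure0 big_nil.
  by apply/seteqP; split => x // [].
have E : [set x | exists2 j, j \in i :: s & V j x] =
    V i `|` [set x | exists2 j, j \in s & V j x].
  apply/seteqP; split => x /=.
    by move=> [j]; rewrite inE => /predU1P[->|js] Vx; [left|right; exists j].
  move=> [Vx|[j js Vx]]; first by exists i; rewrite ?mem_head.
  by exists j => //; rewrite inE js orbT.
rewrite E; split; first exact: measurableU.
by rewrite big_cons; apply: le_trans (measureU2 mu (mV i) mU) _; rewrite leeD2l.
Qed.

Variables (J : int -> choiceType) (T : forall tau, J tau -> R -> R[i]) (B : R).
Arguments T {tau}.
Hypothesis mT : forall tau (i : J tau), cmeasurable (T i).
Hypothesis weak_type : forall (s : seq int) (A : forall tau, {fset J tau}) (al : R),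
  uniq s -> 0 < al ->
  (al%:E * mu [set x | (al ^+ 2 <
     \sum_(tau <- s) cmod (\sum_(i <- A tau) T i x) ^+ 2)%R] <= B%:E)%E.
Variable g : int -> R -> R[i].
Hypothesis Tg : forall tau, sums_to (@T tau) (g tau).

Let mg tau : cmeasurable (g tau). Proof. by case: (Tg tau). Qed.

Let msum (I : Type) (s : seq I) (h : I -> R -> R[i]) (a : R) :
  (forall i, cmeasurable (h i)) ->
  measurable [set x | (a < \sum_(i <- s) cmod (h i x) ^+ 2)%R].
Proof.
by move=> mh; apply: measurable_gt; apply: measurable_sum => i; exact: measurable_cmod_sqr.
Qed.

(** Each [g tau] is replaced by a partial sum close to it off a small set. Going from height al to
    al / 2 absorbs the error and costs the factor 2; the small sets cost an arbitrary [ep]. *)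
Lemma weak_type_finite_limit (s : seq int) (al : R) : uniq s -> 0 < al ->
  (al%:E * mu [set x | (al ^+ 2 < \sum_(tau <- s) cmod (g tau x) ^+ 2)%R] <= (2 * B)%:E)%E.
Proof.
move=> us al0; apply/lee_addgt0Pr => ep ep0.
pose W := wl2 s (fun=> 1) (fun=> 1 : R).
have W0 : 0 <= W by exact: wl2_ge0.
pose e := al / 2 / (1 + W).
have al2 : 0 < al / 2 by rewrite divr_gt0.
have W1 : 0 < 1 + W by rewrite ltr_pwDl.
have e0 : 0 < e by rewrite divr_gt0.
pose n : R := (size s)%:R.
have n0 : 0 <= n by exact: ler0n.
have n1 : 0 < 1 + n by rewrite ltr_pwDl.
pose de := ep / (al * (1 + n)).
have de0 : 0 < de by rewrite divr_gt0// mulr_gt0.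
have ex tau : exists A : {fset J tau},
    (mu [set x | (e < cmod (\sum_(i <- A) T i x - g tau x))%R] <= de%:E)%E.
  have FT : Filter (@totally (J tau)) by exact: (@filter_filter _ _ (totally_filter)).
  have [_ /(_ e e0) h] := Tg tau.
  have [A _ hA] := (cvge0P FT (fun k => measure_ge0 mu _)).2 h de de0.
  by exists A; apply: hA => /=; exact: fsubset_refl.
pose A tau := projT1 (cid (ex tau)).
pose V tau := [set x | (e < cmod (\sum_(i <- A tau) T i x - g tau x))%R].
have hA tau : (mu (V tau) <= de%:E)%E by exact: (projT2 (cid (ex tau))).
have mTA tau : cmeasurable (fun x => \sum_(i <- A tau) T i x) by exact: cmeasurable_sum.
have mV tau : measurable (V tau).
  by apply: measurable_gt; apply: measurable_cmod; exact: cmeasurableB.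
have [mU hU] := measure_seqU s mV.
pose E1 := [set x | ((al / 2) ^+ 2 < \sum_(tau <- s) cmod (\sum_(i <- A tau) T i x) ^+ 2)%R].
have mE1 : measurable E1 by exact: (msum _ _ mTA).
have sE (F : int -> R[i]) : Num.sqrt (\sum_(tau <- s) cmod (F tau) ^+ 2) =
    wl2 s (fun=> 1) (fun tau => cmod (F tau)).
  by rewrite /wl2; under [in RHS]eq_bigr do rewrite mul1r.
have s0 (F : int -> R[i]) : 0 <= \sum_(tau <- s) cmod (F tau) ^+ 2.
  by apply: sumr_ge0 => tau _; exact: sqr_ge0.
have sub : [set x | (al ^+ 2 < \sum_(tau <- s) cmod (g tau x) ^+ 2)%R] `<=`
    E1 `|` [set x | exists2 tau, tau \in s & V tau x].
  move=> x /= hx.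
  have [hV|nV] := pselect (exists2 tau, tau \in s & V tau x); [by right|left].
  have p1 := @wl2_cmod_perturb R _ s (fun tau => g tau x)
    (fun tau => \sum_(i <- A tau) T i x) (fun=> 1) e (ltW e0).
  have {}p1 := p1 _; rewrite -!sE in p1.
  have p2 : Num.sqrt (\sum_(tau <- s) cmod (g tau x) ^+ 2) <=
      Num.sqrt (\sum_(tau <- s) cmod (\sum_(i <- A tau) T i x) ^+ 2) + e * W.
    apply: p1 => tau ts; rewrite mulr1 leNgt; apply/negP => h; apply: nV.
    by exists tau => //; rewrite /V /= cmodC.
  have a1 : al < Num.sqrt (\sum_(tau <- s) cmod (g tau x) ^+ 2).
    rewrite -(@ltr_pXn2r _ 2)// ?nnegrE ?sqrtr_ge0 ?(ltW al0)//.
    by rewrite sqr_sqrtr.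
  have a2 : e * W <= al / 2.
    by rewrite /e mulrAC ler_pdivrMr// ler_wpM2l ?(ltW al2)// lerDr.
  have a3 := half_lt a1 p2 a2.
  rewrite /E1 /= -(@sqr_sqrtr _ (\sum_(tau <- s) cmod (\sum_(i <- A tau) T i x) ^+ 2))//.
  by rewrite ltr_pXn2r ?nnegrE ?sqrtr_ge0 ?(ltW al2).
apply: (@le_trans _ _ (al%:E * (mu E1 + mu [set x | exists2 tau, tau \in s & V tau x]))%E).
  apply: lee_wpmul2l; first by rewrite lee_fin ltW.
  apply: le_trans (measureU2 mu mE1 mU).
  apply: le_measure; last exact: sub.
  - by rewrite inE; exact: (msum _ _ mg).
  - by rewrite inE; exact: measurableU.
rewrite ge0_muleDr//; apply: leeD.
  have -> : al%:E = (2%:E * (al / 2)%:E)%E by rewrite -EFinM; congr EFin; field.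
  rewrite -muleA [leRHS]EFinM; apply: lee_wpmul2l => //; exact: weak_type.
apply: (@le_trans _ _ (al%:E * (n * de)%:E)%E).
  apply: lee_wpmul2l; first by rewrite lee_fin ltW.
  apply: le_trans hU _; apply: (@le_trans _ _ (\sum_(i <- s) de%:E)%E).
    by apply: lee_sum => tau _; exact: hA.
  by rewrite sumEFin lee_fin big_const_seq count_predT iter_addr_0 mulr_natl.
rewrite -EFinM lee_fin.
have -> : al * (n * de) = ep * (n / (1 + n)) by rewrite /de; field; rewrite !gt_eqF.
by rewrite ler_piMr ?(ltW ep0)// ler_pdivrMr// mul1r lerDr.
Qed.

Lemma weakL1_limit :
  (weakL1 (fun x => sqrte (\esum_(tau in [set: int]) (cmod (g tau x) ^+ 2)%:E))
   <= (2 * B)%:E)%E.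
Proof.
apply: ge_ereal_sup => _ [al /= al0 <-].
pose E M := [set x | (al ^+ 2 < \sum_(tau <- enum_upto M) cmod (g tau x) ^+ 2)%R].
have mE M : measurable (E M) by exact: msum.
have -> : [set x | (al%:E < sqrte (\esum_(tau in [set: int]) (cmod (g tau x) ^+ 2)%:E))%E] =
    \bigcup_M E M.
  have iff x : (al%:E < sqrte (\esum_(tau in [set: int]) (cmod (g tau x) ^+ 2)%:E))%E <->
      exists M, E M x.
    have aE : al%:E = sqrte ((al ^+ 2)%:E) by rewrite /= sqrtr_sqr gtr0_norm.
    rewrite aE ltNge lee_sqrt ?lee_fin ?sqr_ge0// -ltNge.
    by apply: lt_esum_int => tau; exact: sqr_ge0.
  apply/seteqP; split => x /=; first by move=> /iff[M EM]; exists M.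
  by move=> [M _ EM]; apply/iff; exists M.
have nd : {homo E : n m / (n <= m)%N >-> (n <= m)%O}.
  move=> n k nk; apply/subsetPset => x /= h; apply: lt_le_trans h _.
  apply: le_sum_subseq => [| | |tau]; try exact: enum_upto_uniq; last exact: sqr_ge0.
  by move=> tau; rewrite !mem_enum_upto => /leq_trans; apply.
have mU : measurable (\bigcup_M E M) by exact: bigcup_measurable.
rewrite -lee_pdivlMl//.
have cv : (mu \o E) x @[x --> \oo] --> mu (\bigcup_M E M) by exact: nondecreasing_cvg_mu.
rewrite -(cvg_lim _ cv)//.
apply: lime_le; first by apply/cvg_ex; eexists; exact: cv.
apply: nearW => M /=; rewrite lee_pdivlMl//.
by apply: weak_type_finite_limit => //; exact: enum_upto_uniq.
Qed.

End SquareFunctionOfLimits.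

(** * Assembly of the final estimate *)

Section Assembly.
Context {R : realType}.
Local Notation mu := (@lebesgue_measure R).
Variables (J : int -> choiceType) (N : int -> R) (F : forall tau, J tau -> R -> R).
Arguments F {tau}.
Hypothesis N0 : forall tau, 0 <= N tau.

Definition weighted_l2 x : \bar R :=
  sqrte (\esum_(tau in [set: int])
    ((N tau)%:E * \esum_(i in [set: J tau]) (`|F i x| ^+ 2)%:E))%E.

Lemma weighted_l2_ge0 x : (0 <= weighted_l2 x)%E.
Proof. exact: sqrte_ge0. Qed.

Let inner_ge0 x tau :
  (0 <= (N tau)%:E * \esum_(i in [set: J tau]) (`|F i x| ^+ 2)%:E)%E.
Proof.
apply: mule_ge0; first by rewrite lee_fin.
by apply: esum_ge0 => i _; rewrite lee_fin sqr_ge0.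
Qed.

Lemma le_weighted_l2 (s : seq int) (A : forall tau, {fset J tau}) x : uniq s ->
  ((Num.sqrt (\sum_(tau <- s) N tau * \sum_(i <- A tau) F i x ^+ 2))%:E
   <= weighted_l2 x)%E.
Proof.
move=> us; have -> (r : R) : (Num.sqrt r)%:E = sqrte r%:E by [].
rewrite lee_sqrt; last by apply: esum_ge0.
apply: le_trans (sum_le_esum us (inner_ge0 x)).
rewrite -sumEFin; apply: lee_sum => tau _.
rewrite EFinM; apply: lee_wpmul2l; first by rewrite lee_fin.
have h0 (i : J tau) : (0 <= (`|F i x| ^+ 2)%:E)%E by rewrite lee_fin sqr_ge0.
apply: le_trans (sum_le_esum (fset_uniq (A tau)) h0).
by rewrite -sumEFin; apply: lee_sum => i _; rewrite lee_fin real_normK// num_real.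
Qed.

Lemma le_weighted_l2_single tau (A : {fset J tau}) x :
  ((l2sum (@F tau) (N tau) A x)%:E <= weighted_l2 x)%E.
Proof.
(* The single set becomes a dependent family by transport along tau = tau', empty elsewhere. *)
pose A' tau' : {fset J tau'} :=
  if pselect (tau = tau') is left e then ecast z {fset J z} e A else fset0.
have -> : A = A' tau.
  by rewrite /A'; case: pselect => // e; rewrite (eq_irrelevance e erefl).
have := le_weighted_l2 A' x (isT : uniq [:: tau]).
by rewrite big_seq1.
Qed.

End Assembly.

Theorem proposition3p4 (R : realType) (C0 : R) (hC0 : 0 < C0) :
  exists2 C : R, 0 < C &
  forall (J : int -> choiceType)
    (I : forall tau : int, J tau -> interval R)
    (N : int -> nat)
    (m f : forall tau : int, J tau -> R -> R[i])
    (F : forall tau : int, J tau -> R -> R),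
  (forall tau, (0 < N tau)%N) ->
  (forall tau (i : J tau),
     bounded_set [set` I tau i] /\ 0 < itv_length (I tau i)) ->
  (forall tau (x : R),
     (\esum_(i in [set: J tau]) (\1_[set` I tau i] x : R)%:E
        <= (N tau)%:R%:E)%E) ->
  (forall tau (i : J tau) (xi : R), xi \notin I tau i -> m tau i xi = 0) ->
  (forall tau (i : J tau), exists2 xi0 : R, xi0 \in I tau i &
     HM_multiplier (fun xi => m tau i (xi + xi0)) /\
     (HM_norm (fun xi => m tau i (xi + xi0)%R) <= 1)%E) ->
  (forall tau (i : J tau), cmeasurable (f tau i)) ->
  (forall tau (i : J tau), measurable_fun [set: R] (F tau i)) ->
  (forall tau (i : J tau) (x : R), 0 <= F tau i x) ->
  (forall tau (i : J tau),
     {ae @lebesgue_measure R, forall x : R,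
       ((cmod (f tau i x))%:E <=
          C0%:E * convolution (dilate (itv_length (I tau i))^-1%R phi) (F tau i) x)%E}) ->
  let T tau (i : J tau) : R -> R[i] :=
    multiplier_op (m tau i) (f tau i) in
  let rhs : \bar R :=
    (\int[@lebesgue_measure R]_x
       sqrte (\esum_(tau in [set: int])
         ((N tau)%:R%:E *
          \esum_(i in [set: J tau]) (`|F tau i x| ^+ 2)%:E)))%E in
  ((rhs < +oo)%E -> forall tau, exists g : R -> R[i], sums_to (@T tau) g) /\
  (forall g : int -> R -> R[i],
     (forall tau, sums_to (@T tau) (g tau)) ->
     (weakL1 (fun x =>
        sqrte (\esum_(tau in [set: int]) (cmod (g tau x) ^+ 2)%:E))
      <= C%:E * rhs)%E).
Proof.
(* 2 C0 is the constant for [bump] in place of [phi]. The final constant doubles K because limits of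
   partial sums are compared at half the height. *)
pose K : R := 6 * (2 * C0) * core_const.
have C10 : 0 < 2 * C0 by rewrite mulr_gt0.
have K0 : 0 < K by rewrite mulr_gt0 ?core_const_gt0// mulr_gt0.
exists (2 * K); first by rewrite mulr_gt0.
move=> J I N m f F N0 bI ov sm hm mf mF F0 fF T rhs.
pose NR tau : R := (N tau)%:R.
have NR0 tau : 0 <= NR tau by exact: ler0n.
have rhsE : rhs = (\int[@lebesgue_measure R]_x weighted_l2 NR F x)%E by [].
have rhs0 : (0 <= rhs)%E by apply: integral_ge0 => x _; exact: weighted_l2_ge0.
have choice tau (i : J tau) : exists p : (R -> R[i]) * R,
    [/\ hm_mult p.1 [set` I tau i] p.2, cmeasurable (m tau i) &
        forall xi, xi != p.2 -> p.1 xi = m tau i xi].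
  have [xi0 _ [h1 h2]] := hm tau i.
  have [mm [m' hm' E]] := hm_mult_of_HM (bI tau i).1 (sm tau i) h1 h2.
  by exists (m', xi0).
pose m' tau (i : J tau) := (projT1 (cid (choice tau i))).1.
pose xi0 tau (i : J tau) := (projT1 (cid (choice tau i))).2.
have hm' tau (i : J tau) : hm_mult (m' tau i) [set` I tau i] (xi0 tau i).
  by case: (projT2 (cid (choice tau i))).
pose t tau (i : J tau) := (itv_length (I tau i))^-1.
have t0 tau (i : J tau) : 0 < t tau i by rewrite invr_gt0; case: (bI tau i).
have fF' tau (i : J tau) : {ae @lebesgue_measure R, forall x,
    ((cmod (f tau i x))%:E <= (2 * C0)%:E * bconv (t tau i) (F tau i) x)%E}.
  apply: ae_imply (fF tau i) => x h; apply: le_trans h _.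
  rewrite mulrC EFinM -muleA; apply: lee_wpmul2l; first by rewrite lee_fin ltW.
  exact: (convolution_le_bconv (t0 tau i) (mF tau i) (F0 tau i)).
have overlap tau (A : {fset J tau}) x :
    \sum_(i <- A) (\1_[set` I tau i] x : R) <= NR tau.
  rewrite -lee_fin -sumEFin; apply: le_trans (ov tau x).
  by apply: sum_le_esum => // i; rewrite lee_fin indicE.
have [rhsy|rhsy] := leP +oo%E rhs.
  have E : rhs = +oo%E by apply/eqP; rewrite eq_le leey rhsy.
  split=> [//|g _].
  by rewrite E gt0_muley ?leey// lte_fin mulr_gt0.
have [rho rho0 rhoE] : exists2 rho, 0 <= rho & rhs = rho%:E.
  by move: rhsy rhs0; case: (rhs) => // r _; exists r.
have single tau (A : {fset J tau}) : (nint (l2sum (F tau) (NR tau) A) <= rho%:E)%E.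
  rewrite -rhoE rhsE; apply: le_integral_nonmeasurable => x.
    by rewrite lee_fin l2sum_ge0.
  exact: le_weighted_l2_single.
(* As N tau >= 1, a single F is dominated by its one-element square function, hence integrable when
   the right-hand side is finite. *)
have Fi tau (i : J tau) : (nint (F tau i) < +oo)%E.
  apply: le_lt_trans (ltry rho); apply: le_trans (single tau [fset i]%fset).
  apply: le_nint => // x; rewrite /l2sum big_seq_fset1.
  rewrite -{1}[F tau i x]ger0_norm// -sqrtr_sqr; apply: ler_wsqrtr.
  by rewrite ler_peMl ?sqr_ge0// ler1n.
have fi tau (i : J tau) : cintegrable (f tau i).
  exact: (cintegrable_of_bconv (mf tau i) (mF tau i) (F0 tau i) (Fi tau i)
    (t0 tau i) (ltW C10) (fF' tau i)).
have TE tau (i : J tau) : T tau i = multiplier_op (m' tau i) (f tau i).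
  rewrite /m'; case: (cid (choice tau i)) => /= p [h1 h2 h3].
  exact: (eq_multiplier_op h2 (hm_meas h1) (fi tau i) h3).
have mT tau (i : J tau) : cmeasurable (T tau i).
  by rewrite TE; exact: (measurable_multiplier_op (hm' tau i) (fi tau i)).
have weak (s : seq int) (A : forall tau, {fset J tau}) (al : R) : uniq s -> 0 < al ->
    (al%:E * @lebesgue_measure R [set x | (al ^+ 2 <
      \sum_(tau <- s) cmod (\sum_(i <- A tau) T tau i x) ^+ 2)%R] <= (K * rho)%:E)%E.
  move=> us al0.
  have h := @finite_weak_type R int s J A m' (fun tau i => [set` I tau i]) xi0 NR hm'
    (fun tau x => overlap tau (A tau) x) f F t (2 * C0) t0 C10 mf mF F0 Fi fF' al al0.
  have E : (fun x => \sum_(tau <- s) cmod (\sum_(i <- A tau) T tau i x) ^+ 2) =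
      sqfun s A m' f.
    apply/funext => x; apply: eq_bigr => tau _; congr (cmod _ ^+ 2).
    by apply: eq_bigr => i _; rewrite TE.
  have -> : [set x | al ^+ 2 < \sum_(tau <- s) cmod (\sum_(i <- A tau) T tau i x) ^+ 2] =
      [set x | al ^+ 2 < sqfun s A m' f x].
    by rewrite -E.
  apply: le_trans h _; rewrite [leRHS]EFinM; apply: lee_wpmul2l; first by rewrite lee_fin ltW.
  rewrite -rhoE rhsE; apply: le_integral_nonmeasurable => x.
    by rewrite lee_fin fnorm_ge0.
  have := le_weighted_l2 F NR0 A x us; congr (_%:E <= _)%E.
  rewrite /Fnorm /fnorm /wl2; congr Num.sqrt.
  rewrite big_allpairs_dep; apply: eq_bigr => tau _.
  by rewrite mulr_sumr; apply: eq_bigr.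
split=> [_ tau|g Tg].
  (* For one tau the finite estimate is used over a one-point index type, where [sqfun] is the
     squared modulus of the partial sum. *)
  apply: (@ex_sums_to R (J tau) (T tau) (F tau) (NR tau) K rho) => // A al al0.
  have h := @finite_weak_type R unit [:: tt] (fun=> J tau) (fun=> A) (fun=> m' tau)
    (fun _ i => [set` I tau i]) (fun=> xi0 tau) (fun=> NR tau) (fun=> hm' tau)
    (fun _ x => overlap tau A x) (fun=> f tau) (fun=> F tau) (fun=> t tau) (2 * C0)
    (fun=> t0 tau) C10 (fun=> mf tau) (fun=> mF tau) (fun=> F0 tau) (fun=> Fi tau)
    (fun=> fF' tau) al al0.
  have -> : [set x | al < cmod (\sum_(i <- A) T tau i x)] =
      [set x | al ^+ 2 < sqfun [:: tt] (fun=> A) (fun=> m' tau) (fun=> f tau) x].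
    apply/seteqP; split => x /=; rewrite /sqfun big_seq1;
      rewrite ltr_pXn2r ?nnegrE ?cmod_ge0 ?(ltW al0)//;
      by under eq_bigr do rewrite TE.
  apply: le_trans h _; apply: lee_wpmul2l; first by rewrite lee_fin ltW.
  apply: le_nint => x; first exact: fnorm_ge0.
  rewrite /Fnorm /fnorm /wl2 /l2sum; apply: ler_wsqrtr.
  by rewrite big_allpairs_dep big_seq1 mulr_sumr.
rewrite rhoE -EFinM -mulrA; exact: (weakL1_limit mT weak Tg).
Qed.
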